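(* Let $0<\alpha<\pi$. The discrete maps corresponding to the circle patterns $Z^2$ and $\mathrm{Log}$ (with intersection angles given by $\alpha$) are embedded.
   Context: Let $\mathbf{V}=\{z=N+iM: N,M\in\mathbf{Z},\ M\ge|N|\}$. For a function $z\mapsto R_z$ on $\mathbf{V}$ and a parameter $\gamma$, consider (with $z=N+iM$) (A) $-MR_zR_{z+1}+(N+1)R_{z+1}R_{z+1+i}+(M+1)R_{z+1+i}R_{z+i}-NR_{z+i}R_z=\frac{\gamma}{2}(R_z+R_{z+1+i})(R_{z+1}+R_{z+i})$ for $z\in\mathbf{V}\cup\{-N+i(N-1): N\in\mathbf{N},N\ge1\}$; (B) $(N+M)(R_{z+i}+R_{z+1})\big(R_z^2-R_{z+1}R_{z-i}+\cos\alpha\,R_z(R_{z-i}-R_{z+1})\big)+(M-N)(R_{z-i}+R_{z+1})\big(R_z^2-R_{z+1}R_{z+i}+\cos\alpha\,R_z(R_{z+i}-R_{z+1})\big)=0$ for $z\in\mathbf{V}\setminus\{\pm N+iN: N\ge 0\}$. In (A), for $z=N+iN$ the factor $R_{z+1}+R_{z+i}$, and for $z=-N+i(N-1)$ the factor $R_z+R_{z+1+i}$, is common to both sides; the equation is understood after cancelling it, so only values of $R$ on $\mathbf{V}$ occur. The circle pattern $Z^2$ is the circle pattern $\{C(z)\}_{z\in\mathbf{V}}$ whose radius function $R$ satisfies (A), (B) with $\gamma=2$ and the initial data $R_0=0$, $R_{1+i}=1$, $R_i=\frac{\sin\alpha}{\alpha}$. (These data arise as the limit $\gamma\to2-0$ of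 the radius functions of $\frac{2-\gamma}{\gamma}Z^{\gamma}$, where $Z^\gamma$ is the solution $f:\mathbf{Z}_+^2\to\mathbf{C}$ of the cross-ratio equation $\frac{(f_{n,m}-f_{n+1,m})(f_{n+1,m+1}-f_{n,m+1})}{(f_{n+1,m}-f_{n+1,m+1})(f_{n,m+1}-f_{n,m})}=e^{-2i\alpha}$ and the constraint $\gamma f_{n,m}=2n\frac{(f_{n+1,m}-f_{n,m})(f_{n,m}-f_{n-1,m})}{f_{n+1,m}-f_{n-1,m}}+2m\frac{(f_{n,m+1}-f_{n,m})(f_{n,m}-f_{n,m-1})}{f_{n,m+1}-f_{n,m-1}}$ with $f_{1,0}=1$, $f_{0,1}=e^{i\gamma\alpha}$; in particular $R_{-1+i}=1$ as well.) The circle pattern $\mathrm{Log}$ is the dual of $Z^2$: the circle pattern with radius function $z\mapsto 1/R_z$, where $R$ is the radius function of $Z^2$; it satisfies (A), (B) with $\gamma=0$. For $\mathrm{Log}$ the radius at $z=0$ is infinite, so the point $f_{0,0}$ is at infinity and the map is considered on $\mathbf{Z}^2_+\setminus\{(0,0)\}$. Here, in the pattern, $C(z)$ and $C(z+i)$ intersect at angle $\alpha$, $C(z)$ and $C(z+1)$ at angle $\pi-\alpha$ (intersection angle = angle at the corner of the intersection of the two discs), and the discs of $C(z)$ and $C(z\pm1+i)$ are tangent and disjoint. The discrete map $f_{n,m}$, $n,m\ge0$, corresponding to a circle pattern $\{C(z)\}_{z\in\mathbf V}$ is: if $n+m$ is even, $f_{n,m}$ is the center of $C(\frac{n-m}{2}+i\frac{n+m}{2})$;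 if $n+m$ is odd, $f_{n,m}$ is the common point $C(\frac{n-m-1}{2}+i\frac{n+m-1}{2})\cap C(\frac{n-m+1}{2}+i\frac{n+m+1}{2})=C(\frac{n-m+1}{2}+i\frac{n+m-1}{2})\cap C(\frac{n-m-1}{2}+i\frac{n+m+1}{2})$ (circles whose index lies outside $\mathbf{V}$ being disregarded). The elementary quadrilaterals are $(f_{n,m},f_{n+1,m},f_{n+1,m+1},f_{n,m+1})$. A discrete map is embedded if the inner parts of different elementary quadrilaterals do not intersect. *)

(* Defs.v *)
From HB Require Import structures.
From mathcomp Require Import all_boot all_order all_algebra.
From mathcomp Require Import all_classical all_reals all_analysis.

Set Implicit Arguments.
Unset Strict Implicit.
Unset Printing Implicit Defensive.

Import Order.TTheory GRing.Theory Num.Theory.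
Import numFieldNormedType.Exports.

Local Open Scope classical_set_scope.
Local Open Scope ring_scope.

(* The complex plane is [R * R].  The norm [`|_|] of this product space is the
   max norm, hence the separate Euclidean norm; topology and boundedness are
   the same for both. *)
Section Plane.
Variable R : realType.
Implicit Types u v p q : R * R.

Definition dot u v : R := u.1 * v.1 + u.2 * v.2.
Definition det2 u v : R := u.1 * v.2 - u.2 * v.1.
Definition enorm u : R := Num.sqrt (dot u u).
Definition angle u v : R := acos (dot u v / (enorm u * enorm v)).

Definition segment p q : set (R * R) :=
  [set p + t *: (q - p) | t in [set t : R | 0 <= t <= 1]].

Definition quad_boundary p0 p1 p2 p3 : set (R * R) :=
  segment p0 p1 `|` segment p1 p2 `|` segment p2 p3 `|` segment p3 p0.

(* The quadrilaterals of a circle pattern need not be convex, so the inner part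
   is the Jordan interior: the union of the bounded components of the
   complement of the boundary.  It is empty for a quadrilateral that
   degenerates to a segment.  The first conjunct is needed because
   [connected_component A p] is empty when [p] is not in [A]. *)
Definition quad_inner p0 p1 p2 p3 : set (R * R) :=
  [set p | (~` quad_boundary p0 p1 p2 p3) p /\
           bounded_set (connected_component (~` quad_boundary p0 p1 p2 p3) p)].

(* Generalised circles: [Circle c r] has centre [c] and radius [r];
   [Line q n] is the line through [q] orthogonal to [n], that is, a circle of
   infinite radius whose disc is the closed half-plane into which [n] points. *)
Inductive circle : Type :=
  | Circle of R * R & R
  | Line of R * R & R * R.

Definition valid_circle (g : circle) : Prop :=
  match g with Circle _ r => 0 <= r | Line _ n => n <> 0 end.

Definition radius (g : circle) : \bar R :=
  match g with Circle _ r => r%:E | Line _ _ => +oo%E end.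

Definition rim (g : circle) : set (R * R) :=
  match g with
  | Circle c r => [set p | enorm (p - c) = r]
  | Line q n => [set p | dot (p - q) n = 0]
  end.

Definition disc (g : circle) : set (R * R) :=
  match g with
  | Circle c r => [set p | enorm (p - c) <= r]
  | Line q n => [set p | 0 <= dot (p - q) n]
  end.

(* A vector normal to the circle at its point [p], pointing into the disc. *)
Definition inner_normal (g : circle) p : R * R :=
  match g with Circle c _ => c - p | Line _ n => n end.

(* At a common point [p] of two circles, the intersection of the two discs has
   a corner bounded by the two tangents; its angle is the supplement of the
   angle between the inner normals. *)
Definition corner_angle p (g h : circle) : R :=
  pi - angle (inner_normal g p) (inner_normal h p).

(* A circle of radius 0 has no tangent; only incidence is then required. *)
Definition intersect_at_angle (theta : R) (g h : circle) : Prop :=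
  exists p, [/\ rim g p, rim h p &
    (0 < radius g)%E -> (0 < radius h)%E -> corner_angle p g h = theta].

Definition tangent_disjoint (g h : circle) : Prop :=
  exists p, [/\ rim g p, rim h p & disc g `&` disc h = [set p]].

End Plane.

(* The lattice point N + iM is given by the pair of integers N, M. *)
Definition inV (N M : int) : bool := `|N| <= M.

(* The equations, with z = N + iM.  The first field is the equation at those z
   for which z, z+1, z+i and z+1+i all belong to V; the two others are the
   equations at z = N + iN and at z = -N + i(N-1), where one of the four points
   lies outside V and the common factor is cancelled. *)
Record eqA (R : realType) (gamma : R) (r : int -> int -> R) : Prop := {
  eqA_interior : forall N M : int, inV N M -> inV (N + 1) M ->
    - M%:~R * r N M * r (N + 1) M
    + (N + 1)%:~R * r (N + 1) M * r (N + 1) (M + 1)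
    + (M + 1)%:~R * r (N + 1) (M + 1) * r N (M + 1)
    - N%:~R * r N (M + 1) * r N M
    = gamma / 2 * (r N M + r (N + 1) (M + 1)) * (r (N + 1) M + r N (M + 1));
  eqA_right : forall N : int, 0 <= N ->
    (N + 1)%:~R * r (N + 1) (N + 1) - N%:~R * r N N
    = gamma / 2 * (r N N + r (N + 1) (N + 1));
  eqA_left : forall N : int, 1 <= N ->
    N%:~R * r (- N) N - (N - 1)%:~R * r (- (N - 1)) (N - 1)
    = gamma / 2 * (r (- (N - 1)) (N - 1) + r (- N) N) }.

Definition eqB (R : realType) (alpha : R) (r : int -> int -> R) : Prop :=
  forall N M : int, inV N M -> `|N| != M ->
    (N + M)%:~R * (r N (M + 1) + r (N + 1) M)
      * (r N M ^+ 2 - r (N + 1) M * r N (M - 1)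
         + cos alpha * r N M * (r N (M - 1) - r (N + 1) M))
    + (M - N)%:~R * (r N (M - 1) + r (N + 1) M)
      * (r N M ^+ 2 - r (N + 1) M * r N (M + 1)
         + cos alpha * r N M * (r N (M + 1) - r (N + 1) M)) = 0.

(* The equations leave the value at -1+i free when gamma = 2 and the value
   at 0 vanishes, so it belongs to the initial data. *)
Definition Z2_initial (R : realType) (alpha : R) (r : int -> int -> R) : Prop :=
  [/\ r 0 0 = 0, r 1 1 = 1, r (-1) 1 = 1 & r 0 1 = sin alpha / alpha].

Section Pattern.
Variable R : realType.
Implicit Types (C : int -> int -> circle R) (f : nat -> nat -> R * R).

(* [cell N M]: the square z, z+1, z+1+i, z+i with z = N + iM has both upper
   vertices in V; it then has at least three vertices in V. *)
Definition cell (N M : int) : bool := inV N (M + 1) && inV (N + 1) (M + 1).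

Definition cell_point C (N M : int) : set (R * R) :=
  [set p | forall N' M' : int, N <= N' <= N + 1 -> M <= M' <= M + 1 ->
             inV N' M' -> rim (C N' M') p].

(* Seen from [p], the disc of index w' follows that of index w
   counterclockwise; void for indices outside V and circles of radius 0. *)
Definition ccw C (p : R * R) (w w' : int * int) : Prop :=
  inV w.1 w.2 -> inV w'.1 w'.2 ->
  (0 < radius (C w.1 w.2))%E -> (0 < radius (C w'.1 w'.2))%E ->
  0 < det2 (inner_normal (C w.1 w.2) p) (inner_normal (C w'.1 w'.2) p).

(* Only the circle C(0) may degenerate to a point or to a straight line.
   The angle conditions determine the position of the circles around a common
   point up to a reflection.  [cp_cell] requires the four circles to be placed
   as the indices z, z+1, z+1+i, z+i in the plane, so that the pattern does not
   fold; it also tells apart the two common points of C(z) and C(z+1), or of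
   C(z) and C(z+i). *)
Record circle_pattern (alpha : R) C : Prop := {
  cp_valid : forall N M, inV N M -> valid_circle (C N M);
  cp_regular : forall N M, inV N M -> (N, M) <> (0, 0) ->
    (0 < radius (C N M) < +oo)%E;
  cp_vertical : forall N M, inV N M -> inV N (M + 1) ->
    intersect_at_angle alpha (C N M) (C N (M + 1));
  cp_horizontal : forall N M, inV N M -> inV (N + 1) M ->
    intersect_at_angle (pi - alpha) (C N M) (C (N + 1) M);
  cp_tangent_right : forall N M, inV N M -> inV (N + 1) (M + 1) ->
    tangent_disjoint (C N M) (C (N + 1) (M + 1));
  cp_tangent_left : forall N M, inV N M -> inV (N - 1) (M + 1) ->
    tangent_disjoint (C N M) (C (N - 1) (M + 1));
  cp_cell : forall N M, cell N M ->
    exists p, [/\ cell_point C N M p,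
      ccw C p (N, M) (N + 1, M), ccw C p (N + 1, M) (N + 1, M + 1),
      ccw C p (N + 1, M + 1) (N, M + 1) & ccw C p (N, M + 1) (N, M)] }.

(* The centre of a straight line is at infinity and is not constrained. *)
Definition centered_at (g : circle R) (p : R * R) : Prop :=
  match g with Circle c _ => p = c | Line _ _ => True end.

(* Every integer division below is exact. *)
Definition discrete_map C f : Prop := forall n m : nat,
  if odd (n + m)
  then cell_point C ((n%:Z - m%:Z - 1) %/ 2)%Z ((n%:Z + m%:Z - 1) %/ 2)%Z (f n m)
  else centered_at (C ((n%:Z - m%:Z) %/ 2)%Z ((n%:Z + m%:Z) %/ 2)%Z) (f n m).

Definition Z2_pattern (alpha : R) C : Prop :=
  circle_pattern alpha C /\
  exists r : int -> int -> R,
    [/\ forall N M, inV N M -> radius (C N M) = (r N M)%:E,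
        eqA 2 r, eqB alpha r & Z2_initial alpha r].

(* The inverse is that of the extended reals, where 0^-1 = +oo. *)
Definition Log_pattern (alpha : R) C : Prop :=
  circle_pattern alpha C /\
  exists C0, Z2_pattern alpha C0 /\
    forall N M, inV N M -> radius (C N M) = ((radius (C0 N M))^-1)%E.

Definition elementary_inner f (n m : nat) : set (R * R) :=
  quad_inner (f n m) (f n.+1 m) (f n.+1 m.+1) (f n m.+1).

(* [D] is the domain of the discrete map; an elementary quadrilateral has its
   four vertices there. *)
Definition embedded (D : nat -> nat -> bool) f : Prop :=
  forall n m n' m' : nat,
    [&& D n m, D n.+1 m, D n.+1 m.+1 & D n m.+1] ->
    [&& D n' m', D n'.+1 m', D n'.+1 m'.+1 & D n' m'.+1] ->
    (n, m) <> (n', m') ->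
    elementary_inner f n m `&` elementary_inner f n' m' = set0.

End Pattern.

Definition Z2_domain (n m : nat) : bool := true.
Definition Log_domain (n m : nat) : bool := (n, m) != (0%N, 0%N).

(* Main.v *)
(* The radius at z = N + iM, N >= 0, is M times the absolute value of the
   Verblunsky coefficient of index M - N of the weight (cos phi - cos x)^N on
   the arc |phi| <= x of the unit circle (x being the angle alpha), and the
   radii are symmetric in N.  Relations between the orthogonal polynomials for
   N and N + 1 give (A), (B) and the positivity of the radii; conversely (A),
   (B) and the initial data determine the radius function.  They also give the
   directions of the edges in closed form.

   All the horizontal edges of the discrete map lie in a sector of opening x
   and the vertical ones in the sector rotated by x.  Hence some linear form H
   increases along horizontal edges and decreases along vertical ones, and the
   quadrilaterals met by a level line of H form a monotone staircase which the
   line visits one after the other; so no point is in two quadrilaterals.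

   Around a point common to four circles the angles leave only one unknown, a
   unit vector, and the closing conditions of the quadrilaterals propagate it
   from one point to all others.  Therefore every pattern with these radii is a
   rotated and translated copy of the explicit one. *)

Require Import Defs.
From mathcomp Require Import all_boot all_order all_algebra.
From mathcomp Require Import all_classical all_reals all_analysis.
From mathcomp Require Import zify ring lra.
Set Implicit Arguments.
Unset Strict Implicit.
Unset Printing Implicit Defensive.
Import Order.TTheory GRing.Theory Num.Theory.
Import numFieldNormedType.Exports.
Local Open Scope ring_scope.

(** * Moments of the weight *)

(** The weight enters only through its moments, given by a recursion instead of integrals.
    Positivity of the norms, which an integral would give at once, is recovered from the dependence
    on the angle: a squared norm vanishes at [x = 0], and its derivative in [x] is [N * sin x] times
    the squared norm for the exponent [N - 1], or |f(e^{ix})|^2 when [N = 0].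

    The bridge from the polynomials to the geometry is [slope], a ratio of norms for the exponents
    [N + 1] and [N]. The Christoffel and semiclassical relations are linear in the radii with this
    single extra parameter, and they make [slant] the length of e^{ix} + [slope]. The edge
    directions are the unit vectors (e^{ix} + slope) / slant, so that (A), (B) and the closing of
    the quadrilaterals become rational identities.

    The origin needs care. The circle there is a point or a line, so no closing condition is
    available for the quadrilateral at (0, 0), and rigidity has to carry directions from (1, 0) to
    (0, 1) around it. *)

Section Moments.
Variable R : realType.
Implicit Types (x y : R) (i j : int) (f g : {poly R}).

(* The integral of [cos (j phi) * (cos phi - cos x) ^ N] for [phi] from 0 to [x]. *)
Fixpoint moment x N j : R :=
  if N is N'.+1 then
    (moment x N' (j + 1) + moment x N' (j - 1)) / 2 - cos x * moment x N' j
  else if j == 0 then x else sin (j%:~R * x) / j%:~R.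

#[global] Arguments moment : simpl never.

Lemma moment0E x j : moment x 0 j = if j == 0 then x else sin (j%:~R * x) / j%:~R.
Proof. by []. Qed.

Lemma momentS x N j : moment x N.+1 j =
  (moment x N (j + 1) + moment x N (j - 1)) / 2 - cos x * moment x N j.
Proof. by []. Qed.

Lemma momentN x N j : moment x N (- j) = moment x N j.
Proof.
elim: N j => [|N IH] j; rewrite ?momentS.
  rewrite !moment0E oppr_eq0; case: ifP => // _.
  by rewrite intrN mulNr sinN invrN mulrN mulNr opprK.
have -> : - j + 1 = - (j - 1) by rewrite opprB addrC.
have -> : - j - 1 = - (j + 1) by rewrite opprD.
by rewrite !IH [_ (j - 1) + _]addrC.
Qed.

Lemma moment_at0 N j : moment 0 N j = 0.
Proof.
elim: N j => [|N IH] j; rewrite ?momentS.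
  by rewrite moment0E; case: ifP => // _; rewrite mulr0 sin0 mul0r.
by rewrite !IH; lra.
Qed.

(* Integration by parts; the boundary terms vanish. *)
Lemma moment_by_parts x N j : j%:~R * moment x N.+1 j =
  (N.+1)%:R / 2 * (moment x N (j - 1) - moment x N (j + 1)).
Proof.
elim: N j => [|N IH] j.
  rewrite momentS !moment0E.
  have mul_sinc i : i%:~R * (if i == 0 then x else sin (i%:~R * x) / i%:~R) =
      sin (i%:~R * x) :> R.
    case: eqP => [->|/eqP i0]; first by rewrite !mul0r sin0.
    by rewrite mulrC divfK ?intr_eq0.
  have H1 := mul_sinc (j + 1); have H2 := mul_sinc (j - 1); have H3 := mul_sinc j.
  move: H1 H2 H3; rewrite !intrD !intrN !mulrDl !mulNr !rmorph1 !mul1r.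
  rewrite sinD (sinD _ (- x)) sinN cosN.
  set m1 := (if j + 1 == 0 then _ else _); set m2 := (if j - 1 == 0 then _ else _).
  set m3 := (if j == 0 then _ else _) => H1 H2 H3.
  rewrite mulrBr [_ * (cos x * _)]mulrCA H3; lra.
rewrite momentS.
have := IH (j + 1); have := IH (j - 1); have := IH j.
rewrite !intrD !intrN ?(addrK, subrK).
have := momentS x N (j + 1); have := momentS x N (j - 1).
rewrite ?(addrK, subrK); rewrite -[N.+2%:R]natr1.
move: (moment x N.+1) (moment x N) => m' m Eb Ea H3 H2 H1.
rewrite mulrBr [_ * (cos x * _)]mulrCA H3; move: H1 H2; rewrite !mulrDl !mul1r => H1 H2.
have EK := congr2 (fun u v => N.+1%:R * (u - v)) Ea Eb.
move: EK; rewrite /= => EK; lra.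
Qed.

(** The derivative in [x]. For a positive exponent the integrand vanishes at the end point, so only
    the derivative of [- cos x] inside the power contributes; for exponent 0 it is the integrand at
    the end point. *)
Definition moment' x N j : R :=
  if N is N'.+1 then N'.+1%:R * sin x * moment x N' j else cos (j%:~R * x).

Global Instance is_derive_moment x N j :
  is_derive x 1 (fun y : R => moment y N j) (moment' x N j).
Proof.
elim: N j => [|N IH] j.
  have -> : (fun y : R => moment y 0 j) =
      (fun y => if j == 0 then y else sin (j%:~R * y) / j%:~R) by [].
  rewrite /=; case: eqP => [->|/eqP j0].
    by rewrite mul0r cos0; exact: is_derive_id.
  have -> : (fun y : R => sin (j%:~R * y) / j%:~R) =
      (j%:~R^-1) \*: ((@sin R) \o (j%:~R \*: (@id R))).
    by apply/funext => y /=; rewrite mulrC.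
  apply: is_derive_eq.
  by rewrite /GRing.scale /= mulr1 mulrC mulfK ?intr_eq0.
have -> : (fun y : R => moment y N.+1 j) =
  (2^-1) \*: ((fun y => moment y N (j + 1)) + (fun y => moment y N (j - 1))) -
  (@cos R) * (fun y => moment y N j).
  by apply/funext => y /=; rewrite momentS mulrC.
apply: is_derive_eq.
rewrite /GRing.scale /= {IH}.
case: N => [|N] /=.
  by rewrite !intrD intrN !mulrDl mulNr !mul1r cosD cosB; lra.
by rewrite -[N.+2%:R]natr1 [moment x N.+1 j]momentS; lra.
Qed.

(** Half the inner product of [f] with z^j over the arc; the half arises because the moments
    integrate over half of the arc only. *)
Definition pairing x N f j : R := \sum_(i < size f) f`_i * moment x N (i%:Z - j).

Definition sqnorm x N f : R := \sum_(j < size f) f`_j * pairing x N f j%:Z.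

Definition sqnorm' x N f : R :=
  if N is N'.+1 then N'.+1%:R * sin x * sqnorm x N' f
  else (\sum_(i < size f) f`_i * cos (i%:R * x)) ^+ 2 +
       (\sum_(i < size f) f`_i * sin (i%:R * x)) ^+ 2.

Lemma is_derive_sqnorm x N f : is_derive x 1 (fun y : R => sqnorm y N f) (sqnorm' x N f).
Proof.
have -> : (fun y : R => sqnorm y N f) = \sum_(j < size f) (f`_j \*:
    \sum_(i < size f) (f`_i \*: (fun y => moment y N (i%:Z - j%:Z)))).
  apply/funext => y; rewrite /sqnorm fct_sumE; apply: eq_bigr => j _.
  by rewrite /pairing /= fct_sumE.
apply: is_derive_eq.
case: N => [|N] /=; last first.
  rewrite /sqnorm mulr_sumr; apply: eq_bigr => j _.
  rewrite /pairing /GRing.scale /= mulrCA; congr (_ * _).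
  by rewrite mulr_sumr; apply: eq_bigr => i _; rewrite mulrCA.
rewrite !expr2 !mulr_suml -big_split /=; apply: eq_bigr => j _.
rewrite /GRing.scale /= -!mulrA -mulrDr; congr (_ * _).
rewrite !mulr_sumr -big_split /=; apply: eq_bigr => i _.
rewrite intrB mulrBl cosB !pmulrn; lra.
Qed.

Lemma sqnorm_at0 N f : sqnorm 0 N f = 0.
Proof.
rewrite /sqnorm big1 // => j _; rewrite /pairing big1 ?mulr0 // => i _.
by rewrite moment_at0 mulr0.
Qed.

Fixpoint chebyshev n : {poly R} :=
  match n with
  | 0 => 1
  | 1 => 'X
  | (n'.+1 as m).+1 => 2 *: ('X * chebyshev m) - chebyshev n'
  end.

Lemma chebyshevSS n :
  chebyshev n.+2 = 2 *: ('X * chebyshev n.+1) - chebyshev n.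
Proof. by []. Qed.

Lemma horner_chebyshev n x : (chebyshev n).[cos x] = cos (n%:R * x).
Proof.
have [] // : (chebyshev n).[cos x] = cos (n%:R * x) /\
  (chebyshev n.+1).[cos x] = cos (n.+1%:R * x).
elim: n => [|n [IH1 IH2]]; first by rewrite /= hornerC hornerX mul0r mul1r cos0.
split=> //; rewrite chebyshevSS hornerD hornerN hornerZ hornerM hornerX IH1 IH2.
have -> : n.+2%:R = n.+1%:R + 1 :> R by rewrite natr1.
have -> : n%:R = n.+1%:R - 1 :> R by rewrite -natr1 addrK.
by rewrite !mulrDl mulNr !mul1r !cosD cosN sinN; lra.
Qed.

Lemma size_chebyshev n : size (chebyshev n) = n.+1.
Proof.
have [] // : size (chebyshev n) = n.+1 /\ size (chebyshev n.+1) = n.+2.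
elim: n => [|n [IH1 IH2]]; first by rewrite /= size_polyC oner_eq0 size_polyX.
have E : size (2 *: ('X * chebyshev n.+1)) = n.+3.
  rewrite size_scale ?pnatr_eq0 // mulrC size_mulX ?IH2 //.
  by rewrite -size_poly_eq0 IH2.
by split=> //; rewrite chebyshevSS size_polyDl ?E // size_polyN IH1.
Qed.

(** In the variable cos y the sum is a polynomial of degree [n], and cos is injective on [0, pi], so
    [n + 1] zeros would be too many. *)
Lemma cos_sum_roots n (a y : nat -> R) : a n != 0 ->
  (forall k, (k <= n)%N -> 0 <= y k <= pi) ->
  {in [pred k | (k <= n)%N] &, injective y} ->
  exists2 k, (k <= n)%N & \sum_(i < n.+1) a i * cos (i%:R * y k) != 0.
Proof.
move=> an y0pi yinj.
set P := \sum_(i < n.+1) a i *: chebyshev i.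
have PE x : P.[cos x] = \sum_(i < n.+1) a i * cos (i%:R * x).
  by rewrite horner_sum; apply: eq_bigr => i _; rewrite hornerZ horner_chebyshev.
have sizeP : size P = n.+1.
  rewrite /P big_ord_recr /= addrC size_polyDl size_scale ?size_chebyshev //.
  rewrite ltnS; apply: (leq_trans (size_sum _ _ _)); apply/bigmax_leqP => i _.
  by apply: (leq_trans (size_scale_leq _ _)); rewrite size_chebyshev.
have P0 : P != 0 by rewrite -size_poly_eq0 sizeP.
pose rs := [seq cos (y k) | k <- iota 0 n.+1].
have uniq_rs : uniq rs.
  rewrite map_inj_in_uniq ?iota_uniq // => k l.
  rewrite !mem_iota !add0n !ltnS /= => kn ln /cos_inj ykl.
  by apply: yinj => //; apply: ykl; rewrite in_itv /= y0pi.
have [all_rs|] := boolP (all (root P) rs).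
  have := max_poly_roots P0 all_rs uniq_rs.
  by rewrite size_map size_iota sizeP ltnn.
rewrite -has_predC => /hasP[_ /mapP[k +  ->]].
rewrite mem_iota add0n ltnS /= => kn; rewrite rootE PE => Pk.
by exists k.
Qed.

(** As a function of the angle the squared norm starts at 0 and is nondecreasing. Were it not
    positive at [x], it would vanish on [0, x]; the mean value theorem on [size f] subintervals
    would give as many zeros of |f(e^{iy})|^2, and its real part already contradicts
    [cos_sum_roots]. *)
Lemma sqnorm0_gt0 x f : 0 < x <= pi -> f != 0 -> 0 < sqnorm x 0 f.
Proof.
move=> /andP[x0 xpi] f0.
have [n sf] : exists n, size f = n.+1 by exists (size f).-1; rewrite prednK ?size_poly_gt0.
have MVTF a b : a < b -> exists2 c, a < c < b &
    sqnorm b 0 f - sqnorm a 0 f = sqnorm' c 0 f * (b - a).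
  move=> ab; have [||c] := @MVT R (fun y => sqnorm y 0 f) (fun y => sqnorm' y 0 f) a b ab.
  - by move=> z _; exact: is_derive_sqnorm.
  - apply: continuous_subspaceT => z; apply: differentiable_continuous.
    by apply/derivable1_diffP; case: (is_derive_sqnorm z 0 f).
  - by rewrite in_itv /= => cab E; exists c.
have sqnorm'_ge0 z : 0 <= sqnorm' z 0 f by rewrite addr_ge0 // sqr_ge0.
have mono a b : a <= b -> sqnorm a 0 f <= sqnorm b 0 f.
  rewrite le_eqVlt => /predU1P[-> //|ab]; rewrite -subr_ge0.
  by have [c _ ->] := MVTF _ _ ab; rewrite mulr_ge0 // subr_ge0 ltW.
rewrite ltNge; apply/negP => F0.
pose u k : R := x * k%:R / n.+1%:R.
have n0 : 0 < n.+1%:R :> R by rewrite ltr0n.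
have u_lt k l : (k < l)%N -> u k < u l.
  by move=> kl; rewrite /u ltr_pM2r ?invr_gt0 // ltr_pM2l // ltr_nat.
have u_ge0 k : 0 <= u k by rewrite /u !mulr_ge0 ?invr_ge0 ?ler0n // ltW.
have u_le k : (k <= n.+1)%N -> u k <= x.
  by move=> kn; rewrite /u ler_pdivrMr // ler_pM2l // ler_nat.
have /choice[y yP] k : exists c, u k < c < u k.+1 /\ ((k <= n)%N -> sqnorm' c 0 f = 0).
  have [c cu E] := MVTF _ _ (u_lt _ _ (ltnSn k)).
  exists c; split=> // kn.
  have z (i : nat) : (i <= n.+1)%N -> sqnorm (u i) 0 f = 0.
    move=> ik; apply/le_anti/andP; split; first exact: le_trans (mono _ _ (u_le _ ik)) F0.
    by rewrite -(sqnorm_at0 0 f) mono.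
  move: E; rewrite (z k.+1) // (z k) ?leqW // subrr => /esym/eqP.
  by rewrite mulf_eq0 => /orP[/eqP //|]; rewrite subr_eq0 gt_eqF ?u_lt.
have [] := @cos_sum_roots n (fun i : nat => f`_i) y.
- by have := f0; rewrite -lead_coef_eq0 /lead_coef sf.
- move=> k kn; have [/andP[yk1 yk2] _] := yP k.
  by rewrite (le_trans (u_ge0 k) (ltW yk1)) (le_trans (ltW yk2)) // (le_trans _ xpi) // u_le.
- have y_lt k l : (k < l)%N -> y k < y l.
    move=> kl; have [/andP[_ h2] _] := yP k; have [/andP[h3 _] _] := yP l.
    apply: (lt_trans h2); apply: le_lt_trans h3.
    by move: kl; rewrite leq_eqVlt => /predU1P[<- //|/u_lt/ltW].
  move=> k l _ _ ykl; case: (ltngtP k l) => // /y_lt; by rewrite ykl ltxx.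
move=> k kn; have [_ /(_ kn)] := yP k.
rewrite /sqnorm' sf => /eqP; rewrite paddr_eq0 ?sqr_ge0 // sqrf_eq0 => /andP[-> _].
by [].
Qed.

(** Induction on the exponent by the mean value theorem on [0, x]: the derivative is a positive
    multiple of the squared norm for the previous exponent. *)
Lemma sqnorm_gt0 x N f : 0 < x < pi -> f != 0 -> 0 < sqnorm x N f.
Proof.
move=> /andP[x0 xpi] f0.
elim: N x x0 xpi => [|N IH] x x0 xpi; first by rewrite sqnorm0_gt0 // x0 ltW.
have [||c] := @MVT R (fun y => sqnorm y N.+1 f) (fun y => sqnorm' y N.+1 f) 0 x x0.
- by move=> z _; exact: is_derive_sqnorm.
- apply: continuous_subspaceT => z; apply: differentiable_continuous.
  by apply/derivable1_diffP; case: (is_derive_sqnorm z N.+1 f).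
rewrite in_itv /= sqnorm_at0 !subr0 => /andP[c0 cx] ->.
have cpi := lt_trans cx xpi.
by rewrite !mulr_gt0 ?ltr0n ?sin_gt0_pi ?IH ?c0.
Qed.

End Moments.

(** * Orthogonal polynomials on the arc *)

Section OrthogonalPolynomials.
Variables (R : realType) (x : R).
Implicit Types (j : int) (f g : {poly R}).

Let c := cos x.

Local Notation ell N f j := (pairing x N f j).

Lemma pairing_widen N n f j : (size f <= n)%N ->
  ell N f j = \sum_(i < n) f`_i * moment x N (i%:Z - j).
Proof.
move=> fn; rewrite /pairing (big_ord_widen n (fun i => f`_i * moment x N (i%:Z - j)) fn).
rewrite big_mkcond; apply: eq_bigr => i _; case: ltnP => // fi.
by rewrite nth_default // mul0r.
Qed.

Lemma pairingD N f g j : ell N (f + g) j = ell N f j + ell N g j.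
Proof.
rewrite (@pairing_widen N (maxn (size f) (size g)) (f + g)); last exact: size_polyD.
rewrite (@pairing_widen N (maxn (size f) (size g)) f) ?leq_maxl //.
rewrite (@pairing_widen N (maxn (size f) (size g)) g) ?leq_maxr //.
by rewrite -big_split; apply: eq_bigr => i _; rewrite coefD mulrDl.
Qed.

Lemma pairingZ N a f j : ell N (a *: f) j = a * ell N f j.
Proof.
rewrite (@pairing_widen N (size f)) ?size_scale_leq // mulr_sumr.
by apply: eq_bigr => i _; rewrite coefZ mulrA.
Qed.

Lemma pairingB N f g j : ell N (f - g) j = ell N f j - ell N g j.
Proof. by rewrite pairingD -scaleN1r pairingZ mulN1r. Qed.

Lemma pairingX N f j : ell N ('X * f) j = ell N f (j - 1).
Proof.
rewrite (@pairing_widen N (size f).+1); last first.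
  by rewrite mulrC (leq_trans (size_polyMleq _ _)) // size_polyX addn2.
rewrite big_ord_recl coefXM eqxx mul0r add0r; apply: eq_bigr => i _.
rewrite coefXM /=; congr (_ * moment _ _ _).
by rewrite /bump leq0n; lia.
Qed.

(** The reversed polynomial z^k f(1/z); on the unit circle it is z^k times the conjugate of f. *)
Definition star k f : {poly R} := \poly_(i < k.+1) f`_(k - i).

Lemma pairing_star N k f j : (size f <= k.+1)%N ->
  ell N (star k f) j = ell N f (k%:Z - j).
Proof.
move=> fk; rewrite (@pairing_widen N k.+1) ?size_poly // (pairing_widen N _ fk).
rewrite (reindex_inj rev_ord_inj); apply: eq_bigr => i _.
rewrite coef_poly ltn_ord /= !subSS subKn -1?ltnS // -momentN.
congr (_ * moment _ _ _); have := ltn_ord i; lia.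
Qed.

Lemma pairing_sym N n f g : (size f <= n)%N -> (size g <= n)%N ->
  \sum_(j < n) g`_j * ell N f j%:Z = \sum_(i < n) f`_i * ell N g i%:Z.
Proof.
move=> fn gn.
under eq_bigr => j _ do rewrite (pairing_widen N _ fn) mulr_sumr.
under [RHS]eq_bigr => j _ do rewrite (pairing_widen N _ gn) mulr_sumr.
rewrite exchange_big; apply: eq_bigr => i _; apply: eq_bigr => j _.
by rewrite mulrCA -momentN opprB.
Qed.

Lemma pairingS N f j : ell N.+1 f j =
  (ell N f (j - 1) + ell N f (j + 1)) / 2 - c * ell N f j.
Proof.
rewrite /pairing mulr_sumr -big_split mulr_suml -sumrB; apply: eq_bigr => i _ /=.
rewrite momentS.
have -> : i%:Z - (j - 1) = i%:Z - j + 1 by lia.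
have -> : i%:Z - (j + 1) = i%:Z - j - 1 by lia.
by rewrite /c; lra.
Qed.

Lemma pairing_Xderiv N f j : ell N ('X * f^`()) j =
  \sum_(i < size f) i%:R * f`_i * moment x N (i%:Z - j).
Proof.
rewrite (@pairing_widen N (size f)).
  apply: eq_bigr => i _; congr (_ * _); rewrite coefXM.
  by case: eqP => [->|/eqP i0]; rewrite ?mul0r // coef_deriv prednK ?lt0n // mulr_natl.
have [->|f0] := eqVneq f 0; first by rewrite derivC mulr0.
rewrite mulrC (leq_trans (size_polyMleq _ _)) // size_polyX addn2 /=.
exact: lt_size_deriv.
Qed.

(** The monic Szegő recursion. The subtracted multiple is the one that makes the next polynomial
    orthogonal to 1. *)
Fixpoint opoly N k : {poly R} :=
  if k is k'.+1 then
    'X * opoly N k' -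
      (ell N (opoly N k') (-1) / ell N (opoly N k') k'%:Z) *: star k' (opoly N k')
  else 1.

#[global] Arguments opoly : simpl never.

Definition onorm N k : R := ell N (opoly N k) k%:Z.

(* The Verblunsky coefficient, with the sign that makes it positive. *)
Definition refl N k : R := (-1) ^+ k * (opoly N k)`_0.

Hypothesis x_bounds : 0 < x < pi.

Lemma opolyS N k : opoly N k.+1 = 'X * opoly N k -
  (ell N (opoly N k) (-1) / onorm N k) *: star k (opoly N k).
Proof. by []. Qed.

(** One induction for all four facts: orthogonality at [k.+1] needs the norm at [k] to be nonzero,
    and the norm is identified with a squared norm only because the polynomial is monic and
    orthogonal to lower powers. *)
Lemma opoly_spec N k : [/\ (size (opoly N k) <= k.+1)%N, (opoly N k)`_k = 1,
  forall j : nat, (j < k)%N -> ell N (opoly N k) j%:Z = 0 & 0 < onorm N k].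
Proof.
have norm_gt0 n : (size (opoly N n) <= n.+1)%N -> (opoly N n)`_n = 1 ->
    (forall j : nat, (j < n)%N -> ell N (opoly N n) j%:Z = 0) -> 0 < onorm N n.
  move=> sz lc orth; rewrite /onorm.
  have f0 : opoly N n != 0.
    by apply: contra_eq_neq lc => ->; rewrite coef0 eq_sym oner_eq0.
  have szE : size (opoly N n) = n.+1.
    apply/eqP; rewrite eqn_leq sz ltnNge; apply/negP => /leq_sizeP/(_ n (leqnn n)) E.
    by move: lc; rewrite E => /esym/eqP; rewrite oner_eq0.
  have := sqnorm_gt0 N x_bounds f0.
  rewrite /sqnorm szE big_ord_recr /= lc mul1r big1 ?add0r // => j _.
  by rewrite orth ?mulr0.
elim: k => [|k [sz lc orth norm]].
  have sz : (size (opoly N 0) <= 1)%N by rewrite /= size_polyC leq_b1.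
  by split=> //; [rewrite coefC eqxx | apply: norm_gt0 => //; rewrite coefC].
have {}sz' : (size (opoly N k.+1) <= k.+2)%N.
  rewrite opolyS (leq_trans (size_polyD _ _)) // geq_max size_polyN.
  rewrite mulrC (leq_trans (size_polyMleq _ _)) ?size_polyX ?addn2 //=.
  by rewrite (leq_trans (size_scale_leq _ _)) // (leq_trans (size_poly _ _)).
have lc' : (opoly N k.+1)`_k.+1 = 1.
  by rewrite opolyS coefB coefXM coefZ coef_poly ltnn mulr0 subr0.
have orth' (j : nat) : (j < k.+1)%N -> ell N (opoly N k.+1) j%:Z = 0.
  rewrite opolyS pairingB pairingZ pairingX pairing_star //.
  case: j => [_|j jk].
    by rewrite sub0r subr0 -/(onorm N k) divfK ?subrr ?gt_eqF.
  have -> : j.+1%:Z - 1 = j%:Z by lia.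
  have -> : k%:Z - j.+1%:Z = (k - j.+1)%N%:Z by lia.
  by rewrite !orth ?mulr0 ?subrr //; lia.
by split=> //; apply: norm_gt0.
Qed.

Lemma onorm_gt0 N k : 0 < onorm N k.
Proof. by case: (opoly_spec N k). Qed.

Lemma size_opoly N k : (size (opoly N k) <= k.+1)%N.
Proof. by case: (opoly_spec N k). Qed.

Lemma opoly_lead N k : (opoly N k)`_k = 1.
Proof. by case: (opoly_spec N k). Qed.

Lemma opoly_orth N k j : 0 <= j < k%:Z -> ell N (opoly N k) j = 0.
Proof. by case: j => // j jk; case: (opoly_spec N k) => _ _ ->. Qed.

Lemma refl0 N : refl N 0 = 1.
Proof. by rewrite /refl expr0 mul1r coefC. Qed.

Lemma opoly_coef0 N k : (opoly N k)`_0 = (-1) ^+ k * refl N k.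
Proof. by rewrite /refl mulrA -expr2 sqrr_sign mul1r. Qed.

Lemma pairing_opoly_N1 N k :
  ell N (opoly N k) (-1) = (-1) ^+ k * refl N k.+1 * onorm N k.
Proof.
have -> : (-1) ^+ k * refl N k.+1 = - (opoly N k.+1)`_0.
  by rewrite opoly_coef0 exprS mulN1r mulNr opprK.
rewrite opolyS coefB coefXM /= sub0r opprK coefZ coef_poly ltn0Sn subn0 opoly_lead.
by rewrite mulr1 divfK // gt_eqF ?onorm_gt0.
Qed.

Lemma onormS N k : onorm N k.+1 = onorm N k * (1 - refl N k.+1 ^+ 2).
Proof.
rewrite {1}/onorm opolyS pairingB pairingZ pairingX pairing_star ?size_opoly //.
have -> : k.+1%:Z - 1 = k%:Z by lia.
have -> : k%:Z - k.+1%:Z = -1 by lia.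
rewrite -/(onorm N k) pairing_opoly_N1 mulfK ?gt_eqF ?onorm_gt0 //.
by rewrite mulrA -expr2 exprMn sqrr_sign mul1r mulrBr mulr1 [refl _ _ ^+ 2 * _]mulrC.
Qed.

(** Pair [f] with the reversal of [opoly N k.+1], which is orthogonal to z, ..., z^{k+1}. Computed
    one way only the constant coefficient of [f] survives; computed the other way only the two
    extreme coefficients of the reversal do. *)
Lemma coef0_orth N k f : (size f <= k.+2)%N ->
  (forall j, 1 <= j <= k%:Z -> ell N f j = 0) ->
  f`_0 * onorm N k.+1 = ell N f 0 + (opoly N k.+1)`_0 * ell N f k.+1%:Z.
Proof.
move=> sz orth.
have := @pairing_sym N k.+2 (star k.+1 (opoly N k.+1)) f.
rewrite size_poly sz => /(_ isT isT) /esym.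
rewrite big_ord_recl big_ord_recr [in RHS]big_ord_recl [in RHS]big_ord_recr /=.
rewrite !big1 ?addr0 ?add0r.
- rewrite /bump leq0n add1n !coef_poly ltn0Sn ltnS leqnn subn0 subnn opoly_lead mul1r.
  move=> ->; rewrite !pairing_star ?size_opoly // subr0 subrr.
  by rewrite (@opoly_orth N k.+1 0) // mulr0 addr0.
- move=> i _; rewrite pairing_star ?size_opoly // opoly_orth ?mulr0 //.
  rewrite /bump leq0n; have := ltn_ord i; lia.
- move=> i _; rewrite orth ?mulr0 // /bump leq0n; have := ltn_ord i; lia.
Qed.

(* The factor [X^2 - 2cX + 1] is, up to a unit of the ring of Laurent
   polynomials, twice the weight [cos - c]. *)
Lemma christoffel N k :
  refl N.+1 k * onorm N k.+1 = refl N k.+2 * onorm N k.+1 +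
    2 * onorm N.+1 k * (refl N.+1 k.+1 - refl N k.+1).
Proof.
set f := opoly N.+1 k.
(* Subtracting the shifted monic polynomial cancels the leading term, so that [Q] has degree at most
   [k.+1] and [coef0_orth] applies. *)
pose Q := 'X * ('X * f) - (2 * c) *: ('X * f) + f - 'X * opoly N k.+1.
have szQ : (size Q <= k.+2)%N.
  apply/leq_sizeP => j kj; rewrite coefB coefD coefB coefZ !coefXM.
  case: j kj => [//|[//|j]] /=; rewrite !ltnS => kj.
  have -> : f`_j.+1 = 0 by apply: (leq_sizeP _ _ (size_opoly _ _)).
  have -> : f`_j.+2 = 0 by apply: (leq_sizeP _ _ (size_opoly _ _)) => //; lia.
  move: kj; rewrite leq_eqVlt => /predU1P[<-|kj]; first by rewrite !opoly_lead; lra.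
  have -> : f`_j = 0 by apply: (leq_sizeP _ _ (size_opoly _ _)).
  have -> : (opoly N k.+1)`_j.+1 = 0 by apply: (leq_sizeP _ _ (size_opoly _ _)).
  lra.
have ellQ j : ell N Q j = 2 * ell N.+1 f (j - 1) - ell N (opoly N k.+1) (j - 1).
  rewrite pairingB pairingD pairingB pairingZ !pairingX pairingS.
  by rewrite addrK; lra.
have := @coef0_orth N k Q szQ.
have -> : Q`_0 = f`_0 by rewrite coefB coefD coefB coefZ !coefXM /=; lra.
have -> : ell N Q 0 = 2 * ell N.+1 f (-1) - ell N (opoly N k.+1) (-1).
  by rewrite ellQ sub0r.
have -> : ell N Q k.+1%:Z = 2 * onorm N.+1 k.
  rewrite ellQ; have -> : k.+1%:Z - 1 = k%:Z by lia.
  by rewrite [X in _ - X]opoly_orth ?subr0 //; lia.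
rewrite !pairing_opoly_N1 !opoly_coef0 exprS => E.
have {}E : (-1) ^+ k * (refl N.+1 k * onorm N k.+1) = (-1) ^+ k *
  (refl N k.+2 * onorm N k.+1 + 2 * onorm N.+1 k * (refl N.+1 k.+1 - refl N k.+1)).
  rewrite mulrA E; first by ring.
  by move=> j jk; rewrite ellQ !opoly_orth; [ring | lia | lia].
by apply: mulfI E; rewrite signr_eq0.
Qed.

(* The semiclassical relation: the weight has a rational logarithmic derivative. *)
Lemma semiclassical N k :
  (2 * N.+1 + k)%:R * (refl N.+1 k * onorm N k.+1) = 2 * onorm N.+1 k *
    ((N.+1 + k).+1%:R * refl N.+1 k.+1 - N.+1%:R * refl N k.+1).
Proof.
set f := opoly N.+1 k; set n : R := N.+1%:R.
pose M : R := n + k%:R.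
pose f' := 'X * f^`().
(* This is (z^2 - 2cz + 1) f' + n (z^2 - 1) f, with f' the Euler derivative z df/dz: up to the
   factor 2z, the derivative of f times the weight of exponent [N.+1], divided by the weight of
   exponent [N]. Its leading coefficient is [M], removed in [Q]. *)
pose P := 'X * ('X * (f' + n *: f)) - (2 * c) *: ('X * f') + (f' - n *: f).
pose Q := P - M *: ('X * opoly N k.+1).
have szQ : (size Q <= k.+2)%N.
  have := size_opoly N k.+1; have := opoly_lead N k.+1.
  rewrite /Q; move: (opoly N k.+1) => g lg sg.
  apply/leq_sizeP => j kj; rewrite coefB coefZ !coefD coefN coefN !coefZ !coefXM.
  case: j kj => [//|[//|j]] /=; rewrite !ltnS => kj.
  rewrite !coefD !coefZ !coefXM !coef_deriv /=.
  have -> : f`_j.+1 = 0 by apply: (leq_sizeP _ _ (size_opoly _ _)).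
  have -> : f`_j.+2 = 0 by apply: (leq_sizeP _ _ (size_opoly _ _)) => //; lia.
  have -> : (if j == 0%N then 0 else f`_j.-1.+1 *+ j.-1.+1) = j%:R * f`_j.
    by case: eqP => [->|/eqP j0]; rewrite ?mul0r // prednK ?lt0n // mulr_natl.
  move: kj; rewrite leq_eqVlt => /predU1P[<-|kj].
    by rewrite opoly_lead lg !mul0rn /M; lra.
  have -> : f`_j = 0 by apply: (leq_sizeP _ _ (size_opoly _ _)).
  have -> : g`_j.+1 = 0 by apply: (leq_sizeP _ _ sg).
  by rewrite !mul0rn; lra.
have ellP j : ell N P j = 2 * (j - 1)%:~R * ell N.+1 f (j - 1).
  have ellf' i := pairing_Xderiv N f i.
  rewrite -/f' in ellf'; rewrite /P; clear Q szQ; clear P; clearbody f'.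
  rewrite pairingD !pairingB pairingZ !pairingX pairingD !pairingZ.
  rewrite !ellf' /pairing.
  rewrite !mulr_sumr -big_split -!sumrB -big_split /=; apply: eq_bigr => i _.
  have := moment_by_parts x N (i%:Z - (j - 1)).
  rewrite intrB momentS.
  have -> : i%:Z - (j - 1) + 1 = i%:Z - (j - 1 - 1) by lia.
  have -> : i%:Z - (j - 1) - 1 = i%:Z - j by lia.
  rewrite -/c -/n -pmulrn.
  move: (moment x N (i%:Z - j)) (moment x N (i%:Z - (j - 1))) => a b.
  move: (moment x N (i%:Z - (j - 1 - 1))) => d.
  move: ((j - 1)%:~R : R) (i%:R : R) f`_i => J I' F E.
  have {}E := congr1 (fun z => F * z) E; lra.
have := @coef0_orth N k Q szQ.
have ellQ j : ell N Q j = 2 * (j - 1)%:~R * ell N.+1 f (j - 1) -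
    M * ell N (opoly N k.+1) (j - 1).
  by rewrite pairingB ellP pairingZ pairingX.
have -> : Q`_0 = - (n * f`_0).
  by rewrite coefB coefZ !coefD !coefN !coefZ !coefXM /=; lra.
have -> : ell N Q 0 = - 2 * ell N.+1 f (-1) - M * ell N (opoly N k.+1) (-1).
  by rewrite ellQ sub0r; lra.
have -> : ell N Q k.+1%:Z = 2 * k%:R * onorm N.+1 k.
  rewrite ellQ; have -> : k.+1%:Z - 1 = k%:Z by lia.
  by rewrite [X in _ - _ * X]opoly_orth ?mulr0 ?subr0 //; lia.
rewrite !pairing_opoly_N1 !opoly_coef0 exprS => E.
have {}E : (-1) ^+ k * (- n * refl N.+1 k * onorm N k.+1) = (-1) ^+ k *
  (M * refl N k.+2 * onorm N k.+1 - 2 * refl N.+1 k.+1 * onorm N.+1 k -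
   2 * k%:R * refl N k.+1 * onorm N.+1 k).
  have -> : (-1) ^+ k * (- n * refl N.+1 k * onorm N k.+1) =
    - (n * ((-1) ^+ k * refl N.+1 k)) * onorm N k.+1 by ring.
  rewrite E; first by ring.
  by move=> j jk; rewrite ellQ !opoly_orth; [ring | lia | lia].
have {}E : - n * refl N.+1 k * onorm N k.+1 =
  M * refl N k.+2 * onorm N k.+1 - 2 * refl N.+1 k.+1 * onorm N.+1 k -
   2 * k%:R * refl N k.+1 * onorm N.+1 k.
  by apply: mulfI E; rewrite signr_eq0.
(* The relation obtained from [coef0_orth] still contains [refl N k.+2], which this multiple of
   [christoffel] eliminates. *)
have C := congr1 (fun z => M * z) (christoffel N k).
have -> : (2 * N.+1 + k)%:R = n + M by rewrite natrD natrM /n /M; ring.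
have -> : (N.+1 + k).+1%:R = M + 1 by rewrite -natr1 natrD.
rewrite -/n; move: E C; rewrite (_ : k%:R = M - n); last by rewrite /M; ring.
move=> E C; rewrite mulrDl; lra.
Qed.

End OrthogonalPolynomials.

(** * The radius function *)

Section Lattice.
Variables (R : realType) (x : R).
Hypothesis x_bounds : 0 < x < pi.

Local Notation c := (cos x).
Local Notation t := (refl x).

Definition slope N k : R := 2 * onorm x N.+1 k / onorm x N k.+1.

(** One side of the Christoffel relation divided by [onorm x N k.+1] and arranged to have only plus
    signs; [slantE] is the other side. *)
Definition slant N k : R := t N.+1 k + slope N k * t N k.+1.

Lemma slope_gt0 N k : 0 < slope N k.
Proof. by rewrite divr_gt0 ?mulr_gt0 ?onorm_gt0 ?ltr0n. Qed.

Lemma slope_onorm N k : slope N k * onorm x N k.+1 = 2 * onorm x N.+1 k.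
Proof. by rewrite divfK // gt_eqF ?onorm_gt0. Qed.

Lemma slantE N k : slant N k = slope N k * t N.+1 k.+1 + t N k.+2.
Proof.
have h0 : onorm x N k.+1 != 0 by rewrite gt_eqF ?onorm_gt0.
apply: (mulIf h0); have := christoffel x_bounds N k.
by have := slope_onorm N k; rewrite /slant => E C; nra.
Qed.

Lemma slope_semiclassical N k : (2 * N.+1 + k)%:R * t N.+1 k =
  slope N k * ((N.+1 + k).+1%:R * t N.+1 k.+1 - N.+1%:R * t N k.+1).
Proof.
have h0 : onorm x N k.+1 != 0 by rewrite gt_eqF ?onorm_gt0.
apply: (mulIf h0); rewrite -mulrA (semiclassical x_bounds N k) -slope_onorm.
by rewrite mulrAC.
Qed.

Lemma refl_sqr_lt1 N k : 0 < 1 - t N k.+1 ^+ 2.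
Proof.
have := onorm_gt0 x_bounds N k.+1.
by rewrite onormS // pmulr_rgt0 ?onorm_gt0.
Qed.

Lemma slopeS N k :
  slope N k.+1 * (1 - t N k.+2 ^+ 2) = slope N k * (1 - t N.+1 k.+1 ^+ 2).
Proof.
have h0 : onorm x N k.+1 != 0 by rewrite gt_eqF ?onorm_gt0.
apply: (mulIf h0).
have := slope_onorm N k.+1; rewrite (onormS _ N k.+1) // (onormS _ N.+1 k) // => E.
have /= := congr1 (fun z => z * (1 - t N.+1 k.+1 ^+ 2)) (slope_onorm N k); lra.
Qed.

Lemma slope0 N : slope N 0 * (1 - t N 1 ^+ 2) = 2 * (t N 1 - c).
Proof.
have h0 : onorm x N 0 != 0 by rewrite gt_eqF ?onorm_gt0.
apply: (mulIf h0).
have := slope_onorm N 0; rewrite onormS // => E.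
have : onorm x N.+1 0 = pairing x N 1 (-1) - c * onorm x N 0.
  rewrite -[onorm x N.+1 0]/(pairing x N.+1 1 0) -[onorm x N 0]/(pairing x N 1 0).
  rewrite pairingS; have -> : 0 - 1 = -1 :> int by []; have -> : 0 + 1 = 1 :> int by [].
  suff -> : pairing x N 1 1 = pairing x N 1 (-1) by lra.
  rewrite !(@pairing_widen _ _ N 1) ?size_polyC ?leq_b1 // !big_ord1.
  by rewrite !sub0r opprK momentN.
have := pairing_opoly_N1 x_bounds N 0; rewrite expr0 mul1r => -> E2; lra.
Qed.

(** In the induction step [slope N k] and the inverse of [slope N k.+1] are the two roots of one
    quadratic, since [slopeS] gives their product; reversing the coefficients of the quadratic
    yields the claim for [k.+1]. *)
Lemma slant_sqr N k : slant N k ^+ 2 = 1 + 2 * c * slope N k + slope N k ^+ 2.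
Proof.
elim: k => [|k IH].
  have := slope0 N; rewrite /slant refl0 expr2.
  move: (slope N 0) (t N 1) => g u E; have := congr1 (fun z => g * z) E.
  by move=> /= E2; nra.
have n0 : 1 - t N k.+2 ^+ 2 != 0 by rewrite gt_eqF ?refl_sqr_lt1.
have s0 : slope N k != 0 by rewrite gt_eqF ?slope_gt0.
move: IH (slopeS N k) n0; rewrite slantE [slant N k.+1]/slant.
move: (slope N k) s0 (slope N k.+1) (t N.+1 k.+1) (t N k.+2) => g g0 g' u v.
move=> IH E n0.
have IH' : g ^+ 2 * (1 - u ^+ 2) + 2 * g * (c - u * v) + (1 - v ^+ 2) = 0 by lra.
suff : g' ^+ 2 * (1 - v ^+ 2) + 2 * g' * (c - u * v) + (1 - u ^+ 2) = 0 by lra.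
apply: (mulfI g0); rewrite mulr0.
have -> : g * (g' ^+ 2 * (1 - v ^+ 2) + 2 * g' * (c - u * v) + (1 - u ^+ 2)) =
  g' * (g ^+ 2 * (1 - u ^+ 2) + 2 * g * (c - u * v) + (1 - v ^+ 2)) +
  (g * g' - 1) * (g' * (1 - v ^+ 2) - g * (1 - u ^+ 2)) by ring.
by rewrite IH' E subrr !mulr0 addr0.
Qed.

Definition rad N k : R := (N + k)%:R * t N k.

Lemma rad0 N : rad N 0 = N%:R.
Proof. by rewrite /rad refl0 addn0 mulr1. Qed.

Lemma slant_rad1 N k :
  (N + k).+1%:R * slant N k = rad N.+1 k + slope N k * rad N k.+1.
Proof. by rewrite /rad /slant addnS addSn; ring. Qed.

Lemma slant_rad4 N k :
  (N + k).+2%:R * slant N k = slope N k * rad N.+1 k.+1 + rad N k.+2.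
Proof. by rewrite slantE /rad !addnS !addSn; ring. Qed.

Lemma slant_rad2 N k :
  N.+1%:R * slant N k = slope N k * rad N.+1 k.+1 - rad N.+1 k.
Proof.
have := slope_semiclassical N k.
rewrite /rad /slant !addnS !addSn.
have -> : (2 * N.+1 + k)%:R = N.+1%:R + (N + k).+1%:R :> R.
  by rewrite -natrD; congr _%:R; lia.
by lra.
Qed.

Lemma slant_rad3 N k :
  N%:R * slant N k = slope N k * rad N k.+1 - rad N k.+2.
Proof.
have := slant_rad1 N k; have := slant_rad2 N k; have := slant_rad4 N k.
by rewrite -!natr1 natrD; lra.
Qed.

Lemma refl01 : t 0 1 = sin x / x.
Proof.
have /andP[x0 _] := x_bounds.
have := pairing_opoly_N1 x_bounds 0 0; rewrite expr0 mul1r /onorm.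
rewrite !(@pairing_widen _ _ 0 1) ?size_polyC ?leq_b1 // !big_ord1.
rewrite !coefC eqxx !mul1r subr0 sub0r opprK !moment0E eqxx /= mul1r divr1 => ->.
by rewrite mulfK ?gt_eqF.
Qed.

(** Induction on [N + k]. Solved for the new radius, [slant_rad2] has only positive terms; for
    [N = 0] the relation [slant_rad3] expresses it as a positive multiple of the previous radius on
    the axis. *)
Lemma refl_gt0 N k : 0 < t N k.
Proof.
suff H M : forall N k, (N + k <= M)%N -> 0 < t N k by exact: (H (N + k)%N).
elim: M => [|M IH] {}N {}k.
  by rewrite leqn0 addn_eq0 => /andP[/eqP-> /eqP->]; rewrite refl0.
rewrite leq_eqVlt => /predU1P[|]; last exact: IH.
case: k => [_|k]; first by rewrite refl0.
rewrite addnS => -[Nk].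
have rad_refl K l : 0 < rad K l -> 0 < t K l.
  by rewrite /rad; apply: contraTT; rewrite -!leNgt => tl; rewrite mulr_ge0_le0.
have refl_rad K l : 0 < t K l -> (0 < K + l)%N -> 0 < rad K l.
  by move=> tl Kl; rewrite mulr_gt0 ?ltr0n.
apply: rad_refl; case: N Nk => [|N] Nk.
  case: k Nk => [_|k Nk].
    have /andP[x0 xpi] := x_bounds.
    by rewrite /rad refl01 mul1r divr_gt0 ?sin_gt0_pi ?x0.
  have := slant_rad3 0 k; rewrite mul0r => /eqP; rewrite eq_sym subr_eq0 => /eqP <-.
  by rewrite mulr_gt0 ?slope_gt0 // refl_rad ?IH //; lia.
have D0 : 0 < slant N k.
  by apply: addr_gt0; [|apply: mulr_gt0; first exact: slope_gt0]; apply: IH; lia.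
have := slant_rad2 N k => E.
rewrite -(pmulr_rgt0 _ (slope_gt0 N k)).
have -> : slope N k * rad N.+1 k.+1 = N.+1%:R * slant N k + rad N.+1 k by lra.
apply: addr_gt0; first by rewrite mulr_gt0 ?ltr0n.
by apply: refl_rad; [apply: IH; lia|].
Qed.

Lemma rad_gt0 N k : (0 < N + k)%N -> 0 < rad N k.
Proof. by move=> Nk; rewrite mulr_gt0 ?refl_gt0 ?ltr0n. Qed.

Lemma rad_ge0 N k : 0 <= rad N k.
Proof. by rewrite mulr_ge0 // ltW // refl_gt0. Qed.

Lemma slant_gt0 N k : 0 < slant N k.
Proof.
apply: addr_gt0; first exact: refl_gt0.
by apply: mulr_gt0; [exact: slope_gt0|exact: refl_gt0].
Qed.

(* Equation (A) at z = N + i(N + k + 1). *)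
Lemma rad_eqA N k :
  let M : R := (N + k).+1%:R in
  rad N.+1 k.+1 * (N%:R * rad N.+1 k + M * rad N k.+2) =
  rad N k.+1 * ((M + 1) * rad N.+1 k + N.+1%:R * rad N k.+2).
Proof.
move=> M.
have g0 : slope N k != 0 by rewrite gt_eqF ?slope_gt0.
have := slant_rad1 N k; have := slant_rad2 N k; have := slant_rad3 N k.
rewrite -/M -[N.+1%:R]natr1.
move: (slope N k) g0 (slant N k) (N%:R : R) M => g g0 D n M E3 E2 E1.
have Eb : rad N.+1 k = M * D - g * rad N k.+1 by lra.
have Ec : rad N k.+2 = g * rad N k.+1 - n * D by lra.
have Ed : g * rad N.+1 k.+1 = (n + M + 1) * D - g * rad N k.+1 by lra.
apply: (mulfI g0); rewrite mulrA Ed Eb Ec; ring.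
Qed.

End Lattice.

(* The neighbouring radii [c] and [e] of [a] are affine in the two roots
   [y] and [w] of one quadratic equation, so Vieta's formulas give (B). *)
Lemma eqB_of_roots (F : realFieldType) (a b c e w y N M co : F) :
  M != 0 -> y != 0 -> M ^+ 2 - a ^+ 2 != 0 ->
  M * e = N * b + (M + N) * a * w -> M * c = (M - N) * a * y - N * b ->
  (b + y * a) ^+ 2 = M ^+ 2 * (1 + 2 * co * y + y ^+ 2) ->
  w * y * (M ^+ 2 - a ^+ 2) = M ^+ 2 - b ^+ 2 ->
  (N + M) * (c + b) * (a ^+ 2 - b * e + co * a * (e - b)) +
  (M - N) * (e + b) * (a ^+ 2 - b * c + co * a * (c - b)) = 0.
Proof.
move=> M0 y0 d0 Ee Ec Ey prod.
have sum : (w + y) * (M ^+ 2 - a ^+ 2) = - 2 * (M ^+ 2 * co - a * b).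
  apply: (mulfI y0); have -> : y * ((w + y) * (M ^+ 2 - a ^+ 2)) =
    w * y * (M ^+ 2 - a ^+ 2) + y ^+ 2 * (M ^+ 2 - a ^+ 2) by ring.
  by rewrite prod; lra.
have cE : c = ((M - N) * a * y - N * b) / M by rewrite -Ec mulrAC divff ?mul1r.
have eE : e = (N * b + (M + N) * a * w) / M by rewrite -Ee mulrAC divff ?mul1r.
apply: (mulfI d0); rewrite mulr0 cE eE.
transitivity ((M + N) * (M - N) / M * a * (
  (a ^+ 2 - b ^+ 2) * ((w + y) * (M ^+ 2 - a ^+ 2)) +
  2 * a * b * ((M ^+ 2 - a ^+ 2) - w * y * (M ^+ 2 - a ^+ 2)) +
  2 * co * (a ^+ 2 * (w * y * (M ^+ 2 - a ^+ 2)) - b ^+ 2 * (M ^+ 2 - a ^+ 2)))).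
  by field.
by rewrite prod sum; ring.
Qed.

Section RadiusFunction.
Variables (R : realType) (x : R).
Hypothesis x_bounds : 0 < x < pi.

Definition radius_fun (N M : int) : R := rad x `|N|%N (`|M| - `|N|)%N.

Local Notation r := radius_fun.

Lemma radius_fun_pos n k : r n%:Z (n + k)%N%:Z = rad x n k.
Proof. by rewrite /radius_fun; congr rad; lia. Qed.

Lemma radius_fun_opp N M : r (- N) M = r N M.
Proof. by rewrite /radius_fun abszN. Qed.

Lemma radius_fun_neg n k : r (- n%:Z) (n + k)%N%:Z = rad x n k.
Proof. by rewrite radius_fun_opp radius_fun_pos. Qed.

Lemma inVP N M : inV N M ->
  exists n k : nat, M = (n + k)%N%:Z /\ (N = n%:Z \/ N = - n%:Z).
Proof.
rewrite /inV => NM; exists `|N|%N, (`|M| - `|N|)%N; split; lia.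
Qed.

Lemma radius_fun_gt0 N M : inV N M -> (N, M) <> (0, 0) -> 0 < r N M.
Proof.
move=> /inVP[n [k [-> NE]]] NM0.
have nk : (0 < n + k)%N.
  rewrite lt0n; apply/eqP => nk0; apply: NM0; rewrite nk0.
  by congr (_, _); lia.
by case: NE => ->; rewrite ?radius_fun_neg ?radius_fun_pos rad_gt0.
Qed.

Lemma radius_fun00 : r 0 0 = 0.
Proof. by rewrite (radius_fun_pos 0 0) rad0. Qed.

Lemma radius_fun_eqA : eqA 2 r.
Proof.
split=> [N M /inVP[n [k [-> NE]]] inV1|N N0|N N1].
- have [N0|N0] := leP 0 N.
    have {NE} NE : N = n%:Z by lia.
    subst N; case: k inV1 => [|k _]; first by rewrite /inV; lia.
    have -> : (n%:Z + 1 = n.+1%:Z)%R by lia.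
    have -> : ((n + k.+1)%N%:Z + 1 = (n + k.+2)%N%:Z)%R by lia.
    have -> : r n.+1 (n + k.+1)%N = rad x n.+1 k.
      by rewrite -radius_fun_pos; congr r; lia.
    have -> : r n.+1 (n + k.+2)%N = rad x n.+1 k.+1.
      by rewrite -radius_fun_pos; congr r; lia.
    rewrite !radius_fun_pos -!pmulrn.
    have := rad_eqA x_bounds n k; rewrite !addnS -(natr1 (n + k).+1) -(natr1 n). rewrite /=; lra.
  have [n' nE] : exists n', n = n'.+1 by exists n.-1; lia.
  have {NE} NE : N = - n'.+1%:Z by lia.
  subst N n.
  have -> : (- n'.+1%:Z + 1 = - n'%:Z)%R by lia.
  have -> : r (- n'%:Z) (n'.+1 + k)%N = rad x n' k.+1.
    by rewrite -radius_fun_neg; congr r; lia.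
  have -> : r (- n'%:Z) ((n'.+1 + k)%N%:Z + 1) = rad x n' k.+2.
    by rewrite -radius_fun_neg; congr r; lia.
  have -> : r (- n'.+1%:Z) ((n'.+1 + k)%N%:Z + 1) = rad x n'.+1 k.+1.
    by rewrite -radius_fun_neg; congr r; lia.
  rewrite !radius_fun_neg intrD !intrN -!pmulrn.
  have := rad_eqA x_bounds n' k; rewrite addSn -(natr1 n') /=; lra.
- have [n ->] : exists n : nat, N = n%:Z by exists `|N|%N; lia.
  have -> : (n%:Z + 1 = n.+1%:Z)%R by lia.
  have rE m : r m%:Z m%:Z = m%:R by rewrite -{2}[m]addn0 radius_fun_pos rad0.
  by rewrite !rE -!pmulrn -(natr1 n); lra.
- have [n ->] : exists n : nat, N = n.+1%:Z by exists (`|N|.-1)%N; lia.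
  have -> : (n.+1%:Z - 1 = n%:Z)%R by lia.
  have rE m : r (- m%:Z) m%:Z = m%:R by rewrite -{2}[m]addn0 radius_fun_neg rad0.
  by rewrite !rE -!pmulrn -(natr1 n); lra.
Qed.

Lemma radius_fun_init : Z2_initial x r.
Proof.
split.
- exact: radius_fun00.
- by rewrite (radius_fun_pos 1 0) rad0.
- by rewrite (radius_fun_neg 1 0) rad0.
by rewrite (radius_fun_pos 0 1) /rad refl01 // mul1r.
Qed.

Lemma rad_lt n k : 0 < (n + k).+1%:R ^+ 2 - rad x n k.+1 ^+ 2.
Proof.
rewrite /rad addnS exprMn -[X in X - _]mulr1 -mulrBr.
by rewrite mulr_gt0 ?exprn_gt0 ?ltr0n ?refl_sqr_lt1.
Qed.

Lemma slant_sqr1 n k :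
  (rad x n.+1 k + slope x n k * rad x n k.+1) ^+ 2 =
  (n + k).+1%:R ^+ 2 * (1 + 2 * cos x * slope x n k + slope x n k ^+ 2).
Proof. by rewrite -slant_rad1 // exprMn slant_sqr. Qed.

Lemma slope_rad n k :
  slope x n k.+1 * ((n + k).+2%:R ^+ 2 - rad x n k.+2 ^+ 2) =
  slope x n k * ((n + k).+2%:R ^+ 2 - rad x n.+1 k.+1 ^+ 2).
Proof.
have := congr1 (fun z => (n + k).+2%:R ^+ 2 * z) (slopeS x_bounds n k).
by rewrite /= /rad !addnS addSn; lra.
Qed.

Lemma rad_eqB_right n k :
  let M : R := (n + k).+1%:R in
  let a := rad x n k.+1 in let b := rad x n.+1 k in
  let c := rad x n k.+2 in let e := rad x n k in
  (n%:R + M) * (c + b) * (a ^+ 2 - b * e + cos x * a * (e - b)) +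
  (M - n%:R) * (e + b) * (a ^+ 2 - b * c + cos x * a * (c - b)) = 0.
Proof.
move=> M a b c e.
have y0 : slope x n k != 0 by rewrite gt_eqF ?slope_gt0.
have M0 : M != 0 by rewrite pnatr_eq0.
have d0 : M ^+ 2 - a ^+ 2 != 0 by rewrite gt_eqF ?rad_lt.
have Ec : M * c = (M - n%:R) * a * slope x n k - n%:R * b.
  have := slant_rad1 x n k; have := slant_rad3 x_bounds n k.
  move: (slant x n k); rewrite -/M -/a -/b -/c => D E3 E1.
  have := congr1 (fun z => n%:R * z) E1; have := congr1 (fun z => M * z) E3.
  by rewrite /=; lra.
have Ey := slant_sqr1 n k.
case: k => [|k] in M a b c e y0 M0 d0 Ec Ey *.
  have bE : b = M by rewrite /b rad0 /M addn0.
  have eE : e = n%:R by rewrite /e rad0.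
  (* Here z + 1 lies on the border of the lattice and has radius [M], so the product of the roots is
     0 and the second root is 0. *)
  apply: (@eqB_of_roots _ a b c e 0 (slope x n 0) n%:R M) => //.
    by rewrite eE bE; ring.
  by rewrite bE; ring.
have w0 : slope x n k != 0 by rewrite gt_eqF ?slope_gt0.
apply: (@eqB_of_roots _ a b c e (slope x n k)^-1 (slope x n k.+1) n%:R M) => //.
  have := slant_rad4 x_bounds n k; have := slant_rad3 x_bounds n k.
  move: (slant x n k); rewrite -/a -/b -/e -(addnS n k) -/M.
  move=> D E3 E4; apply: (mulfI w0).
  have -> : slope x n k * (n%:R * b + (M + n%:R) * a * (slope x n k)^-1) =
     slope x n k * n%:R * b + (M + n%:R) * a by field.
  have := congr1 (fun z => n%:R * z) E4; have := congr1 (fun z => M * z) E3.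
  by rewrite /= /M addnS; lra.
apply: (mulfI w0); have := slope_rad n k.
rewrite -(addnS n k) -/M -/a -/b => E.
have -> : slope x n k * ((slope x n k)^-1 * slope x n k.+1 * (M ^+ 2 - a ^+ 2)) =
  slope x n k.+1 * (M ^+ 2 - a ^+ 2) by field.
by [].
Qed.

(** Left of the axis the neighbour z + 1 is the inner one, and the roots change places:
    [slope x n k] now gives the lower neighbour and the inverse of [slope x n k.+1] the upper
    one. *)
Lemma rad_eqB_left n k :
  let M : R := (n + k).+2%:R in let N : R := n.+1%:R in
  let a := rad x n.+1 k.+1 in let b := rad x n k.+2 in
  let c := rad x n.+1 k.+2 in let e := rad x n.+1 k in
  (N + M) * (e + b) * (a ^+ 2 - b * c + cos x * a * (c - b)) +
  (M - N) * (c + b) * (a ^+ 2 - b * e + cos x * a * (e - b)) = 0.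
Proof.
move=> M N a b c e.
have y0 : slope x n k != 0 by rewrite gt_eqF ?slope_gt0.
have w0 : slope x n k.+1 != 0 by rewrite gt_eqF ?slope_gt0.
have M0 : M != 0 by rewrite pnatr_eq0.
have d0 : M ^+ 2 - a ^+ 2 != 0 by rewrite gt_eqF // /M -addSn rad_lt.
apply: (@eqB_of_roots _ a b e c (slope x n k.+1)^-1 (slope x n k) N M) => //.
- have := slant_rad1 x n k.+1; have := slant_rad2 x_bounds n k.+1.
  move: (slant x n k.+1); rewrite addnS -/a -/b -/c -/M -/N.
  move=> D E3 E4; apply: (mulfI w0).
  have -> : slope x n k.+1 * (N * b + (M + N) * a * (slope x n k.+1)^-1) =
     slope x n k.+1 * N * b + (M + N) * a by field.
  have := congr1 (fun z => N * z) E4; have := congr1 (fun z => M * z) E3.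
  by rewrite /=; lra.
- have := slant_rad4 x_bounds n k; have := slant_rad2 x_bounds n k.
  move: (slant x n k); rewrite -/a -/b -/e -/M -/N => D E3 E4.
  have := congr1 (fun z => N * z) E4; have := congr1 (fun z => M * z) E3.
  by rewrite /=; lra.
- have := slant_rad4 x_bounds n k; rewrite -/M -/a -/b => E4.
  by rewrite addrC -E4 exprMn slant_sqr.
apply: (mulfI w0).
have -> : slope x n k.+1 * ((slope x n k.+1)^-1 * slope x n k * (M ^+ 2 - a ^+ 2)) =
  slope x n k * (M ^+ 2 - a ^+ 2) by field.
by rewrite -slope_rad.
Qed.

Lemma radius_fun_eqB : eqB x r.
Proof.
move=> N M /inVP[n [k [-> NE]]] Nneq.
case: k Nneq => [|k _]; first by case: NE => ->; rewrite addn0 ?normrN ?eqxx.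
have -> : (n + k.+1)%N%:Z + 1 = (n + k.+2)%N%:Z by lia.
have -> : (n + k.+1)%N%:Z - 1 = (n + k)%N%:Z by lia.
have right : N = n%:Z -> (N + (n + k.+1)%N%:Z)%:~R * (r N (n + k.+2)%N + r (N + 1) (n + k.+1)%N) *
  (r N (n + k.+1)%N ^+ 2 - r (N + 1) (n + k.+1)%N * r N (n + k)%N +
   cos x * r N (n + k.+1)%N * (r N (n + k)%N - r (N + 1) (n + k.+1)%N)) +
  ((n + k.+1)%N%:Z - N)%:~R * (r N (n + k)%N + r (N + 1) (n + k.+1)%N) *
  (r N (n + k.+1)%N ^+ 2 - r (N + 1) (n + k.+1)%N * r N (n + k.+2)%N +
   cos x * r N (n + k.+1)%N * (r N (n + k.+2)%N - r (N + 1) (n + k.+1)%N)) = 0.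
  move=> ->; have -> : r (n%:Z + 1) (n + k.+1)%N = rad x n.+1 k.
    by rewrite -radius_fun_pos; congr r; lia.
  rewrite !radius_fun_pos intrB intrD -!pmulrn addnS.
  exact: rad_eqB_right.
case: NE => [/right //|NE].
case: n => [|n] in right NE *; first by apply: right; rewrite NE.
have -> : r (N + 1) (n.+1 + k.+1)%N = rad x n k.+2.
  by rewrite -radius_fun_neg; congr r; lia.
rewrite NE !radius_fun_neg intrB intrD intrN -!pmulrn addSn addnS opprK.
by have := rad_eqB_left n k; rewrite /=; lra.
Qed.

End RadiusFunction.

(** * Uniqueness of the radius function *)

Lemma eqB_axis_unique (F : fieldType) (a b e co y y' : F) :
  let X := a ^+ 2 - b * e + co * a * (e - b) in
  let L z := (z + b) * X + (e + b) * (a ^+ 2 - b * z + co * a * (z - b)) in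
  e + b != 0 -> a ^+ 2 - 2 * co * a * b + b ^+ 2 != 0 ->
  L y = 0 -> L y' = 0 -> y = y'.
Proof.
move=> X L eb0 ab0 Ly Ly'; apply/eqP; rewrite -subr_eq0.
(* [k] is the coefficient of [z] in the affine function [L]; if it vanished, [L] would be a nonzero
   constant. *)
pose k := X + (e + b) * (co * a - b).
have : (y - y') * k = 0 by rewrite -[RHS](subrr 0) -{1}Ly -Ly' /L /k; ring.
move=> /eqP; rewrite mulf_eq0 => /orP[// | /eqP k0].
have : (e + b) * (a ^+ 2 - 2 * co * a * b + b ^+ 2) = L y - (y + b) * k.
  by rewrite /L /k; ring.
by rewrite Ly k0 mulr0 subr0 => /eqP; rewrite mulf_eq0 (negPf eb0) (negPf ab0).
Qed.

Section Uniqueness.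
Variables (R : realType) (x : R).
Hypothesis x_bounds : 0 < x < pi.
Local Notation radius_fun := (radius_fun x).

(** Row by row: the border values come from the cancelled forms of (A), the value on the axis from
    (B) at [N = 0], which uses the two rows below, and the others from (A) solved for the radius
    farthest from the axis. The coefficient of the unknown is nonzero because the explicit radii are
    positive. *)
Lemma radius_unique (r : int -> int -> R) : eqA 2 r -> eqB x r ->
  Z2_initial x r -> forall N M, inV N M -> r N M = radius_fun N M.
Proof.
move=> rA rB [r00 r11 rm11 r01].
have /andP[x0 xpi] := x_bounds.
have diag (s : int -> int -> R) : eqA 2 s -> s 1 1 = 1 -> s (-1) 1 = 1 ->
    forall n : nat, s n.+1%:Z n.+1%:Z = n.+1%:R /\ s (- n.+1%:Z) n.+1%:Z = n.+1%:R.
  move=> [_ sR sL] s1 sm1; elim=> [//|n [IH1 IH2]].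
  have n0 : n.+1%:R != 0 :> R by rewrite pnatr_eq0.
  have := sR n.+1%:Z; have := sL n.+2%:Z.
  have -> : n.+1%:Z + 1 = n.+2%:Z by lia.
  have -> : n.+2%:Z - 1 = n.+1%:Z by lia.
  rewrite IH1 IH2 -!pmulrn -(natr1 n.+1) => /(_ isT) E2 /(_ isT) E1.
  by split; apply: (mulfI n0); lra.
have [_ q11 qm11 q01] := radius_fun_init x_bounds.
have [qA qB] := (radius_fun_eqA x_bounds, radius_fun_eqB x_bounds).
pose agree (m : nat) := forall n : nat, (n <= m)%N ->
  r n%:Z m%:Z = radius_fun n%:Z m%:Z /\ r (- n%:Z) m%:Z = radius_fun (- n%:Z) m%:Z.
have q_gt0 N M : inV N M -> 0 < M -> 0 < radius_fun N M.
  by move=> NM M0; apply: radius_fun_gt0 => // -[_ ME]; rewrite ME ltxx in M0.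
have step m : agree m -> agree m.-1 -> agree m.+1.
  move=> am am1.
  have axis : r 0 m.+1%:Z = radius_fun 0 m.+1%:Z.
    case: m am am1 => [_ _|m am am1]; first by rewrite r01 q01.
    have m0 : m.+1%:R != 0 :> R by rewrite pnatr_eq0.
    have a1 : r 0 m.+1 = radius_fun 0 m.+1 by case: (am 0%N isT).
    have a2 : r 0 m = radius_fun 0 m by case: (am1 0%N isT).
    have a3 : r 1 m.+1 = radius_fun 1 m.+1 by case: (am 1%N isT).
    have := rB 0 m.+1%:Z isT isT; have := qB 0 m.+1%:Z isT isT.
    have -> : m.+1%:Z + 1 = m.+2%:Z by lia.
    have -> : m.+1%:Z - 1 = m%:Z by lia.
    rewrite !add0r subr0 a1 a2 a3 -!pmulrn /= => E E'.
    have a0 : 0 < radius_fun 0 m.+1 by apply: q_gt0.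
    have b0 : 0 < radius_fun 1 m.+1 by apply: q_gt0.
    have e0 : 0 <= radius_fun 0 m by apply: rad_ge0.
    apply: (@eqB_axis_unique _ (radius_fun 0 m.+1) (radius_fun 1 m.+1)
      (radius_fun 0 m) (cos x)).
    - by rewrite gt_eqF // ltr_wpDl.
    - rewrite gt_eqF //.
      have := cos2Dsin2 x; have := sin_gt0_pi x_bounds.
      move: (radius_fun 0 m.+1) (radius_fun 1 m.+1) a0 b0 (sin x) (cos x).
      move=> a b a0 b0 s c s0 cs.
      have -> : a ^+ 2 - 2 * c * a * b + b ^+ 2 = (a - c * b) ^+ 2 + (s * b) ^+ 2 by nra.
      by rewrite ltr_wpDl ?sqr_ge0 // exprn_gt0 // mulr_gt0.
    - by apply: (mulfI m0); rewrite mulr0 -[RHS]E'; ring.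
    - by apply: (mulfI m0); rewrite mulr0 -[RHS]E; ring.
  elim=> [_|n IH nm]; first by rewrite oppr0 axis.
  have [IH1 IH2] := IH (ltnW nm).
  move: nm; rewrite leq_eqVlt => /predU1P[[nm]|nm].
    rewrite nm; have [-> ->] := diag _ rA r11 rm11 m.
    by have [-> ->] := diag _ qA q11 qm11 m.
  have [a1 a2] := am n (ltnW nm); have [b1 b2] := am n.+1 nm.
  have inVs : [/\ inV n m, inV n.+1 m, inV (- n.+1%:Z) m, inV (- n%:Z) m & 
    [/\ inV n m.+1, inV (- n%:Z) m.+1 & inV (- n.+1%:Z) m.+1]].
    by rewrite /inV; repeat split; lia.
  have [v1 v2 v3 v4 [v5 v6 v7]] := inVs.
  have m0 : 0 < m%:Z by lia.
  have mN : 0 < m%:R :> R by rewrite ltr0n; lia.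
  have n1 : n%:Z + 1 = n.+1%:Z by lia.
  have mn1 : - n.+1%:Z + 1 = - n%:Z by lia.
  have m1 : m%:Z + 1 = m.+1%:Z by lia.
  split.
  - have := eqA_interior rA v1; have := eqA_interior qA v1.
    rewrite n1 m1 IH1 a1 b1 => /(_ v2) E /(_ v2) E'.
    have b0 : 0 < radius_fun n.+1 m by apply: q_gt0.
    have c0 : 0 < radius_fun n m.+1 by apply: q_gt0.
    have d0 : n%:R * radius_fun n.+1 m + m%:R * radius_fun n m.+1 != 0.
      by rewrite gt_eqF //; apply: ltr_wpDl; [apply: mulr_ge0; [exact: ler0n|exact: ltW] | exact: mulr_gt0].
    apply: (mulfI d0); move: E E'; rewrite -!pmulrn -!(natr1 n) -!(natr1 m); lra.
  have := eqA_interior rA v3; have := eqA_interior qA v3.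
  rewrite mn1 m1 IH2 a2 b2 => /(_ v4) E /(_ v4) E'.
  have a0 : 0 < radius_fun (- n.+1%:Z) m by apply: q_gt0.
  have d0 : 0 < radius_fun (- n%:Z) m.+1 by apply: q_gt0.
  have k0 : n%:R * radius_fun (- n.+1%:Z) m + m%:R * radius_fun (- n%:Z) m.+1 != 0.
    by rewrite gt_eqF //; apply: ltr_wpDl; [apply: mulr_ge0; [exact: ler0n|exact: ltW] | exact: mulr_gt0].
  apply: (mulfI k0); move: E E'; rewrite !intrN -!pmulrn -!(natr1 n) -!(natr1 m); lra.
have all m : agree m /\ agree m.-1.
  have agree0 : agree 0%N.
    by move=> n; rewrite leqn0 => /eqP->; rewrite oppr0 r00 radius_fun00.
  by elim: m => [|m [am am1]]; split=> //; apply: step.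
move=> N M; rewrite /inV => NM; have [am _] := all `|M|%N.
have nm : (`|N| <= `|M|)%N by lia.
have ME : `|M|%N%:Z = M by lia.
have [] := am _ nm; rewrite ME.
by have [NE|NE] : N = `|N|%N%:Z \/ N = - `|N|%N%:Z; [lia|rewrite -NE|rewrite -NE].
Qed.

End Uniqueness.

Lemma eq_vec (R : realType) (u v : R * R) : u.1 = v.1 -> u.2 = v.2 -> u = v.
Proof. by case: u v => [u1 u2] [v1 v2] /= -> ->. Qed.

Lemma scalev (R : realType) (a : R) (u : R * R) : a *: u = (a * u.1, a * u.2).
Proof. by []. Qed.

(** * Radii and directions on the grid *)

Section Grid.
Variables (R : realType) (x : R).
Implicit Types u v : R * R.

Definition rotate u : R * R := (cos x * u.1 - sin x * u.2, sin x * u.1 + cos x * u.2).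

Definition conjv u : R * R := (u.1, - u.2).

Variables (rho : nat -> nat -> R) (U : nat -> nat -> R * R).

(* Edges of the discrete map: [rho] is the radius at the even points (centres),
   and [U] is the direction of the horizontal line through the odd points. *)
Definition hor_edge n m : R * R :=
  if odd (n + m) then rho n.+1 m *: U n m else rho n m *: U n.+1 m.

Definition ver_edge n m : R * R :=
  if odd (n + m) then rho n m.+1 *: rotate (U n m) else rho n m *: rotate (U n m.+1).

Definition grid_closed n m := hor_edge n m + ver_edge n.+1 m = ver_edge n m + hor_edge n m.+1.

(** [gp_turn] will orient positively both triangles into which the diagonal from (n, m) to (n+1,
    m+1) cuts a quadrilateral, convex or not. [gp_sector] provides the linear form [det2 _ w] that
    is monotone along the edges. *)
Record grid_pattern (D : nat -> nat -> bool) : Prop := {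
  gp_unit : forall n m, odd (n + m) -> dot (U n m) (U n m) = 1;
  gp_gt0 : forall n m, ~~ odd (n + m) -> (n, m) <> (0%N, 0%N) -> 0 < rho n m;
  gp_ge0 : 0 <= rho 0 0;
  gp_closed : forall n m, D n m -> grid_closed n m;
  gp_turn : forall n m, odd (n + m) ->
    - sin x <= det2 (U n m) (U n.+1 m.+1) <= sin x;
  gp_sector : exists2 w : R * R, dot w w = 1 & forall n m, odd (n + m) ->
    0 <= det2 (U n m) w /\ det2 (rotate (U n m)) w <= 0 }.

End Grid.

(** * Directions of the edges and the dual grid *)

Section Directions.
Variables (R : realType) (x : R).
Hypothesis x_bounds : 0 < x < pi.

Implicit Types u v : R * R.

Local Notation c := (cos x).
Local Notation s := (sin x).
Local Notation rot := (rotate x).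
Local Notation rad := (rad x).
Local Notation slope := (slope x).
Local Notation slant := (slant x).

(** For positive index, the unit vector along e^{ix} + [slope]. Index 0 belongs to the border
    [m = 0], which is a straight line. *)
Definition dir N k : R * R :=
  if k is k'.+1 then ((c + slope N k') / slant N k', s / slant N k') else (1, 0).

(** The reflection exchanging (1, 0) and (cos x, sin x); it realises the symmetry N -> -N on
    directions. *)
Definition mirror (u : R * R) : R * R := rot (conjv u).

Lemma sqr_sin_cos : s ^+ 2 = 1 - c ^+ 2.
Proof. by rewrite -(cos2Dsin2 x); ring. Qed.

Lemma sin_x_gt0 : 0 < s. Proof. exact: sin_gt0_pi. Qed.

Lemma dir_unit N k : dot (dir N k) (dir N k) = 1.
Proof.
case: k => [|k]; rewrite /dot /=; first by ring.
have D0 : slant N k != 0 by rewrite gt_eqF ?slant_gt0.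
rewrite -!expr2 !expr_div_n -mulrDl slant_sqr //.
have -> : (c + slope N k) ^+ 2 + s ^+ 2 = 1 + 2 * c * slope N k + slope N k ^+ 2.
  by rewrite sqr_sin_cos; ring.
by rewrite -slant_sqr // divff // expf_neq0.
Qed.

Lemma dir_sector N k : 0 <= (dir N k).2 /\ 0 <= det2 (dir N k) (c, s).
Proof.
have s0 := sin_x_gt0.
case: k => [|k]; rewrite /det2 /=; first by split=> //; rewrite mul1r mul0r subr0 ltW.
have D0 := slant_gt0 x_bounds N k; have g0 := slope_gt0 x_bounds N k.
split; first by rewrite divr_ge0 // ltW.
have -> : (c + slope N k) / slant N k * s - s / slant N k * c = slope N k * s / slant N k.
  by field; rewrite gt_eqF.
by apply: divr_ge0; apply: ltW; rewrite // mulr_gt0.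
Qed.

(** Once denominators are cleared, both coordinates for [k > 0] are combinations of [con], which
    restates [slant_rad2] and [slant_rad3], and of [key], which comes from their squares and
    [slant_sqr]. *)
Lemma dir_kite_even N k :
  rad N.+1 k *: dir N.+1 k + rad N.+1 k.+1 *: rot (dir N.+1 k) =
  rad N.+1 k *: rot (dir N k.+1) + rad N.+1 k.+1 *: dir N k.+1.
Proof.
have s2 := sqr_sin_cos.
have n0 : N.+1%:R != 0 :> R by rewrite pnatr_eq0.
have D0 : slant N k != 0 by rewrite gt_eqF ?slant_gt0.
have ED := slant_rad2 x_bounds N k.
have ED2 := slant_sqr x_bounds N k.
move: (slope_gt0 x_bounds N k) (rad_gt0 x_bounds (isT : (0 < N.+1 + k)%N)).
case: k => [|k] in D0 ED ED2 *.
  rewrite rad0 in ED *.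
  set a := N.+1%:R in n0 ED *; move: ED D0 ED2 => /=.
  move: (slope N 0) (rad N.+1 1) (slant N 0) => g r D ED D0 ED2 g0 _.
  have key : (g * r - a) * r = a * (r + a * (2 * c + g)).
    apply: (mulfI (lt0r_neq0 g0)).
    have := congr1 (fun z => z ^+ 2) ED; rewrite exprMn ED2 => E; lra.
  have DE : D = (g * r - a) / a by rewrite -ED mulrAC divff ?mul1r.
  have k0 : g * r - a != 0 by rewrite -ED mulf_neq0.
  apply: eq_vec; rewrite !scalev /rotate /= ?mulr1 ?mulr0 ?subr0 ?addr0.
    apply: (mulIf D0).
    transitivity (a * (c * (c + g) - s ^+ 2) + r * (c + g)); last by field.
     apply: (mulfI n0); rewrite s2.
    transitivity ((a + r * c) * (a * D)); first by ring.
    have := congr1 (fun z => c * z) key.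
    by rewrite ED /=; lra.
  apply: (mulIf D0).
  transitivity (a * (s * (c + g) + c * s) + r * s); last by field.
  apply: (mulfI n0); transitivity ((r * s) * (a * D)); first by ring.
  have := congr1 (fun z => s * z) key.
  by rewrite ED /=; lra.
have E3 := slant_rad3 x_bounds N.+1 k.
have E2 := slant_sqr x_bounds N.+1 k.
have E0 := slant_gt0 x_bounds N.+1 k.
have y0 := slope_gt0 x_bounds N.+1 k.
have Dgt := slant_gt0 x_bounds N k.+1.
have ngt : 0 < N.+1%:R :> R by rewrite ltr0n.
rewrite /dir; move: ED D0 ED2 Dgt E3 E2 E0 y0; set n := N.+1%:R in n0 ngt *.
move: (slope N k.+1) (slant N k.+1) (rad N.+1 k.+1) (rad N.+1 k.+2).
move: (slope N.+1 k) (slant N.+1 k).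
move=> y E g D a r ED D0 ED2 Dgt E3 E2 E0 y0 g0 a0.
have key : (g * r - a) * (a + 2 * c * r + y * r) = (a * y - r) * (r + 2 * c * a + g * a).
  (* The two instances of [slant_sqr] yield [key] only up to the factor [y * g - 1], which
     positivity of the slants shows to be positive. *)
  have p0 : y * g - 1 != 0.
    rewrite gt_eqF //.
    have h1 : 0 < a * y - r by rewrite [a * y]mulrC -E3 mulr_gt0.
    have h2 : 0 < g * r - a by rewrite -ED mulr_gt0.
    have r0 : 0 < r by rewrite -(pmulr_rgt0 _ g0); lra.
    have : 0 < (a * y - r) * g * r + r * (g * r - a).
      by rewrite addr_gt0 ?mulr_gt0.
    have -> : (a * y - r) * g * r + r * (g * r - a) = (y * g - 1) * (a * r) by ring.
    by rewrite pmulr_lgt0 ?mulr_gt0.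
  apply/eqP; rewrite -subr_eq0; apply/eqP; apply: (mulfI p0); rewrite mulr0.
  have F1 : n ^+ 2 * (1 + 2 * c * y + y ^+ 2) = (a * y - r) ^+ 2.
    by rewrite -E2 -exprMn E3 mulrC.
  have F2 : n ^+ 2 * (1 + 2 * c * g + g ^+ 2) = (g * r - a) ^+ 2.
    by rewrite -ED2 -exprMn ED.
  transitivity ((1 + 2 * c * y + y ^+ 2) * (g * r - a) ^+ 2 -
                (1 + 2 * c * g + g ^+ 2) * (a * y - r) ^+ 2); first by ring.
  by rewrite -F1 -F2; ring.
have E0' : E != 0 by rewrite gt_eqF.
have {}key : (n * D) * (a + 2 * c * r + y * r) = (n * E) * (r + 2 * c * a + g * a).
  by rewrite ED E3 key [y * a]mulrC.
have {}key : D * (a + 2 * c * r + y * r) = E * (r + 2 * c * a + g * a).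
  by apply: (mulfI n0); rewrite !mulrA.
have con : D * (y * a - r) = E * (g * r - a).
  by rewrite -E3 -ED; ring.
apply: eq_vec; rewrite !scalev /rotate /=.
  apply: (mulIf E0'); apply: (mulIf D0).
  transitivity (D * (a * (c + y) + r * (c * (c + y) - s ^+ 2))); first by field.
  transitivity (E * (a * (c * (c + g) - s ^+ 2) + r * (c + g))); last first.
    by field; rewrite D0.
  rewrite s2.
  transitivity (c * (D * (a + 2 * c * r + y * r)) + D * (y * a - r)); first by ring.
  by rewrite key con; ring.
apply: (mulIf E0'); apply: (mulIf D0).
transitivity (D * (a * s + r * (s * (c + y) + c * s))); first by field.
transitivity (E * (a * (s * (c + g) + c * s) + r * s)); last by field; rewrite D0.
transitivity (s * (D * (a + 2 * c * r + y * r))); first by ring.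
by rewrite key; ring.
Qed.

(** Here the quadrilateral lies on the symmetry axis. For [k > 0] the ratio of its two radii is the
    [slope] that also defines the direction, by [slant_rad3] with [N = 0]. *)
Lemma dir_kite_axis k :
  rad 0 k *: dir 0 k + rad 0 k.+1 *: rot (dir 0 k) =
  rad 0 k *: rot (mirror (dir 0 k)) + rad 0 k.+1 *: mirror (dir 0 k).
Proof.
have s2 := sqr_sin_cos.
case: k => [|k].
  rewrite rad0; apply: eq_vec; rewrite !scalev /mirror /rotate /conjv /=; ring.
have := slant_rad3 x_bounds 0 k; rewrite mul0r => /eqP; rewrite eq_sym subr_eq0 => /eqP E.
have D0 : slant 0 k != 0 by rewrite gt_eqF ?slant_gt0.
rewrite /dir -E; move: (rad 0 k.+1) (slope 0 k) (slant 0 k) D0 => a g D D0.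
apply: eq_vec; rewrite !scalev /mirror /rotate /conjv /=; apply: (mulIf D0).
  transitivity (a * (c + g + g * (c * (c + g) - s ^+ 2))); first by field.
  transitivity (a * ((c * (c * (c + g) + s ^+ 2) - s * (s * (c + g) - c * s)) +
     g * (c * (c + g) + s ^+ 2))); last by field.
  have -> : s * (s * (c + g) - c * s) = s ^+ 2 * g by ring.
  by rewrite s2; ring.
transitivity (a * (s + g * (s * (c + g) + c * s))); first by field.
transitivity (a * ((s * (c * (c + g) + s ^+ 2) + c * (s * (c + g) - c * s)) +
     g * (s * (c + g) - c * s))); last by field.
by rewrite s2; ring.
Qed.

Lemma dir_kite_odd N k :
  rad N.+1 k *: dir N k + rad N.+1 k *: rot (dir N k.+1) =
  rad N k.+1 *: rot (dir N k) + rad N k.+1 *: dir N k.+1.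
Proof.
have s2 := sqr_sin_cos.
have D0 : slant N k != 0 by rewrite gt_eqF ?slant_gt0.
suff : refl x N.+1 k *: dir N k + refl x N.+1 k *: rot (dir N k.+1) =
    refl x N k.+1 *: rot (dir N k) + refl x N k.+1 *: dir N k.+1.
  rewrite /rad addnS addSn; move: (refl x N.+1 k) (refl x N k.+1) => t t' H.
  by rewrite -!scalerA -!scalerDr; congr (_ *: _); rewrite !scalerDr.
case: k => [|k] in D0 *.
  have := slope0 x_bounds N; move: D0; rewrite /dir /slant refl0.
  move: (slope N 0) (refl x N 1) => g u D0 E.
  apply: eq_vec; rewrite !scalev /rotate /=; apply: (mulIf D0).
    transitivity ((1 + g * u) + (c * (c + g) - s ^+ 2)); first by field.
    transitivity (u * c * (1 + g * u) + u * (c + g)); last by field.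
    rewrite s2; have := congr1 (fun z => z * c) E; lra.
  transitivity (s * (c + g) + c * s); first by field.
  transitivity (u * s * (1 + g * u) + u * s); last by field.
  have := congr1 (fun z => z * s) E; lra.
have E0 : slant N k != 0 by rewrite gt_eqF ?slant_gt0.
have n0 := refl_sqr_lt1 x_bounds N.+1 k.
have E5 := slopeS x_bounds N k.
have := slant_sqr x_bounds N k.+1.
rewrite /dir; move: D0 E0; rewrite (slantE x_bounds N k) /slant.
move: (refl x N.+1 k.+1) (refl x N k.+2) (slope N k) (slope N k.+1) n0 E5.
move=> t t' y g n0 E5 D0 E0 Eg.
(* Multiplied by 1 - t^2, the difference of the two sides is a combination of [slant_sqr] and
   [slopeS]. *)
have key : (t - y * t' - 2 * c * t') * (t + g * t') = (t' - g * t - 2 * c * t) * (y * t + t').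
  apply: (mulfI (lt0r_neq0 n0)); apply/eqP; rewrite -subr_eq0; apply/eqP.
  transitivity ((t ^+ 2 - t' ^+ 2) * (1 + 2 * c * g + g ^+ 2 - (t + g * t') ^+ 2) +
    (g * (1 - t' ^+ 2) - y * (1 - t ^+ 2)) *
      (2 * t * t' - 2 * c * t ^+ 2 - g * (t ^+ 2 - t' ^+ 2))); first by ring.
  by rewrite -Eg E5; ring.
apply: eq_vec; rewrite !scalev /rotate /=; apply: (mulIf D0); apply: (mulIf E0).
  transitivity (t * ((c + y) * (t + g * t')) +
      t * (c * (c + g) - s ^+ 2) * (y * t + t')); first by field; rewrite E0 D0.
  transitivity (t' * (c * (c + y) - s ^+ 2) * (t + g * t') + t' * (c + g) * (y * t + t')).
    rewrite s2; have := congr1 (fun z => z * c) key; lra.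
  by field; rewrite E0 D0.
transitivity (t * s * (t + g * t') + t * (s * (c + g) + c * s) * (y * t + t')).
  by field; rewrite E0 D0.
transitivity (t' * (s * (c + y) + c * s) * (t + g * t') + t' * s * (y * t + t')).
  have := congr1 (fun z => z * s) key; lra.
by field; rewrite E0 D0.
Qed.

(** The determinant is [sin x] times the difference of consecutive slopes over the product of the
    slants. With t, t' the two shared coefficients, [slopeS] makes that difference y t^2 - g t'^2,
    while the product expands to y t^2 + g t'^2 plus a positive term. *)
Lemma dir_turn N k : - s <= det2 (dir N k) (dir N k.+1) <= s.
Proof.
have s0 := sin_x_gt0; have D0 := slant_gt0 x_bounds N k.
have g0 := slope_gt0 x_bounds N k.
case: k => [|k] in D0 g0 *.
  have D1 : 1 <= slant N 0.
    by rewrite /slant refl0 lerDl mulr_ge0 // ltW // refl_gt0.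
  rewrite /det2 /dir /= mul1r mul0r subr0.
  have : 0 <= s / slant N 0 by rewrite divr_ge0 // ltW.
  have : s / slant N 0 <= s by rewrite ler_pdivrMr // ler_peMr // ltW.
  lra.
have E0 := slant_gt0 x_bounds N k; have y0 := slope_gt0 x_bounds N k.
have t0 := refl_gt0 x_bounds N.+1 k.+1; have t0' := refl_gt0 x_bounds N k.+2.
have E5 := slopeS x_bounds N k.
have -> : det2 (dir N k.+1) (dir N k.+2) =
    s * ((slope N k - slope N k.+1) / (slant N k * slant N k.+1)).
  rewrite /det2 /=; field; by rewrite !gt_eqF.
have DE0 : 0 < slant N k * slant N k.+1 by rewrite mulr_gt0.
suff : -1 <= (slope N k - slope N k.+1) / (slant N k * slant N k.+1) <= 1.
  move: (_ / _) => z; nra.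
rewrite ler_pdivlMr // ler_pdivrMr // mulN1r mul1r (slantE x_bounds N k).
rewrite -[slant N k.+1]/(refl x N.+1 k.+1 + slope N k.+1 * refl x N k.+2).
move: (slope N k) (slope N k.+1) y0 g0 (refl x N.+1 k.+1) (refl x N k.+2) t0 t0' E5.
move=> y g y0 g0 t t' t0 t0' E5.
have h1 : 0 < t * t' * (1 + y * g) by rewrite !mulr_gt0 // addr_gt0 ?mulr_gt0.
have h2 : 0 < y * t ^+ 2 by rewrite mulr_gt0 ?exprn_gt0.
have h3 : 0 < g * t' ^+ 2 by rewrite mulr_gt0 ?exprn_gt0.
by apply/andP; split; lra.
Qed.

Lemma mirrorK u : mirror (mirror u) = u.
Proof.
have s2 := sqr_sin_cos.
apply: eq_vec; rewrite /mirror /rotate /conjv /=.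
  by transitivity ((c ^+ 2 + s ^+ 2) * u.1); [ring|rewrite s2; ring].
by transitivity ((c ^+ 2 + s ^+ 2) * u.2); [ring|rewrite s2; ring].
Qed.

(** With n = N + M and m = M - N, the smaller of [n] and [m] is M - |N| and half their distance is
    |N|. *)
Definition zrho n m : R :=
  if (m <= n)%N then rad (n - m)./2 m else rad (m - n)./2 n.

Definition zdir n m : R * R :=
  if (m < n)%N then dir (n - m).-1./2 m else mirror (dir (m - n).-1./2 n).

Lemma zrhoE N k : zrho (k + N.*2) k = rad N k.
Proof. by rewrite /zrho leq_addr addKn doubleK. Qed.

Lemma zdirE N k : zdir (k + N.*2).+1 k = dir N k.
Proof.
rewrite /zdir ltnS leq_addr; congr dir.
by rewrite -addnS addKn doubleK.
Qed.

Lemma zrho_sym n m : zrho n m = zrho m n.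
Proof. by rewrite /zrho; case: (ltngtP n m) => // ->. Qed.

Lemma zdir_sym n m : n != m -> zdir n m = mirror (zdir m n).
Proof. by rewrite /zdir; case: (ltngtP n m) => //; rewrite mirrorK. Qed.

Lemma odd_cases n m : odd (n + m) ->
  exists N, n = (m + N.*2).+1 \/ m = (n + N.*2).+1.
Proof.
by move=> nm; case: (ltngtP n m) => h; [exists (m - n).-1./2; right|
  exists (n - m).-1./2; left|exists 0%N]; lia.
Qed.

Local Notation hor := (hor_edge zrho zdir).
Local Notation ver := (ver_edge x zrho zdir).

(** The reflection in the line of direction (cos x, sin x); it carries the edges at (n, m) to those
    at (m, n), exchanging horizontal and vertical. *)
Let flip u := rot (mirror u).

Lemma flip_rot u : flip (rot u) = mirror u.
Proof.
have s2 := sqr_sin_cos.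
apply: eq_vec; rewrite /flip /mirror /rotate /conjv /=.
  transitivity ((c ^+ 2 + s ^+ 2) * (c * u.1 + s * u.2)); first by ring.
  by rewrite s2; ring.
transitivity ((c ^+ 2 + s ^+ 2) * (s * u.1 - c * u.2)); first by ring.
by rewrite s2; ring.
Qed.

Lemma flipZ a u : flip (a *: u) = a *: flip u.
Proof. by apply: eq_vec; rewrite !scalev /flip /mirror /rotate /conjv /=; ring. Qed.

Lemma flipD u v : flip (u + v) = flip u + flip v.
Proof. by apply: eq_vec; rewrite /flip /mirror /rotate /conjv /=; ring. Qed.

Lemma hor_sym n m : hor n m = flip (ver m n).
Proof.
rewrite /hor_edge /ver_edge [(m + n)%N]addnC; case: ifP => nm; rewrite flipZ flip_rot.
  by rewrite zrho_sym zdir_sym //; lia.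
by rewrite zrho_sym zdir_sym //; lia.
Qed.

Lemma ver_sym n m : ver n m = flip (hor m n).
Proof.
rewrite /hor_edge /ver_edge [(m + n)%N]addnC; case: ifP => nm; rewrite flipZ.
  by rewrite zrho_sym zdir_sym //; lia.
by rewrite zrho_sym zdir_sym //; lia.
Qed.

Lemma Z2_closed n m : grid_closed x zrho zdir n m.
Proof.
rewrite /grid_closed.
suff H k j : hor (k + j) k + ver (k + j).+1 k = ver (k + j) k + hor (k + j) k.+1.
  have [mn|nm] := leqP m n; first by have := H m (n - m)%N; rewrite subnKC.
  have := H n (m - n)%N; rewrite subnKC ?(ltnW nm) // => /(congr1 flip).
  rewrite (flipD (hor m n)) (flipD (ver m n)).
  by rewrite -(hor_sym n m.+1) -(ver_sym n m) -(hor_sym n m) -(ver_sym n.+1 m).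
have {j} [N [->|->]] : exists N, j = N.*2 \/ j = N.*2.+1.
- by exists j./2; lia.
- have ev : odd (k + N.*2 + k) = false by lia.
  rewrite /hor_edge /ver_edge addSn !addnS /= ev /= zdirE -[(k + N.*2).+1]/(k.+1 + N.*2)%N !zrhoE.
  case: N {ev} => [|N].
    rewrite addn0 zdir_sym; last by lia.
    by have := zdirE 0 k; rewrite addn0 => ->; exact: dir_kite_axis.
  have -> : (k + N.+1.*2)%N = (k.+1 + N.*2).+1 by lia.
  by rewrite zdirE; exact: dir_kite_even.
have {n m} [n nE] : exists n, n = (k + N.*2).+1 by exists (k + N.*2).+1.
have od : odd (n + k) by lia.
have -> : (k + N.*2.+1)%N = n by lia.
rewrite /hor_edge /ver_edge addSn !addnS /= od /=.
have -> : zrho n.+1 k = rad N.+1 k by rewrite -zrhoE; congr zrho; lia.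
have -> : zrho n k.+1 = rad N k.+1 by rewrite -zrhoE; congr zrho; lia.
have -> : zdir n k = dir N k by rewrite -zdirE nE.
have -> : zdir n.+1 k.+1 = dir N k.+1 by rewrite -zdirE nE.
exact: dir_kite_odd.
Qed.

Lemma mirror_dot u v : dot (mirror u) (mirror v) = dot u v.
Proof.
have s2 := sqr_sin_cos; rewrite /dot /mirror /rotate /conjv /=.
transitivity ((c ^+ 2 + s ^+ 2) * (u.1 * v.1 + u.2 * v.2)); first by ring.
by rewrite s2; ring.
Qed.

Lemma mirror_det2 u v : det2 (mirror u) (mirror v) = - det2 u v.
Proof.
have s2 := sqr_sin_cos; rewrite /det2 /mirror /rotate /conjv /=.
transitivity (- (c ^+ 2 + s ^+ 2) * (u.1 * v.2 - u.2 * v.1)); first by ring.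
by rewrite s2; ring.
Qed.

Lemma zdir_sector n m : odd (n + m) -> 0 <= (zdir n m).2 /\ 0 <= det2 (zdir n m) (c, s).
Proof.
have s2 := sqr_sin_cos.
move=> /odd_cases[N [->|->]]; first by rewrite zdirE; exact: dir_sector.
rewrite zdir_sym; last by lia.
rewrite zdirE; have [] := dir_sector N n; move: (dir N n) => u h1 h2.
split; first by move: h2; rewrite /mirror /rotate /conjv /det2 /=; lra.
have -> : det2 (mirror u) (c, s) = (c ^+ 2 + s ^+ 2) * u.2.
  by rewrite /mirror /rotate /conjv /det2 /=; ring.
by rewrite s2 addrC subrK mul1r.
Qed.

Lemma zrho_gt0 n m : ~~ odd (n + m) -> (n, m) <> (0%N, 0%N) -> 0 < zrho n m.
Proof.
move=> nm nm0; rewrite /zrho; case: ifP => h; apply: rad_gt0 => //.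
  by rewrite lt0n; apply/eqP => E; apply: nm0; congr (_, _); lia.
by rewrite lt0n; apply/eqP => E; apply: nm0; congr (_, _); lia.
Qed.

Lemma zdir_unit n m : odd (n + m) -> dot (zdir n m) (zdir n m) = 1.
Proof.
move=> /odd_cases[N [->|->]]; first by rewrite zdirE dir_unit.
by rewrite zdir_sym ?zdirE ?mirror_dot ?dir_unit //; lia.
Qed.

Lemma zdir_turn n m : odd (n + m) -> - s <= det2 (zdir n m) (zdir n.+1 m.+1) <= s.
Proof.
move=> /odd_cases[N [->|->]].
  by rewrite -[(m + N.*2).+2]/(m.+1 + N.*2).+1 !zdirE; exact: dir_turn.
rewrite zdir_sym; last by lia.
rewrite [zdir n.+1 _]zdir_sym; last by lia.
rewrite -[(n + N.*2).+2]/(n.+1 + N.*2).+1 !zdirE mirror_det2.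
by have := dir_turn N n; lra.
Qed.

Lemma Z2_grid : grid_pattern x zrho zdir Z2_domain.
Proof.
have s2 := sqr_sin_cos.
split.
- exact: zdir_unit.
- exact: zrho_gt0.
- by rewrite /zrho /= rad0.
- by move=> n m _; exact: Z2_closed.
- exact: zdir_turn.
exists (c, s); first by rewrite /dot /= -!expr2 s2; ring.
move=> n m /zdir_sector[h1 h2]; split=> //.
have -> : det2 (rot (zdir n m)) (c, s) = - ((c ^+ 2 + s ^+ 2) * (zdir n m).2).
  by rewrite /rotate /det2 /=; ring.
by rewrite s2 addrC subrK mul1r oppr_le0.
Qed.

Lemma mirror_rot u : mirror (rot u) = conjv u.
Proof.
have s2 := sqr_sin_cos; apply: eq_vec; rewrite /mirror /rotate /conjv /=.
  by transitivity ((c ^+ 2 + s ^+ 2) * u.1); [ring|rewrite s2; ring].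
by transitivity (- (c ^+ 2 + s ^+ 2) * u.2); [ring|rewrite s2; ring].
Qed.

Lemma mirrorZ a u : mirror (a *: u) = a *: mirror u.
Proof. by apply: eq_vec; rewrite !scalev /mirror /rotate /conjv /=; ring. Qed.

Lemma mirrorD u v : mirror (u + v) = mirror u + mirror v.
Proof. by apply: eq_vec; rewrite /mirror /rotate /conjv /=; ring. Qed.

(** Under [mirror] a direction becomes the rotation of its conjugate, and a rotated direction
    becomes its conjugate; division by [a * r] then replaces each radius by the inverse of the
    other. *)
Lemma dual_even (a r : R) u v : a != 0 -> r != 0 ->
  a *: u + r *: rot u = a *: rot v + r *: v ->
  a^-1 *: conjv u + r^-1 *: rot (conjv u) = a^-1 *: rot (conjv v) + r^-1 *: conjv v.
Proof.
move=> a0 r0 /(congr1 mirror); rewrite !mirrorD !mirrorZ !mirror_rot => H.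
have aE : a^-1 = (a * r)^-1 * r by field; rewrite r0 a0.
have rE : r^-1 = (a * r)^-1 * a by field; rewrite r0 a0.
rewrite aE rE -!scalerA -!scalerDr; congr (_ *: _).
by rewrite addrC H addrC.
Qed.

Lemma dual_odd (a r : R) u v : a != 0 -> r != 0 ->
  a *: u + a *: rot v = r *: rot u + r *: v ->
  a^-1 *: conjv u + a^-1 *: rot (conjv v) = r^-1 *: rot (conjv u) + r^-1 *: conjv v.
Proof.
move=> a0 r0 /(congr1 mirror); rewrite !mirrorD !mirrorZ !mirror_rot => H.
have aE : a^-1 = (a * r)^-1 * r by field; rewrite r0 a0.
have rE : r^-1 = (a * r)^-1 * a by field; rewrite r0 a0.
rewrite -!scalerDr aE rE -!scalerA; congr (_ *: _).
by rewrite !scalerDr -H.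
Qed.

Lemma conjv_det2 u v : det2 (conjv u) (conjv v) = - det2 u v.
Proof. by rewrite /det2 /conjv /=; ring. Qed.

Lemma Log_grid : grid_pattern x (fun n m => (zrho n m)^-1)
  (fun n m => conjv (zdir n m)) Log_domain.
Proof.
have [unit gt0 ge0 closed turn _] := Z2_grid; split.
- by move=> n m /unit; rewrite /dot /conjv /= mulrNN.
- by move=> n m nm nm0; rewrite invr_gt0 gt0.
(* [zrho 0 0] is 0 and its inverse is 0 by convention; [Log_domain] keeps this value out of every
   closing condition. *)
- by rewrite invr_ge0.
- move=> n m nm0; have := closed n m isT.
  have pos k l : ~~ odd (k + l) -> (k, l) <> (0%N, 0%N) -> zrho k l != 0.
    by move=> kl kl0; rewrite gt_eqF ?gt0.
  rewrite /grid_closed /hor_edge /ver_edge addSn addnS /=; case: ifP => od /= E.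
    by apply: dual_odd E; apply: pos; rewrite ?addSn ?addnS /= ?od.
  apply: dual_even E; last by apply: pos; rewrite ?addSn ?addnS /= ?od.
  by apply: pos; rewrite ?od //; exact/eqP.
- by move=> n m /turn; rewrite conjv_det2; lra.
exists (1, 0); first by rewrite /dot /=; ring.
move=> n m /zdir_sector[h1 h2]; rewrite /det2 /conjv /rotate /=; split; first by lra.
by move: h2; rewrite /det2 /=; lra.
Qed.

End Directions.

Local Open Scope classical_set_scope.

(** * Monotone grids are embedded *)

Section QuadInner.
Variable R : realType.
Implicit Types (p q u v w : R * R) (a b t : R).

Lemma continuous_line p v : continuous (fun t : R => p + t *: v).
Proof.
move=> t; apply: cvgD; first exact: cvg_cst.
by apply: cvgZ; [exact: cvg_id|exact: cvg_cst].
Qed.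

Lemma closed_segment p q : closed (segment p q).
Proof.
apply: compact_closed; first exact: norm_hausdorff.
apply: continuous_compact; first exact/continuous_subspaceT/continuous_line.
have -> : [set t : R | 0 <= t <= 1] = `[0, 1]%classic.
  by apply/seteqP; split=> t /=; rewrite in_itv.
exact: segment_compact.
Qed.

Lemma closed_quad_boundary q0 q1 q2 q3 : closed (quad_boundary q0 q1 q2 q3).
Proof. by do 3?apply: closedU; exact: closed_segment. Qed.

Lemma connected_line p v (A : set R) :
  is_interval A -> connected [set p + t *: v | t in A].
Proof.
move=> iA; apply: connected_continuous_connected; first exact/connected_intervalP.
exact/continuous_subspaceT/continuous_line.
Qed.

(** A ray missing the boundary would be connected, hence contained in the bounded component of [p],
    although it is unbounded. *)
Lemma quad_inner_ray q0 q1 q2 q3 p v : quad_inner q0 q1 q2 q3 p -> v != 0 ->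
  exists2 t : R, 0 < t & quad_boundary q0 q1 q2 q3 (p + t *: v).
Proof.
move=> [pB bnd] v0; apply: contrapT => noray.
have [M [M0 hM]] := pinfty_ex_gt0 bnd.
set t := (M + `|p| + 1) / `|v|.
have t0 : 0 <= t by rewrite divr_ge0 // !addr_ge0 // ltW.
have sub : [set p + t *: v | t in [set t : R | 0 <= t]] `<=`
    connected_component (~` quad_boundary q0 q1 q2 q3) p.
  apply: connected_component_max.
  - by exists 0; rewrite ?scale0r ?addr0 /=.
  - move=> _ /= [u + <-]; rewrite le_eqVlt => /predU1P[<-|u0].
      by rewrite scale0r addr0.
    by move=> uB; apply: noray; exists u.
  - by apply: connected_line => y z /= y0 _ w /andP[yw _]; exact: le_trans yw.
have /hM /= : connected_component (~` quad_boundary q0 q1 q2 q3) p (p + t *: v).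
  by apply: sub; exists t.
have := lerB_normD (t *: v) p; rewrite [t *: v + p]addrC normrZ ger0_norm //.
rewrite /t divfK ?normr_eq0 //; lra.
Qed.

(** Allows a common point of two quadrilaterals to be moved to a level that contains none of their
    vertices. *)
Lemma quad_inner_shift q0 q1 q2 q3 p v : quad_inner q0 q1 q2 q3 p ->
  exists2 d : R, 0 < d & forall t, 0 <= t < d -> quad_inner q0 q1 q2 q3 (p + t *: v).
Proof.
set B := quad_boundary q0 q1 q2 q3; move=> [pB bnd].
have oB : open (~` B) by apply: closed_openC; exact: closed_quad_boundary.
have : nbhs (0 : R) [set t | (~` B) (p + t *: v)].
  apply: (@continuous_line p v 0); rewrite scale0r addr0.
  exact: open_nbhs_nbhs.
move=> /nbhs_ballP[d /= d0 dB]; exists d => // t /andP[t0 td].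
have tB (u : R) : 0 <= u <= t -> (~` B) (p + u *: v).
  move=> /andP[u0 ut]; apply: dB; rewrite /ball /= sub0r normrN ger0_norm //.
  exact: le_lt_trans td.
have E : connected_component (~` B) p (p + t *: v).
  apply: (@connected_component_max _ _ [set p + u *: v | u in [set u : R | 0 <= u <= t]]).
  - by exists 0; rewrite ?scale0r ?addr0 //= lexx.
  - by move=> _ /= [u + <-]; exact: tB.
  - apply: connected_line => y z /= /andP[y0 _] /andP[_ zt] w /andP[yw wz].
    by rewrite (le_trans y0 yw) (le_trans wz zt).
  - by exists t; rewrite //= lexx t0.
split; first by apply: tB; rewrite t0 lexx.
by rewrite -(same_connected_component E).
Qed.

End QuadInner.

(** * Quadrilaterals cut by a level line *)

Section Staircase.
Variables (R : realType) (w : R * R).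
Hypothesis w_unit : dot w w = 1.
Implicit Types (p q u v A B C D P Q : R * R) (t : R).

Let H v : R := det2 v w.
Let K v : R := dot v w.

(* The [K]-coordinate of the point of level [t] on the line through [P] and [Q]. *)
Definition crossing P Q t : R := K P + (t - H P) / (H Q - H P) * (K Q - K P).

Lemma crossingC P Q t : H P != H Q -> crossing P Q t = crossing Q P t.
Proof.
rewrite /crossing => PQ; field.
by rewrite !subr_eq0 [H Q == _]eq_sym PQ.
Qed.

Lemma segmentC P Q p : segment P Q p -> segment Q P p.
Proof.
move=> [t /andP[t0 t1] <-]; exists (1 - t); first by apply/andP; split; lra.
by apply: eq_vec; rewrite !scalev /=; ring.
Qed.

Lemma segment_crossing P Q p t : segment P Q p -> H p = t -> H P != t -> H Q != t ->
  H P <= H Q -> H P < t < H Q /\ K p = crossing P Q t.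
Proof.
move=> [u /andP[u0 u1] <-].
have -> : H (P + u *: (Q - P)) = H P + u * (H Q - H P).
  by rewrite /H /det2 scalev /=; ring.
have -> : K (P + u *: (Q - P)) = K P + u * (K Q - K P).
  by rewrite /K /dot scalev /=; ring.
move=> E Pt Qt PQ.
have PQ0 : H Q - H P != 0.
  by apply: contra_neq Pt => PQ0; rewrite -E PQ0 mulr0 addr0.
split; last by rewrite /crossing -E; field.
by rewrite !lt_neqAle Pt [t == _]eq_sym Qt /=; apply/andP; split; nra.
Qed.

Lemma det2_HK u v : det2 u v = H u * K v - K u * H v.
Proof.
rewrite -[LHS]mulr1 -w_unit /H /K /det2 /dot; ring.
Qed.

Lemma crossing_below P Q Q' t : H P <= t -> t < H Q -> t < H Q' ->
  0 <= det2 (Q - P) (Q' - P) -> crossing P Q t <= crossing P Q' t.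
Proof.
move=> Pt Qt Q't; rewrite det2_HK.
have HB u v : H (u - v) = H u - H v by rewrite /H /det2 /=; ring.
have KB u v : K (u - v) = K u - K v by rewrite /K /dot /=; ring.
rewrite !HB !KB /crossing => d.
rewrite lerD2l -!mulrA; apply: ler_wpM2l; first by rewrite subr_ge0.
rewrite mulrC [leRHS]mulrC.
have h : 0 < H Q - H P by lra.
have h' : 0 < H Q' - H P by lra.
by rewrite ler_pdivrMr // mulrAC ler_pdivlMr //; lra.
Qed.

Lemma crossing_above P Q Q' t : t < H P -> H Q <= t -> H Q' <= t ->
  det2 (Q - P) (Q' - P) <= 0 -> crossing P Q t <= crossing P Q' t.
Proof.
move=> Pt Qt Q't; rewrite det2_HK.
have HB u v : H (u - v) = H u - H v by rewrite /H /det2 /=; ring.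
have KB u v : K (u - v) = K u - K v by rewrite /K /dot /=; ring.
rewrite !HB !KB /crossing => d.
have h : 0 < H P - H Q by lra.
have h' : 0 < H P - H Q' by lra.
have flip X : (t - H P) / (H X - H P) = (H P - t) / (H P - H X).
  by rewrite -(opprB (H P)) -(opprB (H P)) invrN mulrNN.
rewrite lerD2l !flip -!mulrA ler_pM2l ?subr_gt0 // mulrC [leRHS]mulrC.
by rewrite ler_pdivrMr // mulrAC ler_pdivlMr //; lra.
Qed.

Section Quad.
Variables (A B C D : R * R).

Definition entry t : R := if t < H A then crossing A D t else crossing A B t.
Definition exit t : R := if t < H C then crossing D C t else crossing B C t.

Hypotheses (HDA : H D <= H A) (HAB : H A <= H B) (HDC : H D <= H C) (HCB : H C <= H B).
Hypotheses (ABC : 0 <= det2 (B - A) (C - A)) (ACD : 0 <= det2 (C - A) (D - A)).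

(** The chains D, A, B and D, C, B both rise from [D] to [B]. If [A] and [C] lie on the same side of
    the level, the two edges cut share the end point [D] or [B] and the orientation compares them;
    otherwise the diagonal from [A] to [C] is cut between them. Convexity is not assumed. *)
Lemma entry_le_exit t : H D <= t < H B -> entry t <= exit t.
Proof.
have e1 : det2 (A - B) (C - B) = - det2 (B - A) (C - A) by rewrite /det2 /=; ring.
have e2 : det2 (A - C) (D - C) = - det2 (C - A) (D - A) by rewrite /det2 /=; ring.
have e3 : det2 (D - A) (C - A) = - det2 (C - A) (D - A) by rewrite /det2 /=; ring.
have e4 : det2 (A - C) (B - C) = det2 (B - A) (C - A) by rewrite /det2 /=; ring.
have e5 : det2 (A - D) (C - D) = det2 (C - A) (D - A) by rewrite /det2 /=; ring.
rewrite /entry /exit => /andP[Dt Bt]; case: (ltP t (H A)) => At; case: (ltP t (H C)) => Ct.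
- rewrite crossingC ?gt_eqF ?(le_lt_trans Dt) //.
  by apply: crossing_below; rewrite // e5.
- apply: (@le_trans _ _ (crossing A C t)).
    by apply: crossing_above; rewrite // e3 oppr_le0.
  rewrite [X in X <= _]crossingC ?gt_eqF ?(le_lt_trans Ct) //.
  rewrite [X in _ <= X]crossingC ?gt_eqF ?(le_lt_trans Ct) //.
  by apply: crossing_below; rewrite // e4.
- apply: (@le_trans _ _ (crossing A C t)).
    exact: crossing_below.
  rewrite [X in X <= _]crossingC ?lt_eqF ?(le_lt_trans At) //.
  rewrite [X in _ <= X]crossingC ?lt_eqF ?(le_lt_trans Dt) //.
  by apply: crossing_above; rewrite // e2 oppr_le0.
rewrite crossingC ?lt_eqF ?(le_lt_trans At) //.
by apply: crossing_above; rewrite // e1 oppr_le0.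
Qed.

(** Both rays from [p] along the level line must hit the boundary, and the boundary meets this line
    only at the entry and the exit. *)
Lemma quad_inner_between t p : quad_inner A B C D p -> H p = t ->
  H A != t -> H B != t -> H C != t -> H D != t ->
  H D < t < H B /\ entry t < K p < exit t.
Proof.
move=> pin pt At Bt Ct Dt.
have w0 : w != 0.
  by apply: contra_eq_neq w_unit => ->; rewrite /dot /= mulr0 addr0 eq_sym oner_eq0.
have hits q : quad_boundary A B C D q -> H q = t ->
    H D < t < H B /\ (K q = entry t \/ K q = exit t).
  rewrite /entry /exit => -[[[sg|sg]|/segmentC sg]|sg] qt.
  - have [/andP[a b] ->] := segment_crossing sg qt At Bt HAB.
    by rewrite b (le_lt_trans HDA a) (lt_gtF a); split=> //; left.
  - have [/andP[a b] ->] := segment_crossing (segmentC sg) qt Ct Bt HCB.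
    rewrite (crossingC _ (negbT (lt_eqF (lt_trans a b)))).
    by rewrite b (le_lt_trans HDC a) (lt_gtF a); split=> //; right.
  - have [/andP[a b] ->] := segment_crossing sg qt Dt Ct HDC.
    by rewrite a b (lt_le_trans b HCB); split=> //; right.
  have [/andP[a b] ->] := segment_crossing sg qt Dt At HDA.
  rewrite (crossingC _ (negbT (lt_eqF (lt_trans a b)))).
  by rewrite a b (lt_le_trans b HAB); split=> //; left.
have on_ray (e : R) : H (p + e *: w) = t /\ K (p + e *: w) = K p + e.
  split; first by rewrite -pt /H /det2 scalev /=; ring.
  by rewrite -[in RHS](mulr1 e) -w_unit /K /dot scalev /=; ring.
have [e e0 up] := quad_inner_ray pin w0.
have [|e' e'0 down] := quad_inner_ray (v := - w) pin; first by rewrite oppr_eq0.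
rewrite scalerN -scaleNr in down.
have [Ht Hu] := hits _ up (on_ray e).1; have [_ Hd] := hits _ down (on_ray (- e')).1.
split=> //; move: Hu Hd (@entry_le_exit t).
rewrite (on_ray e).2 (on_ray (- e')).2 => Hu Hd le.
have {}le : entry t <= exit t by apply: le; case/andP: Ht => /ltW-> ->.
by apply/andP; split; case: Hu; case: Hd; lra.
Qed.

End Quad.

Variables (D : nat -> nat -> bool) (f : nat -> nat -> R * R).
Hypothesis D_right : forall n m, D n m -> D n.+1 m.
Hypothesis D_up : forall n m, D n m -> D n m.+1.
Hypothesis f_right : forall n m, D n m -> H (f n m) <= H (f n.+1 m).
Hypothesis f_up : forall n m, D n m -> H (f n m.+1) <= H (f n m).
Hypothesis f_lower : forall n m, D n m ->
  0 <= det2 (f n.+1 m - f n m) (f n.+1 m.+1 - f n m).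
Hypothesis f_upper : forall n m, D n m ->
  0 <= det2 (f n.+1 m.+1 - f n m) (f n m.+1 - f n m).

Lemma H_right n n' m : D n m -> (n <= n')%N -> H (f n m) <= H (f n' m).
Proof.
move=> Dn /subnKC <-; elim: (n' - n)%N => [|j IH]; first by rewrite addn0.
rewrite addnS (le_trans IH) // f_right //.
by elim: {IH} j => [|j IH]; rewrite ?addn0 // addnS D_right.
Qed.

Lemma H_up n m m' : D n m -> (m <= m')%N -> H (f n m') <= H (f n m).
Proof.
move=> Dn /subnKC <-; elim: (m' - m)%N => [|j IH]; first by rewrite addn0.
rewrite addnS; apply: le_trans IH; rewrite f_up //.
by elim: j => [|j IH]; rewrite ?addn0 // addnS D_up.
Qed.

(* The quadrilaterals met by the line [H = t] form a staircase going up and to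
   the right, and this is also their order along the line. *)
Lemma staircase t n m n' m' : D n m -> D n' m' -> (n <= n')%N -> (m <= m')%N ->
  (n, m) <> (n', m') ->
  H (f n m.+1) <= t < H (f n.+1 m) -> H (f n' m'.+1) <= t < H (f n'.+1 m') ->
  exit (f n.+1 m) (f n.+1 m.+1) (f n m.+1) t <= entry (f n' m') (f n'.+1 m') (f n' m'.+1) t.
Proof.
move=> Dn Dn' nn' mm' neq; move: {2}(n' - n + (m' - m))%N (erefl (n' - n + (m' - m))%N) => d.
elim: d n m Dn nn' mm' neq => [|d IH] n m Dn nn' mm' neq dE /andP[l1 u1] /andP[l2 u2].
  by exfalso; apply: neq; congr (_, _); lia.
have next i j : D i j -> (n <= i <= n')%N -> (m <= j <= m')%N -> (i + j = (n + m).+1)%N ->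
    H (f i j.+1) <= t < H (f i.+1 j) ->
    entry (f i j) (f i.+1 j) (f i j.+1) t <= entry (f n' m') (f n'.+1 m') (f n' m'.+1) t.
  move=> Di /andP[ni in'] /andP[mj jm'] ij cr.
  have [E|neq'] := pselect ((i, j) = (n', m')); first by case: E => -> ->.
  apply: (@le_trans _ _ (exit (f i.+1 j) (f i.+1 j.+1) (f i j.+1) t)).
    apply: entry_le_exit => //; rewrite ?f_up ?f_right ?f_lower ?f_upper ?D_up ?D_right //.
  by apply: IH => //; [lia|rewrite l2 u2].
(* The line leaves through the edge shared with the quadrilateral above if it passes below the
   corner (n+1, m+1), and otherwise through the edge shared with the one to the right. Monotonicity
   of [H] excludes that the target has no room left in that direction. *)
rewrite /exit; case: ltP => Ct.
  have -> : crossing (f n m.+1) (f n.+1 m.+1) t =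
      entry (f n m.+1) (f n.+1 m.+1) (f n m.+2) t by rewrite /entry ltNge l1.
  have mm : (m < m')%N.
    rewrite ltnNge; apply/negP => m'm; have mE : m' = m by lia.
    have nn : (n < n')%N by rewrite ltn_neqAle nn' andbT; apply/eqP => nE; apply: neq; congr (_, _).
    have : H (f n.+1 m.+1) <= H (f n' m.+1) by apply: H_right => //; rewrite D_right // D_up.
    move: l2; rewrite mE => l2 h.
    by move: (lt_le_trans Ct (le_trans h l2)); rewrite ltxx.
  have i1 : (n <= n <= n')%N by lia.
  have i2 : (m <= m.+1 <= m')%N by lia.
  have i3 : (n + m.+1)%N = (n + m).+1 by lia.
  apply: (next _ _ (D_up Dn) i1 i2 i3).
  rewrite Ct andbT; apply: le_trans l1; apply: f_up; exact: D_up.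
have -> : crossing (f n.+1 m) (f n.+1 m.+1) t =
    entry (f n.+1 m) (f n.+2 m) (f n.+1 m.+1) t by rewrite /entry u1.
have nn : (n < n')%N.
  rewrite ltnNge; apply/negP => n'n; have nE : n' = n by lia.
  have mm : (m < m')%N by rewrite ltn_neqAle mm' andbT; apply/eqP => mE; apply: neq; congr (_, _).
  have : H (f n.+1 m') <= H (f n.+1 m.+1) by apply: H_up => //; rewrite D_right // D_up.
  move: u2; rewrite nE => u2 h.
  by move: (lt_le_trans u2 (le_trans h Ct)); rewrite ltxx.
have i1 : (n <= n.+1 <= n')%N by lia.
have i2 : (m <= m <= m')%N by lia.
have i3 : (n.+1 + m)%N = (n + m).+1 by lia.
apply: (next _ _ (D_right Dn) i1 i2 i3).
by rewrite Ct (lt_le_trans u1) // f_right // D_right.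
Qed.

Lemma avoid_values (h : R) (L : seq R) :
  exists2 d : R, 0 < d & forall e, 0 < e < d -> h + e \notin L.
Proof.
elim: L => [|l L [d d0 IH]]; first by exists 1.
have [lh|hl] := leP l h.
  exists d => // e ed; rewrite inE negb_or IH // andbT gt_eqF //.
  by case/andP: ed => e0 _; lra.
exists (Num.min d (l - h)); first by rewrite lt_min d0 subr_gt0.
move=> e /andP[e0]; rewrite lt_min => /andP[ed el].
by rewrite inE negb_or IH ?e0 // andbT lt_eqF //; lra.
Qed.

Lemma staircase_disjoint n m n' m' p : D n m -> D n' m' -> (n, m) <> (n', m') ->
  elementary_inner f n m p -> elementary_inner f n' m' p -> False.
Proof.
pose L := [seq H (f (n + i)%N (m + j)%N) | i <- iota 0 2, j <- iota 0 2] ++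
  [seq H (f (n' + i)%N (m' + j)%N) | i <- iota 0 2, j <- iota 0 2].
move=> Dn Dn' neq pin pin'.
(* [H v] is 1, so adding [u *: v] raises the level by [u]; a small [u] avoids the levels of all
   eight vertices, collected in [L]. *)
pose v : R * R := (w.2, - w.1).
have [d d0 hd] := quad_inner_shift v pin; have [d' d'0 hd'] := quad_inner_shift v pin'.
have [e e0 he] := avoid_values (H p) L.
pose u := Num.min d (Num.min d' e) / 2.
have [u0 ud ud' ue] : [/\ 0 < u, u < d, u < d' & u < e].
  have m0 : 0 < Num.min d (Num.min d' e) by rewrite !lt_min d0 d'0.
  have : Num.min d (Num.min d' e) <= d by rewrite ge_min lexx.
  have : Num.min d (Num.min d' e) <= d' by rewrite !ge_min lexx orbT.
  have : Num.min d (Num.min d' e) <= e by rewrite !ge_min lexx !orbT.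
  rewrite /u; split; lra.
have {}hd := hd u; have {}hd' := hd' u.
have {}hd : quad_inner (f n m) (f n.+1 m) (f n.+1 m.+1) (f n m.+1) (p + u *: v).
  by apply: hd; rewrite ltW.
have {}hd' : quad_inner (f n' m') (f n'.+1 m') (f n'.+1 m'.+1) (f n' m'.+1) (p + u *: v).
  by apply: hd'; rewrite ltW.
set t := H p + u.
have Ht : H (p + u *: v) = t.
  by rewrite /t -[in RHS](mulr1 u) -w_unit /H /det2 /dot scalev /=; ring.
have tL : t \notin L by apply: he; rewrite u0.
have neqt x : x \in L -> x != t by apply: contraTneq => ->.
have between i j : D i j -> quad_inner (f i j) (f i.+1 j) (f i.+1 j.+1) (f i j.+1) (p + u *: v) ->
    [&& H (f i j) \in L, H (f i.+1 j) \in L, H (f i.+1 j.+1) \in L & H (f i j.+1) \in L] ->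
    H (f i j.+1) < t < H (f i.+1 j) /\
    entry (f i j) (f i.+1 j) (f i j.+1) t < K (p + u *: v)
      < exit (f i.+1 j) (f i.+1 j.+1) (f i j.+1) t.
  move=> Dij hin /and4P[/neqt h1 /neqt h2 /neqt h3 /neqt h4].
  by apply: quad_inner_between => //; rewrite ?f_up ?f_right ?f_lower ?f_upper ?D_up ?D_right.
have [|c1 b1] := between n m Dn hd.
  by rewrite /L !mem_cat /= !inE !addn0 !addn1 !eqxx !orbT.
have [|c2 b2] := between n' m' Dn' hd'.
  by rewrite /L !mem_cat /= !inE !addn0 !addn1 !eqxx !orbT.
have weak a b : a < t < b -> a <= t < b by move=> /andP[/ltW-> ->].
(* Two quadrilaterals met by one level line are comparable in the product order, as [staircase]
   requires. *)
have compare i j i' j' : D i j -> D i' j' -> H (f i j.+1) < t < H (f i.+1 j) ->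
    H (f i' j'.+1) < t < H (f i'.+1 j') -> (i < i')%N -> (j <= j')%N.
  move=> Di Di' /andP[_ h1] /andP[h2 _] ii'; rewrite leqNgt; apply/negP => jj'.
  have Di'j : D i' j.
    rewrite -(subnKC jj'); elim: (j - j'.+1)%N => [|k]; first by rewrite addn0 D_up.
    by rewrite addnS; exact: D_up.
  have : H (f i.+1 j) <= H (f i' j) by apply: H_right => //; exact: D_right.
  have : H (f i' j) <= H (f i' j'.+1) by apply: H_up => //; exact: D_up.
  by move=> k1 k2; move: (lt_trans h2 h1); rewrite ltNge (le_trans k2 k1).
have ordered i j i' j' : D i j -> D i' j' -> H (f i j.+1) < t < H (f i.+1 j) ->
    H (f i' j'.+1) < t < H (f i'.+1 j') -> (i <= i')%N /\ (j <= j')%N \/ (i' <= i)%N /\ (j' <= j)%N.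
  move=> Di Di' h1 h2; case: (ltngtP i i') => [ii'|ii'|ii'].
  - by left; split; [by []|exact: (compare _ _ _ _ Di Di' h1 h2)].
  - by right; split; [by []|exact: (compare _ _ _ _ Di' Di h2 h1)].
  - by case: (leqP j j') => [h|/ltnW h]; [left|right].
case: (ordered _ _ _ _ Dn Dn' c1 c2) => -[a b].
  have := staircase Dn Dn' a b neq (weak _ _ c1) (weak _ _ c2).
  by case/andP: b1 => _ x1; case/andP: b2 => x2 _; lra.
have := staircase Dn' Dn a b (fun E => neq (esym E)) (weak _ _ c2) (weak _ _ c1).
by case/andP: b1 => x1 _; case/andP: b2 => _ x2; lra.
Qed.

End Staircase.

(** * Grid patterns give embedded maps *)

Section GridEmbedding.
Variables (R : realType) (x : R).
Hypothesis x_bounds : 0 < x < pi.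
Implicit Types (u v g w : R * R).

Local Notation rot := (rotate x).

Definition cmul g u : R * R := (g.1 * u.1 - g.2 * u.2, g.1 * u.2 + g.2 * u.1).

Lemma cmul_det2 g u v : det2 (cmul g u) (cmul g v) = dot g g * det2 u v.
Proof. by rewrite /det2 /cmul /dot /=; ring. Qed.

Lemma cmul_dot g u v : dot (cmul g u) (cmul g v) = dot g g * dot u v.
Proof. by rewrite /cmul /dot /=; ring. Qed.

Lemma cmulD g u v : cmul g (u + v) = cmul g u + cmul g v.
Proof. by apply: eq_vec; rewrite /cmul /=; ring. Qed.

Lemma cmulZ g (a : R) u : cmul g (a *: u) = a *: cmul g u.
Proof. by apply: eq_vec; rewrite !scalev /cmul /=; ring. Qed.

Lemma cmul_rot g u : cmul g (rot u) = rot (cmul g u).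
Proof. by apply: eq_vec; rewrite /cmul /rotate /=; ring. Qed.

Lemma det2_rot u : dot u u = 1 -> det2 u (rot u) = sin x.
Proof.
move=> u1; rewrite -[RHS]mulr1 -u1 /det2 /dot /rotate /=; ring.
Qed.

Lemma det2Z (a b : R) u v : det2 (a *: u) (b *: v) = a * b * det2 u v.
Proof. by rewrite !scalev /det2 /=; ring. Qed.

Lemma dotZ (a b : R) u v : dot (a *: u) (b *: v) = a * b * dot u v.
Proof. by rewrite !scalev /dot /=; ring. Qed.

Lemma det2Zl (b : R) u v : det2 (b *: u) v = b * det2 u v.
Proof. by rewrite scalev /det2 /=; ring. Qed.

Lemma det2Zr (b : R) u v : det2 u (b *: v) = b * det2 u v.
Proof. by rewrite scalev /det2 /=; ring. Qed.

Lemma det2D u v w : det2 u (v + w) = det2 u v + det2 u w.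
Proof. by rewrite /det2 /=; ring. Qed.

Variables (rho : nat -> nat -> R) (U : nat -> nat -> R * R).
Variables (D : nat -> nat -> bool).
Hypothesis gp : grid_pattern x rho U D.

Lemma rho_ge0 n m : ~~ odd (n + m) -> 0 <= rho n m.
Proof.
move=> nm; have [[-> ->]|nm0] := pselect ((n, m) = (0%N, 0%N)); first exact: gp_ge0 gp.
exact/ltW/(gp_gt0 gp).
Qed.

(** For [n + m] even the edges are multiples of a vector and its rotation. For [n + m] odd, [det2]
    of the closing condition with [U n m] leaves a term bounded by [gp_turn]. *)
Lemma hor_ver_ge0 n m : D n m -> 0 <= det2 (hor_edge rho U n m) (ver_edge x rho U n.+1 m).
Proof.
move=> Dn; have := gp_closed gp Dn; have s0 := sin_gt0_pi x_bounds.
rewrite /grid_closed /hor_edge /ver_edge addSn addnS /=; case: ifP => od /= E; rewrite det2Z.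
  have [u1 v1] : dot (U n m) (U n m) = 1 /\ dot (U n.+1 m.+1) (U n.+1 m.+1) = 1.
    by split; apply: (gp_unit gp); rewrite ?addSn ?addnS /= ?negbK od.
  have [E0 F0] : 0 <= rho n.+1 m /\ 0 <= rho n m.+1.
    by split; apply: rho_ge0; rewrite ?addSn ?addnS /= od.
  have := congr1 (det2 (U n m)) E.
  rewrite !det2D !det2Zr det2_rot //.
  have -> : det2 (U n m) (U n m) = 0 by rewrite /det2; ring.
  have /andP[t1 _] := gp_turn gp od.
  move=> E2; rewrite -mulrA; apply: mulr_ge0 => //.
  have -> : rho n.+1 m * det2 (U n m) (rot (U n.+1 m.+1)) =
    rho n m.+1 * (sin x + det2 (U n m) (U n.+1 m.+1)) by lra.
  by rewrite mulr_ge0 //; lra.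
rewrite det2_rot; last by apply: (gp_unit gp); rewrite addSn /= od.
apply: mulr_ge0; last exact: ltW.
by apply: mulr_ge0; apply: rho_ge0; rewrite ?addSn ?addnS /= ?od.
Qed.

Lemma ver_hor_ge0 n m : D n m -> 0 <= det2 (hor_edge rho U n m.+1) (ver_edge x rho U n m).
Proof.
move=> Dn; have := gp_closed gp Dn; have s0 := sin_gt0_pi x_bounds.
rewrite /grid_closed /hor_edge /ver_edge addSn addnS /=; case: ifP => od /= E; rewrite det2Z.
  have v1 : dot (U n.+1 m.+1) (U n.+1 m.+1) = 1.
    by apply: (gp_unit gp); rewrite ?addSn ?addnS /= ?negbK od.
  have [E0 F0] : 0 <= rho n.+1 m /\ 0 <= rho n m.+1.
    by split; apply: rho_ge0; rewrite ?addSn ?addnS /= od.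
  have := congr1 (det2 (U n.+1 m.+1)) E.
  rewrite !det2D !det2Zr det2_rot //.
  have -> : det2 (U n.+1 m.+1) (U n.+1 m.+1) = 0 by rewrite /det2; ring.
  have -> : det2 (U n.+1 m.+1) (U n m) = - det2 (U n m) (U n.+1 m.+1).
    by rewrite /det2; ring.
  have /andP[_ t2] := gp_turn gp od.
  move=> E2; rewrite -mulrA; apply: mulr_ge0 => //.
  have -> : rho n m.+1 * det2 (U n.+1 m.+1) (rot (U n m)) =
    rho n.+1 m * (sin x - det2 (U n m) (U n.+1 m.+1)) by lra.
  by rewrite mulr_ge0 //; lra.
rewrite det2_rot; last by apply: (gp_unit gp); rewrite addnS /= od.
apply: mulr_ge0; last exact: ltW.
by apply: mulr_ge0; apply: rho_ge0; rewrite ?addSn ?addnS /= ?od.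
Qed.

Lemma embedded_of_edges f g : (forall n m, D n m -> D n.+1 m) ->
  (forall n m, D n m -> D n m.+1) -> dot g g = 1 ->
  (forall n m, D n m -> f n.+1 m - f n m = cmul g (hor_edge rho U n m) /\
                        f n m.+1 - f n m = cmul g (ver_edge x rho U n m)) ->
  embedded D f.
Proof.
move=> D_right D_up g1 edges n m n' m' /and4P[Dn _ _ _] /and4P[Dn' _ _ _] neq.
apply/seteqP; split=> // p [pin pin'].
have [w w1 sector] := gp_sector gp.
have HB u v : det2 u (cmul g w) - det2 v (cmul g w) = det2 (u - v) (cmul g w).
  by rewrite /det2 /=; ring.
have cgw1 : dot (cmul g w) (cmul g w) = 1 by rewrite cmul_dot g1 w1 mulr1.
have diag k l : D k l -> f k.+1 l.+1 - f k l = cmul g (hor_edge rho U k l) + cmul g (ver_edge x rho U k.+1 l).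
  move=> Dk; have [<- _] := edges _ _ Dk; have [_ <-] := edges _ _ (D_right _ _ Dk).
  by rewrite [RHS]addrC addrA subrK.
have diag' k l : D k l -> f k.+1 l.+1 - f k l = cmul g (ver_edge x rho U k l) + cmul g (hor_edge rho U k l.+1).
  move=> Dk; have [_ <-] := edges _ _ Dk; have [<- _] := edges _ _ (D_up _ _ Dk).
  by rewrite [RHS]addrC addrA subrK.
apply: (staircase_disjoint cgw1 D_right D_up _ _ _ _ Dn Dn' neq pin pin').
- move=> k l Dk; rewrite -subr_ge0 HB; have [-> _] := edges _ _ Dk.
  rewrite cmul_det2 g1 mul1r /hor_edge; case: ifP => od.
    have [h _] := sector _ _ od; rewrite det2Zl.
    by rewrite mulr_ge0 // rho_ge0 // addSn /= od.
  have od' : odd (k.+1 + l) by rewrite addSn /= od.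
  have [h _] := sector _ _ od'; rewrite det2Zl.
  by rewrite mulr_ge0 // rho_ge0 // od.
- move=> k l Dk; rewrite -subr_le0 HB; have [_ ->] := edges _ _ Dk.
  rewrite cmul_det2 g1 mul1r /ver_edge; case: ifP => od.
    have [_ h] := sector _ _ od; rewrite det2Zl.
    by rewrite mulr_ge0_le0 // rho_ge0 // addnS /= od.
  have od' : odd (k + l.+1) by rewrite addnS /= od.
  have [_ h] := sector _ _ od'; rewrite det2Zl.
  by rewrite mulr_ge0_le0 // rho_ge0 // od.
- move=> k l Dk; rewrite diag //; have [-> _] := edges _ _ Dk.
  rewrite -cmulD cmul_det2 g1 mul1r det2D.
  have -> : det2 (hor_edge rho U k l) (hor_edge rho U k l) = 0 by rewrite /det2; ring.
  by rewrite add0r hor_ver_ge0.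
move=> k l Dk; rewrite diag' //; have [_ ->] := edges _ _ Dk.
rewrite -cmulD cmul_det2 g1 mul1r.
have -> : det2 (ver_edge x rho U k l + hor_edge rho U k l.+1) (ver_edge x rho U k l) =
  det2 (hor_edge rho U k l.+1) (ver_edge x rho U k l) by rewrite /det2 /=; ring.
exact: ver_hor_ge0.
Qed.

End GridEmbedding.

(** * Existence of the patterns *)

Lemma inV_grid (N M : int) : inV N M ->
  exists n m : nat, [/\ N + M = n%:Z, M - N = m%:Z & ~~ odd (n + m)].
Proof.
rewrite /inV => V; exists `|(N + M)%R|%N, `|(M - N)%R|%N; split; lia.
Qed.

Section Supports.
Variable R : realType.
Implicit Types (u v p q d : R * R) (g h : circle R).

Lemma enorm_ge0 u : 0 <= enorm u.
Proof. exact: sqrtr_ge0. Qed.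

Lemma dot_ge0 u : 0 <= dot u u.
Proof. by rewrite addr_ge0 // -expr2 sqr_ge0. Qed.

Lemma enorm_sqr u : enorm u ^+ 2 = dot u u.
Proof. by rewrite sqr_sqrtr // dot_ge0. Qed.

Lemma dot_eq0 u : dot u u = 0 -> u = 0.
Proof. by case: u => a b; rewrite /dot /= => E; apply: eq_vec => /=; nra. Qed.

(* [d] plays the role of the inner normal at [p], also for a circle of radius 0. *)
Record supports g p d : Prop := {
  supports_rim : rim g p;
  supports_disc : disc g p;
  supports_ge0 : forall q, disc g q -> 0 <= dot (q - p) d;
  supports_normal : (0 < Defs.radius g)%E -> exists2 l : R, 0 < l & inner_normal g p = l *: d }.

(** False for a half-plane: of two discs on opposite sides of a common tangent, at least one must be
    bounded for them to meet in a single point. *)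
Definition touches_only g p d := forall q, disc g q -> dot (q - p) d <= 0 -> q = p.

Lemma disc_circleP c (r : R) q : 0 <= r -> disc (Circle c r) q <-> dot (q - c) (q - c) <= r ^+ 2.
Proof. by move=> r0; rewrite -enorm_sqr /= ler_pXn2r ?nnegrE ?enorm_ge0. Qed.

Lemma rim_circleP c (r : R) q : 0 <= r -> rim (Circle c r) q <-> dot (q - c) (q - c) = r ^+ 2.
Proof.
move=> r0; rewrite -enorm_sqr /=; split=> [->//|/eqP].
by rewrite eqrXn2 ?enorm_ge0 // => /eqP.
Qed.

Lemma dot_subl p q (r : R) d : dot d d = 1 ->
  dot (q - (p + r *: d)) (q - (p + r *: d)) = dot (q - p) (q - p) - 2 * r * dot (q - p) d + r ^+ 2.
Proof.
move=> d1; have -> : r ^+ 2 = r ^+ 2 * dot d d by rewrite d1 mulr1.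
by rewrite scalev /dot /=; ring.
Qed.

Lemma circle_touches p (r : R) d : dot d d = 1 -> 0 <= r ->
  touches_only (Circle (p + r *: d) r) p d.
Proof.
move=> d1 r0 q /disc_circleP -/(_ r0); rewrite dot_subl // => h h2.
apply/eqP; rewrite -subr_eq0; apply/eqP/dot_eq0.
have := dot_ge0 (q - p); nra.
Qed.

Lemma circle_supports p (r : R) d : dot d d = 1 -> 0 <= r ->
  supports (Circle (p + r *: d) r) p d.
Proof.
move=> d1 r0; have z : dot (p - p) (p - p) - 2 * r * dot (p - p) d + r ^+ 2 = r ^+ 2.
  by rewrite subrr /dot /=; ring.
split.
- by apply/rim_circleP => //; rewrite dot_subl.
- by apply/disc_circleP => //; rewrite dot_subl // z.
- move=> q /disc_circleP -/(_ r0); rewrite dot_subl // => h.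
  have h2 := dot_ge0 (q - p).
  rewrite leNgt; apply/negP => neg.
  have r_le : 0 <= - (2 * r * dot (q - p) d) by nra.
  have /dot_eq0 E : dot (q - p) (q - p) = 0 by lra.
  by move: neg; rewrite E /dot /= !mul0r addr0 ltxx.
- by rewrite /= lte_fin => rp; exists r => //; rewrite addrC addKr.
Qed.

Lemma supports_corner g h p d e (x : R) : 0 < x < pi -> supports g p d -> supports h p e ->
  dot d d = 1 -> dot e e = 1 -> dot d e = - cos x -> intersect_at_angle x g h.
Proof.
move=> x_b [rg _ _ ng] [rh _ _ nh] d1 e1 de; exists p; split=> // /ng[l l0 El] /nh[k k0 Ek].
have norm1 (a : R) v : 0 < a -> dot v v = 1 -> enorm (a *: v) = a.
  move=> a0 v1; rewrite /enorm; have -> : dot (a *: v) (a *: v) = a ^+ 2.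
    by rewrite -[RHS]mulr1 -v1 scalev /dot /=; ring.
  by rewrite sqrtr_sqr gtr0_norm.
rewrite /corner_angle /angle El Ek !norm1 //.
have -> : dot (l *: d) (k *: e) / (l * k) = - cos x.
  have -> : dot (l *: d) (k *: e) = - cos x * (l * k) by rewrite -de !scalev /dot /=; ring.
  by rewrite mulfK // mulf_neq0 // gt_eqF.
have -> : - cos x = cos (pi - x) by rewrite cosB cospi sinpi; ring.
by rewrite cosK; [ring|rewrite in_itv /=; lra].
Qed.

Lemma supports_tangent g h p d : supports g p d -> supports h p (- d) ->
  touches_only g p d -> tangent_disjoint g h.
Proof.
move=> [rg dg _ _] [rh dh hh _] tg; exists p; split=> //; apply/seteqP; split=> [q [/= dq hq]|_ ->] //.
apply: tg => //; have := hh q hq.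
by rewrite /dot /=; lra.
Qed.

Lemma supports_tangentC g h p d : supports g p (- d) -> supports h p d ->
  touches_only h p d -> tangent_disjoint g h.
Proof.
move=> sg sh th; have [q [rh rg E]] := supports_tangent sh sg th.
by exists q; split; rewrite 1?setIC.
Qed.

Lemma supports_ccw C (p d e : R * R) (w w' : int * int) :
  (inV w.1 w.2 -> supports (C w.1 w.2) p d) -> (inV w'.1 w'.2 -> supports (C w'.1 w'.2) p e) ->
  0 < det2 d e -> ccw C p w w'.
Proof.
move=> sg sh de V V' /(supports_normal (sg V))[l l0 ->] /(supports_normal (sh V'))[k k0 ->].
by rewrite det2Z; apply: mulr_gt0 => //; exact: mulr_gt0.
Qed.

End Supports.

Section CirclePatternOfGrid.
Variables (R : realType) (x : R).
Hypothesis x_bounds : 0 < x < pi.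
Local Notation rot := (rotate x).

Lemma dot_rot u : dot (rot u) (rot u) = dot u u.
Proof.
have E := cos2Dsin2 x.
have -> : dot (rot u) (rot u) = (cos x ^+ 2 + sin x ^+ 2) * dot u u by rewrite /dot /rotate /=; ring.
by rewrite E mul1r.
Qed.

Lemma dot_rotr (u : R * R) : dot u u = 1 -> dot u (rot u) = cos x.
Proof. by move=> u1; rewrite -[RHS]mulr1 -u1 /dot /rotate /=; ring. Qed.

Definition lattice_circle (K : nat -> nat -> circle R) (N M : int) :=
  K `|(N + M)%R|%N `|(M - N)%R|%N.

Lemma lattice_circleE (K : nat -> nat -> circle R) N M n m :
  N + M = n%:Z -> M - N = m%:Z -> lattice_circle K N M = K n m.
Proof. by rewrite /lattice_circle => -> ->. Qed.

Variables (K : nat -> nat -> circle R) (f U : nat -> nat -> R * R).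

Hypothesis K_valid : forall n m, ~~ odd (n + m) -> valid_circle (K n m).
Hypothesis K_regular : forall n m, ~~ odd (n + m) -> (n, m) <> (0, 0)%N ->
  (0 < Defs.radius (K n m) < +oo)%E.
Hypothesis K_center : forall n m, ~~ odd (n + m) -> centered_at (K n m) (f n m).
Hypothesis U_unit : forall n m, odd (n + m) -> dot (U n m) (U n m) = 1.
Hypothesis K_right : forall n m, odd (n + m) ->
  supports (K n.+1 m) (f n m) (U n m) /\ touches_only (K n.+1 m) (f n m) (U n m).
Hypothesis K_up : forall n m, odd (n + m) ->
  supports (K n m.+1) (f n m) (rot (U n m)) /\ touches_only (K n m.+1) (f n m) (rot (U n m)).
Hypothesis K_left : forall n m, odd (n.+1 + m) -> supports (K n m) (f n.+1 m) (- U n.+1 m).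
Hypothesis K_down : forall n m, odd (n + m.+1) -> supports (K n m) (f n m.+1) (- rot (U n m.+1)).

Local Notation C := (lattice_circle K).

Section AtOddPoint.
Variables (N M : int) (n m : nat).
Hypotheses (En : N + M + 1 = n%:Z) (Em : M - N = m%:Z).

(** At the odd grid point of the cell with lower left index z, the indices z, z + 1, z + 1 + i and z
    + i are those of its left, lower, right and upper neighbours. *)
Lemma odd_point : odd (n + m). Proof. lia. Qed.

Lemma right_circle : supports (C (N + 1) (M + 1)) (f n m) (U n m).
Proof.
rewrite (@lattice_circleE _ _ _ n.+1 m); try lia.
exact: (K_right odd_point).1.
Qed.

Lemma up_circle : supports (C N (M + 1)) (f n m) (rot (U n m)).
Proof.
rewrite (@lattice_circleE _ _ _ n m.+1); try lia.
exact: (K_up odd_point).1.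
Qed.

Lemma left_circle : inV N M -> supports (C N M) (f n m) (- U n m).
Proof.
rewrite /inV => V; have n0 : n = n.-1.+1 by lia.
rewrite (@lattice_circleE _ _ _ n.-1 m); try lia.
by rewrite {2 3}n0; apply: K_left; lia.
Qed.

Lemma down_circle : inV (N + 1) M -> supports (C (N + 1) M) (f n m) (- rot (U n m)).
Proof.
rewrite /inV => V; have m0 : m = m.-1.+1 by lia.
rewrite (@lattice_circleE _ _ _ n m.-1); try lia.
by rewrite {2 3}m0; apply: K_down; lia.
Qed.

Lemma grid_cell_point : cell_point C N M (f n m).
Proof.
move=> N' M' hN hM V.
have [EN|EN] : N' = N \/ N' = N + 1 by lia.
  have [EM|EM] : M' = M \/ M' = M + 1 by lia.
    by rewrite EN EM in V *; exact: supports_rim (left_circle V).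
  by rewrite EN EM; exact: supports_rim up_circle.
have [EM|EM] : M' = M \/ M' = M + 1 by lia.
  by rewrite EN EM in V *; exact: supports_rim (down_circle V).
by rewrite EN EM; exact: supports_rim right_circle.
Qed.

End AtOddPoint.

Lemma grid_circle_pattern : circle_pattern x C.
Proof.
have rotN u : dot (- u) (- u) = dot u u by rewrite /dot /=; ring.
split.
- by move=> N M /inV_grid[n [m [En Em ev]]]; rewrite (lattice_circleE _ En Em); exact: K_valid.
- move=> N M /inV_grid[n [m [En Em ev]]] neq; rewrite (lattice_circleE _ En Em); apply: K_regular => //.
  by case=> En0 Em0; apply: neq; congr pair; lia.
- move=> N M V V'; have [n [m [En Em ev]]] := inV_grid V.
  have u1 : dot (U n.+1 m) (U n.+1 m) = 1 by apply: U_unit; lia.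
  apply: (supports_corner x_bounds (@left_circle N M n.+1 m _ _ V)
    (@up_circle N M n.+1 m _ _)); try lia.
  + by rewrite rotN.
  + by rewrite dot_rot.
  + by rewrite -(dot_rotr u1) /dot /=; ring.
- move=> N M V V'; have [n [m [En Em ev]]] := inV_grid V'.
  have m1 : M - N = m.+1%:Z by lia.
  have n1 : n = n.-1.+1 by move: V V'; rewrite /inV; lia.
  have u1 : dot (U n.-1 m) (U n.-1 m) = 1 by apply: U_unit; move: V V'; rewrite /inV; lia.
  have x_bounds' : 0 < pi - x < pi by move: x_bounds; rewrite subr_gt0 gtrBl => /andP[-> ->].
  (* The circles at z and z + 1 are the upper and the right neighbour of the odd point of the cell
     at z - i. *)
  have -> : C N M = C N (M - 1 + 1) by rewrite subrK.
  have -> : C (N + 1) M = C (N + 1) (M - 1 + 1) by rewrite subrK.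
  apply: (supports_corner x_bounds' (@up_circle N (M - 1) n.-1 m _ _)
    (@right_circle N (M - 1) n.-1 m _ _)); try lia.
  + by rewrite dot_rot.
  + by [].
  + have -> : dot (rot (U n.-1 m)) (U n.-1 m) = cos x by rewrite -(dot_rotr u1) /dot /=; ring.
    by rewrite cosB cospi sinpi; ring.
- move=> N M V V'; have [n [m [En Em ev]]] := inV_grid V.
  have od : odd (n.+1 + m) by lia.
  have [_ t] := K_right od.
  apply: (supports_tangentC (@left_circle N M n.+1 m _ _ V)
    (@right_circle N M n.+1 m _ _)); try lia.
  by rewrite (@lattice_circleE _ _ _ n.+2 m) //; lia.
- move=> N M V V'; have [n [m [En Em ev]]] := inV_grid V.
  have od : odd (n + m.+1) by lia.
  have [_ t] := K_up od.
  have EN : C N M = C (N - 1 + 1) M by rewrite subrK.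
  have V2 : inV (N - 1 + 1) M by rewrite subrK.
  rewrite EN.
  apply: (supports_tangentC (@down_circle (N - 1) M n m.+1 _ _ V2)
    (@up_circle (N - 1) M n m.+1 _ _)); try lia.
  by rewrite (@lattice_circleE _ _ _ n m.+2) //; lia.
move=> N M; rewrite /cell /inV => /andP[V1 V2].
have [n En] : exists n : nat, N + M + 1 = n%:Z by exists `|(N + M + 1)%R|%N; lia.
have [m Em] : exists m : nat, M - N = m%:Z by exists `|(M - N)%R|%N; lia.
have u1 : dot (U n m) (U n m) = 1 by apply: U_unit; lia.
have s0 : 0 < det2 (U n m) (rot (U n m)) by rewrite det2_rot // sin_gt0_pi.
have detN (u v : R * R) : det2 (- u) (- v) = det2 u v by rewrite /det2 /=; ring.
have detC (u v : R * R) : det2 u (- v) = det2 v u by rewrite /det2 /=; ring.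
have detC' (u v : R * R) : det2 (- u) v = det2 v u by rewrite /det2 /=; ring.
exists (f n m); split; first exact: grid_cell_point.
- by apply: (supports_ccw (w := (N, M)) (w' := (N + 1, M))
    (@left_circle _ _ _ _ En Em) (@down_circle _ _ _ _ En Em)); rewrite detN.
- apply: (supports_ccw (w := (N + 1, M)) (w' := (N + 1, M + 1))
    (@down_circle _ _ _ _ En Em) (fun=> @right_circle _ _ _ _ En Em)).
  by rewrite detC'.
- exact: (supports_ccw (w := (N + 1, M + 1)) (w' := (N, M + 1))
    (fun=> @right_circle _ _ _ _ En Em) (fun=> @up_circle _ _ _ _ En Em)).
by apply: (supports_ccw (w := (N, M + 1)) (w' := (N, M))
    (fun=> @up_circle _ _ _ _ En Em) (@left_circle _ _ _ _ En Em)); rewrite detC.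
Qed.

Lemma grid_discrete_map : discrete_map C f.
Proof.
move=> n m; case: ifP => od.
  by apply: grid_cell_point; lia.
rewrite (@lattice_circleE _ _ _ n m); try lia.
by apply: K_center; rewrite od.
Qed.

End CirclePatternOfGrid.

(** * Summing the edges of a grid to a circle pattern *)

Section GridMap.
Variables (R : realType) (x : R).
Hypothesis x_bounds : 0 < x < pi.
Local Notation rot := (rotate x).

Variables (rho : nat -> nat -> R) (U : nat -> nat -> R * R) (D : nat -> nat -> bool).
Hypothesis gp : grid_pattern x rho U D.
Hypothesis D_off_origin : forall n m, (n, m) <> (0, 0)%N -> D n m.

Local Notation hor := (hor_edge rho U).
Local Notation ver := (ver_edge x rho U).

(* The base point is (1, 0), as the origin may be at infinity. *)
Definition grid_map n m : R * R :=
  if n is n'.+1 then \sum_(i < n') hor i.+1 0 + \sum_(j < m) ver n'.+1 j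
  else \sum_(j < m) ver 1 j - hor 0 m.

Lemma grid_map_hor n m : grid_map n.+1 m - grid_map n m = hor n m.
Proof.
case: n => [|n]; first by rewrite /= big_ord0 add0r opprB addrC subrK.
elim: m => [|m IHm].
  by rewrite /= !big_ord0 !addr0 big_ord_recr /= [LHS]addrC addKr.
have Dn : D n.+1 m by exact: D_off_origin.
have E : hor n.+1 m + ver n.+2 m = ver n.+1 m + hor n.+1 m.+1 by have := gp_closed gp Dn.
have up k : grid_map k.+1 m.+1 = grid_map k.+1 m + ver k.+1 m by rewrite /= big_ord_recr addrA.
by rewrite !up opprD addrACA IHm addrA E addrAC subrr add0r.
Qed.

Lemma grid_map_ver n m : D n m -> grid_map n m.+1 - grid_map n m = ver n m.
Proof.
case: n => [Dm|n _]; last by rewrite /= big_ord_recr /= addrA [LHS]addrC addKr.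
have E : hor 0 m + ver 1 m = ver 0 m + hor 0 m.+1 by have := gp_closed gp Dm.
have -> : ver 0 m = hor 0 m + ver 1 m - hor 0 m.+1 by rewrite E addrK.
by rewrite /= big_ord_recr /= opprB [LHS]addrC -!addrA addKr.
Qed.

(** [D] can fail only at the origin, whose circle is then a line through the image of (1, 0). The
    hypothesis [line_at_origin] makes it pass through the image of (0, 1) with the normal required
    there. *)
Definition grid_circle n m : circle R :=
  if D n m then Circle (grid_map n m) (rho n m) else Line (grid_map 1 0) (- U 1 0).

Hypothesis line_at_origin : ~~ D 0 0 ->
  rot (U 0 1) = U 1 0 /\ dot (grid_map 0 1 - grid_map 1 0) (U 1 0) = 0.

Lemma not_D n m : ~~ D n m -> n = 0%N /\ m = 0%N.
Proof.
move=> ND; have [[-> ->]|/D_off_origin] := pselect ((n, m) = (0, 0)%N); first by [].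
by rewrite (negbTE ND).
Qed.

Lemma odd_D n m : odd (n + m) -> D n m.
Proof. by move=> od; apply: D_off_origin => -[n0 m0]; move: od; rewrite n0 m0. Qed.

Lemma dotNN u : dot (- u) (- u) = dot u u :> R.
Proof. by rewrite /dot /=; ring. Qed.

Lemma line_supports (q p d : R * R) : dot (p - q) d = 0 -> supports (Line q d) p d.
Proof.
move=> pq; split=> //=; first by rewrite pq.
  move=> y; have -> : dot (y - p) d = dot (y - q) d - dot (p - q) d by rewrite /dot /=; ring.
  by rewrite pq subr0.
by exists 1 => //; rewrite scale1r.
Qed.

Lemma grid_right n m : odd (n + m) ->
  supports (grid_circle n.+1 m) (grid_map n m) (U n m) /\
  touches_only (grid_circle n.+1 m) (grid_map n m) (U n m).
Proof.
move=> od; rewrite /grid_circle D_off_origin //.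
have u1 := gp_unit gp od.
have r0 : 0 <= rho n.+1 m by apply: (rho_ge0 gp); rewrite addSn /= od.
have -> : grid_map n.+1 m = grid_map n m + rho n.+1 m *: U n m.
  by rewrite -[LHS](subrK (grid_map n m)) grid_map_hor /hor_edge od addrC.
by split; [exact: circle_supports|exact: circle_touches].
Qed.

Lemma grid_up n m : odd (n + m) ->
  supports (grid_circle n m.+1) (grid_map n m) (rot (U n m)) /\
  touches_only (grid_circle n m.+1) (grid_map n m) (rot (U n m)).
Proof.
move=> od; rewrite /grid_circle D_off_origin //.
have u1 : dot (rot (U n m)) (rot (U n m)) = 1 by rewrite dot_rot (gp_unit gp od).
have r0 : 0 <= rho n m.+1 by apply: (rho_ge0 gp); rewrite addnS /= od.
have -> : grid_map n m.+1 = grid_map n m + rho n m.+1 *: rot (U n m).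
  by rewrite -[LHS](subrK (grid_map n m)) grid_map_ver ?odd_D // /ver_edge od addrC.
by split; [exact: circle_supports|exact: circle_touches].
Qed.

Lemma grid_left n m : odd (n.+1 + m) ->
  supports (grid_circle n m) (grid_map n.+1 m) (- U n.+1 m).
Proof.
move=> od; rewrite /grid_circle; have ev : odd (n + m) = false by apply: negbTE; rewrite addSn in od.
case: ifP => [Dn|/negbT ND]; last first.
  have [-> ->] := not_D ND; apply: line_supports.
  by rewrite subrr /dot /= !mul0r addr0.
have -> : grid_map n m = grid_map n.+1 m + rho n m *: (- U n.+1 m).
  by rewrite -[grid_map n.+1 m](subrK (grid_map n m)) grid_map_hor /hor_edge ev scalerN addrAC subrr add0r.
apply: circle_supports; first by rewrite dotNN (gp_unit gp od).
by apply: (rho_ge0 gp); rewrite ev.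
Qed.

Lemma grid_down n m : odd (n + m.+1) ->
  supports (grid_circle n m) (grid_map n m.+1) (- rot (U n m.+1)).
Proof.
move=> od; rewrite /grid_circle; have ev : odd (n + m) = false by apply: negbTE; rewrite addnS in od.
case: ifP => [Dn|/negbT ND]; last first.
  have [n0 m0] := not_D ND; rewrite n0 m0 in ND *.
  have [-> h] := line_at_origin ND; apply: line_supports.
  by move: h; rewrite /dot /=; lra.
have -> : grid_map n m = grid_map n m.+1 + rho n m *: (- rot (U n m.+1)).
  by rewrite -[grid_map n m.+1](subrK (grid_map n m)) grid_map_ver // /ver_edge ev scalerN addrAC subrr add0r.
apply: circle_supports; first by rewrite dotNN dot_rot (gp_unit gp od).
by apply: (rho_ge0 gp); rewrite ev.
Qed.

Lemma grid_map_pattern :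
  circle_pattern x (lattice_circle grid_circle) /\
  discrete_map (lattice_circle grid_circle) grid_map.
Proof.
have center n m : ~~ odd (n + m) -> centered_at (grid_circle n m) (grid_map n m).
  by move=> ev; rewrite /grid_circle; case: ifP.
split; last exact: (grid_discrete_map x_bounds center grid_right grid_up grid_left grid_down).
apply: grid_circle_pattern => //.
- move=> n m ev; rewrite /grid_circle; case: ifP => _ /=; first exact: (rho_ge0 gp).
  move=> U0; have := gp_unit gp (isT : odd (1 + 0)%N).
  by rewrite -dotNN U0 /dot /= !mul0r addr0 => /esym/eqP; rewrite oner_eq0.
- move=> n m ev nm; rewrite /grid_circle D_off_origin //= lte_fin ltry andbT.
  exact: (gp_gt0 gp).
- exact: gp_unit gp.
- exact: grid_right.
- exact: grid_up.
- exact: grid_left.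
exact: grid_down.
Qed.

End GridMap.

Section Existence.
Variables (R : realType) (x : R).
Hypothesis x_bounds : 0 < x < pi.

Lemma radius_fun_zrho N M n m : N + M = n%:Z -> M - N = m%:Z -> radius_fun x N M = zrho x n m.
Proof.
move=> En Em; rewrite /radius_fun; have [N0|N0] := leP 0 N.
  have -> : n = (m + `|N|%N.*2)%N by lia.
  by rewrite zrhoE; congr rad; lia.
have -> : m = (n + `|N|%N.*2)%N by lia.
by rewrite zrho_sym zrhoE; congr rad; lia.
Qed.

Let Z2_off (n m : nat) : (n, m) <> (0, 0)%N -> Z2_domain n m.
Proof. by []. Qed.

Let Log_off (n m : nat) : (n, m) <> (0, 0)%N -> Log_domain n m.
Proof. by move/eqP. Qed.

Lemma Z2_pattern_exists : exists (C : int -> int -> circle R) (f : nat -> nat -> R * R),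
  Z2_pattern x C /\ discrete_map C f.
Proof.
have line : ~~ Z2_domain 0 0 -> rotate x (zdir x 0 1) = zdir x 1 0 /\
  dot (grid_map x (zrho x) (zdir x) 0 1 - grid_map x (zrho x) (zdir x) 1 0) (zdir x 1 0) = 0 by [].
have [pat map] := grid_map_pattern x_bounds (Z2_grid x_bounds) Z2_off line.
eexists; eexists; split; last exact: map.
split=> //; exists (radius_fun x); split.
- move=> N M /inV_grid[n [m [En Em _]]].
  by rewrite (lattice_circleE _ En Em) /grid_circle /= (radius_fun_zrho En Em).
- exact: radius_fun_eqA.
- exact: radius_fun_eqB.
exact: radius_fun_init.
Qed.

Lemma Z2_pattern_radius C : Z2_pattern x C -> forall N M n m,
  N + M = n%:Z -> M - N = m%:Z -> ~~ odd (n + m) -> Defs.radius (C N M) = (zrho x n m)%:E.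
Proof.
move=> [_ [r [Cr rA rB rI]]] N M n m En Em ev.
have V : inV N M by rewrite /inV; lia.
by rewrite Cr // (radius_unique x_bounds rA rB rI V) (radius_fun_zrho En Em).
Qed.

Lemma Log_pattern_radius C : Log_pattern x C -> forall N M n m,
  N + M = n%:Z -> M - N = m%:Z -> ~~ odd (n + m) ->
  Defs.radius (C N M) = if Log_domain n m then (zrho x n m)^-1%:E else +oo%E.
Proof.
move=> [_ [C0 [/Z2_pattern_radius r0 Cr]]] N M n m En Em ev.
rewrite Cr; last by rewrite /inV; lia.
rewrite (r0 _ _ _ _ En Em ev) inver; case: ifP => [/eqP z0|/negbT z0].
  case: ifP => // /eqP nm; have := zrho_gt0 x_bounds ev; move=> /(_ nm).
  by rewrite z0 ltxx.
case: ifP => // /negbFE/eqP[n0 m0]; move: z0.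
by rewrite n0 m0 /zrho /= rad0 eqxx.
Qed.

Lemma Log_pattern_exists : exists (C : int -> int -> circle R) (f : nat -> nat -> R * R),
  Log_pattern x C /\ discrete_map C f.
Proof.
pose rho n m := (zrho x n m)^-1; pose U n m := conjv (zdir x n m).
have line : ~~ Log_domain 0 0 -> rotate x (U 0 1) = U 1 0 /\
  dot (grid_map x rho U 0 1 - grid_map x rho U 1 0) (U 1 0) = 0.
  move=> _; have E := cos2Dsin2 x; split.
    apply: eq_vec; rewrite /U /zdir /rotate /mirror /rotate /conjv /=; last by ring.
    by rewrite -[RHS]E; ring.
  rewrite /grid_map !big_ord0 big_ord1 /hor_edge /ver_edge /= !scalev.
  by rewrite /U /zdir /mirror /rotate /conjv /dot /=; ring.
have [pat map] := grid_map_pattern x_bounds (Log_grid x_bounds) Log_off line.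
have [C0 [f0 [Z2 _]]] := Z2_pattern_exists.
eexists; eexists; split; last exact: map.
split=> //; exists C0; split=> // N M V; have [n [m [En Em ev]]] := inV_grid V.
rewrite (Z2_pattern_radius Z2 En Em ev) inver (lattice_circleE _ En Em) /grid_circle.
case: ifP => [Dn|/negbFE/eqP[n0 m0]]; last by rewrite n0 m0 /zrho /= rad0 eqxx.
have z0 := zrho_gt0 x_bounds ev (elimN eqP Dn).
by rewrite gt_eqF.
Qed.

End Existence.

(** * Rigidity *)

Section Angles.
Variables (R : realType) (x : R).
Hypothesis x_bounds : 0 < x < pi.
Implicit Types (u v p q c d : R * R) (r s : R).
Local Notation rot := (rotate x).

Lemma dotC u v : dot u v = dot v u.
Proof. by rewrite /dot; ring. Qed.

Lemma rim_normal c r p : rim (Circle c r) p -> dot (c - p) (c - p) = r ^+ 2.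
Proof. by move=> <-; rewrite enorm_sqr /dot /=; ring. Qed.

(** By the law of cosines the product of the normals depends only on the radii and the distance of
    the centres, so the angle known at one common point holds at every other one. *)
Lemma intersect_dot (theta : R) c r d s p : 0 <= theta <= pi -> 0 < r -> 0 < s ->
  intersect_at_angle theta (Circle c r) (Circle d s) ->
  rim (Circle c r) p -> rim (Circle d s) p ->
  dot (c - p) (d - p) = - cos theta * (r * s).
Proof.
move=> t_b r0 s0 [q [rq sq ang]] /rim_normal rp /rim_normal sp.
have {ang} := ang _ _; rewrite /= !lte_fin => /(_ r0 s0).
move: rq sq => /rim_normal rq /rim_normal sq.
have en (a : R) v : 0 < a -> dot v v = a ^+ 2 -> enorm v = a.
  by move=> a0 E; rewrite /enorm E sqrtr_sqr gtr0_norm.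
rewrite /corner_angle /angle /= (en _ _ r0 rq) (en _ _ s0 sq).
set y := _ / (r * s) => ang.
have rs : r * s != 0 by rewrite mulf_neq0 // gt_eqF.
have Ey : dot (c - q) (d - q) = y * (r * s) by rewrite /y divfK.
have -> : dot (c - p) (d - p) = dot (c - q) (d - q).
  have pol w : dot (c - d) (c - d) = dot (c - w) (c - w) + dot (d - w) (d - w) - 2 * dot (c - w) (d - w).
    by rewrite /dot /=; ring.
  have := pol p; have := pol q; rewrite rp sp rq sq; lra.
rewrite Ey; congr (_ * _).
have y1 : -1 <= y <= 1.
  rewrite -ler_norml -(@ler_pXn2r _ 2) ?nnegrE ?normr_ge0 // expr1n real_normK ?num_real //.
  have rs2 : 0 < (r * s) ^+ 2 by rewrite exprn_gt0 // mulr_gt0.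
  rewrite -(ler_pM2r rs2) mul1r -exprMn -Ey exprMn -rq -sq /dot.
  have := sqr_ge0 (det2 (c - q) (d - q)); rewrite /det2.
  set a := (c - q).1; set b := (c - q).2; set e := (d - q).1; set g := (d - q).2 => h.
  rewrite -subr_ge0; apply: le_trans h _; rewrite le_eqVlt; apply/orP; left; apply/eqP; ring.
have -> : y = cos (pi - theta) by rewrite -ang subKr acosK // in_itv.
by rewrite cosB cospi sinpi; ring.
Qed.

Lemma rot_eq u v : dot u u = 1 -> dot v v = 1 -> dot u v = cos x -> 0 < det2 u v -> v = rot u.
Proof.
move=> u1 v1 uv d0; have s0 := sin_gt0_pi x_bounds.
have d : det2 u v = sin x.
  apply/eqP; rewrite -(@eqrXn2 _ 2) ?ltW //; apply/eqP.
  have -> : det2 u v ^+ 2 = dot u u * dot v v - dot u v ^+ 2 by rewrite /det2 /dot; ring.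
  by rewrite u1 v1 uv mulr1 -(cos2Dsin2 x); ring.
have E1 : v.1 = dot u u * v.1 by rewrite u1 mul1r.
have E2 : v.2 = dot u u * v.2 by rewrite u1 mul1r.
by apply: eq_vec; [rewrite [LHS]E1|rewrite [LHS]E2]; rewrite /rotate /= -d -uv /dot /det2; ring.
Qed.

Lemma rot_inj u v : rot u = rot v -> u = v.
Proof.
case: u => a b; case: v => c d [E1 E2]; have E := cos2Dsin2 x.
have H (y : R) : y = (cos x ^+ 2 + sin x ^+ 2) * y by rewrite E mul1r.
apply: eq_vec => /=; rewrite [LHS]H [RHS]H.
  have := congr1 (fun y => cos x * y) E1; have := congr1 (fun y => sin x * y) E2; simpl; lra.
have := congr1 (fun y => - sin x * y) E1; have := congr1 (fun y => cos x * y) E2; simpl; lra.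
Qed.

Lemma rot_eq_scaled (a b : R) u v : 0 < a -> 0 < b -> dot u u = a ^+ 2 -> dot v v = b ^+ 2 ->
  dot u v = cos x * (a * b) -> 0 < det2 u v -> b^-1 *: v = rot (a^-1 *: u).
Proof.
move=> a0 b0 u1 v1 uv d0.
have [an bn] : a != 0 /\ b != 0 by rewrite !gt_eqF.
apply: rot_eq; rewrite ?dotZ ?u1 ?v1 ?uv ?det2Z; try by field.
  by field; rewrite an bn.
by rewrite !mulr_gt0 // invr_gt0.
Qed.

(** Multiplication by the complex number a + b e^{ix}, nonzero as soon as [b] is. *)
Definition comb (a b : R) u := a *: u + b *: rot u.

Lemma comb_inj (a b : R) u v : b != 0 -> comb a b u = comb a b v -> u = v.
Proof.
move=> b0 E; have s0 := sin_gt0_pi x_bounds.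
have {}E : comb a b (u - v) = 0.
  have -> : comb a b (u - v) = comb a b u - comb a b v; last by rewrite E subrr.
  by apply: eq_vec; rewrite /comb !scalev /rotate /=; ring.
apply/eqP; rewrite -subr_eq0; apply/eqP/dot_eq0; set w := u - v in E *.
have : ((a + b * cos x) ^+ 2 + (b * sin x) ^+ 2) * dot w w = 0.
  have -> : ((a + b * cos x) ^+ 2 + (b * sin x) ^+ 2) * dot w w = dot (comb a b w) (comb a b w).
    by rewrite /comb !scalev /rotate /dot /=; ring.
  by rewrite E /dot /= mul0r addr0.
move/eqP; rewrite mulf_eq0 => /orP[|/eqP//].
by rewrite gt_eqF // ltr_wpDl ?sqr_ge0 // lt_def sqr_ge0 andbT sqrf_eq0 mulf_neq0 // gt_eqF.
Qed.

Lemma cmul_comb g (a b : R) u : cmul g (comb a b u) = comb a b (cmul g u).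
Proof. by rewrite /comb cmulD !cmulZ cmul_rot. Qed.

Lemma comb_transfer g (a b a' b' : R) u v u' v' : b' != 0 ->
  comb a b u = comb a' b' v -> comb a b u' = comb a' b' v' -> u' = cmul g u -> v' = cmul g v.
Proof.
move=> b0 E E' Eu; apply: (comb_inj b0 (a := a')).
by rewrite -E' Eu -cmul_comb E cmul_comb.
Qed.

End Angles.

Section RigidDirections.
Variables (R : realType) (x : R).
Hypothesis x_bounds : 0 < x < pi.
Variables (rho : nat -> nat -> R) (u U : nat -> nat -> R * R).
Hypothesis rho_gt0 : forall n m, ~~ odd (n + m) -> (n, m) <> (0, 0)%N -> 0 < rho n m.
Hypothesis u_closed : forall n m, (n, m) <> (0, 0)%N -> grid_closed x rho u n m.
Hypothesis U_closed : forall n m, (n, m) <> (0, 0)%N -> grid_closed x rho U n m.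
Hypothesis u_unit : dot (u 1 0) (u 1 0) = 1.
Hypothesis U_unit : dot (U 1 0) (U 1 0) = 1.

Lemma closed_diag v n m : grid_closed x rho v n m -> odd (n + m) ->
  comb x (rho n.+1 m) (- rho n m.+1) (v n m) = comb x (rho n m.+1) (- rho n.+1 m) (v n.+1 m.+1).
Proof.
rewrite /grid_closed /hor_edge /ver_edge addSn addnS /= => + od; rewrite od /= => E.
rewrite /comb !scaleNr; apply/eqP; rewrite subr_eq addrAC eq_sym subr_eq.
by rewrite E addrC.
Qed.

Lemma closed_anti v n m : grid_closed x rho v n m -> ~~ odd (n + m) ->
  comb x (rho n m) (rho n.+1 m.+1) (v n.+1 m) = comb x (rho n.+1 m.+1) (rho n m) (v n m.+1).
Proof.
rewrite /grid_closed /hor_edge /ver_edge addSn addnS /= => + /negbTE od; rewrite od /= => E.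
by rewrite /comb E addrC.
Qed.

Lemma directions_rigid : exists2 g : R * R, dot g g = 1 &
  forall n m, odd (n + m) -> u n m = cmul g (U n m).
Proof.
(* The quotient of the two directions at (1, 0), the inverse of a unit vector being its
   conjugate. *)
pose g := cmul (u 1 0) (conjv (U 1 0)).
have cc : dot (conjv (U 1 0)) (conjv (U 1 0)) = 1 by rewrite -U_unit /dot /=; ring.
exists g.
  have -> : dot g g = dot (u 1 0) (u 1 0) * dot (conjv (U 1 0)) (conjv (U 1 0)).
    by rewrite /g cmul_dot.
  by rewrite u_unit cc mulr1.
pose Q n m := u n m = cmul g (U n m).
have diag n m : odd (n + m) -> Q n m -> Q n.+1 m.+1.
  move=> od; have nm : (n, m) <> (0, 0)%N by case=> n0 m0; move: od; rewrite n0 m0.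
  apply: (comb_transfer x_bounds _ (closed_diag (U_closed nm) od) (closed_diag (u_closed nm) od)).
  by rewrite oppr_eq0 gt_eqF // rho_gt0 // addSn /= od.
have anti1 n m : ~~ odd (n + m) -> (n, m) <> (0, 0)%N -> Q n.+1 m -> Q n m.+1.
  move=> ev nm.
  apply: (comb_transfer x_bounds _ (closed_anti (U_closed nm) ev) (closed_anti (u_closed nm) ev)).
  by rewrite gt_eqF // rho_gt0.
have anti2 n m : ~~ odd (n + m) -> (n, m) <> (0, 0)%N -> Q n m.+1 -> Q n.+1 m.
  move=> ev nm.
  apply: (comb_transfer x_bounds _ (esym (closed_anti (U_closed nm) ev))
    (esym (closed_anti (u_closed nm) ev))).
  by rewrite gt_eqF // rho_gt0 // addSn addnS /= negbK.
have Q10 : Q 1 0.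
  have E : u 1 0 = dot (U 1 0) (U 1 0) *: u 1 0 by rewrite U_unit scale1r.
  by rewrite /Q [LHS]E; apply: eq_vec; rewrite scalev /g /cmul /conjv /dot /=; ring.
(* The direct link from (1, 0) to (0, 1) is the quadrilateral at the origin, where no closing
   condition is given; the detour runs through (2, 1) and (1, 2). *)
have Q21 : Q 2 1 by apply: diag.
have Q12 : Q 1 2 by apply: anti1.
have diag_inv : Q 1 2 -> Q 0 1.
  have nm : (0, 1)%N <> (0, 0)%N by [].
  apply: (comb_transfer x_bounds _ (esym (closed_diag (U_closed nm) isT))
    (esym (closed_diag (u_closed nm) isT))).
  by rewrite oppr_eq0 gt_eqF // rho_gt0.
have Q01 := diag_inv Q12.
(* Inner points of an antidiagonal come from the previous odd one; its two end points come from
   their neighbours on the same antidiagonal. *)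
have layer k : forall n m, (n + m = k.*2.+1)%N -> Q n m.
  elim: k => [|k IHk].
    by case=> [|[|n]] [|[|m]] // E; exfalso; move: E; rewrite ?addSn ?addnS.
  have inner n m : (n.+1 + m.+1 = k.+1.*2.+1)%N -> Q n.+1 m.+1.
    by move=> E; apply: diag; [lia|apply: IHk; lia].
  case=> [|n] [|m] //.
    by move=> E; apply: anti1; [lia|case; lia|case: m E => [|m] E; [lia|apply: inner; lia]].
  - by move=> E; apply: anti2; [lia|case; lia|case: n E => [|n] E; [lia|apply: inner; lia]].
  exact: inner.
by move=> n m od; apply: (layer (n + m)./2); lia.
Qed.

End RigidDirections.

(** * Edges of an arbitrary pattern with given radii *)

Section PatternRigidity.
Variables (R : realType) (x : R).
Hypothesis x_bounds : 0 < x < pi.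
Local Notation rot := (rotate x).

Variables (rho : nat -> nat -> R) (C : int -> int -> circle R) (f : nat -> nat -> R * R).
Hypothesis rho_gt0 : forall n m, ~~ odd (n + m) -> (n, m) <> (0, 0)%N -> 0 < rho n m.
Hypothesis C_pattern : circle_pattern x C.
Hypothesis f_map : discrete_map C f.
Hypothesis C_radius : forall N M n m, N + M = n%:Z -> M - N = m%:Z -> ~~ odd (n + m) ->
  (n, m) <> (0, 0)%N -> Defs.radius (C N M) = (rho n m)%:E.

Lemma map_center N M n m : N + M = n%:Z -> M - N = m%:Z -> centered_at (C N M) (f n m).
Proof.
move=> En Em; have := f_map n m; case: ifP => [od|_]; first by exfalso; lia.
have -> : ((n%:Z - m%:Z) %/ 2)%Z = N by lia.
by have -> : ((n%:Z + m%:Z) %/ 2)%Z = M by lia.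
Qed.

Lemma map_circle N M n m : N + M = n%:Z -> M - N = m%:Z -> (n, m) <> (0, 0)%N ->
  C N M = Circle (f n m) (rho n m).
Proof.
move=> En Em nm; have ev : ~~ odd (n + m) by lia.
have := C_radius En Em ev nm; have := map_center En Em.
 by case: (C N M) => [c r|q d] //= -> [->].
Qed.

Section AtOddPoint.
Variables (N M : int) (n m : nat).
Hypotheses (En : N + M + 1 = n%:Z) (Em : M - N = m%:Z).

Let od : odd (n + m). Proof. lia. Qed.

Lemma map_point : cell_point C N M (f n m).
Proof.
have := f_map n m; rewrite od.
have -> : ((n%:Z - m%:Z - 1) %/ 2)%Z = N by lia.
by have -> : ((n%:Z + m%:Z - 1) %/ 2)%Z = M by lia.
Qed.

Lemma rim_disc (g : circle R) p : rim g p -> disc g p.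
Proof. by case: g => [c r|q d] /= ->. Qed.

Lemma tangent_unique (g h : circle R) p q : tangent_disjoint g h ->
  rim g p -> rim h p -> rim g q -> rim h q -> p = q.
Proof.
move=> [y [_ _ E]] /rim_disc gp /rim_disc hp /rim_disc gq /rim_disc hq.
have : (disc g `&` disc h) p by []. have : (disc g `&` disc h) q by [].
by rewrite E => -> ->.
Qed.

Let V_up : inV N (M + 1). Proof. rewrite /inV; lia. Qed.
Let V_right : inV (N + 1) (M + 1). Proof. rewrite /inV; lia. Qed.

(** The point supplied by [cp_cell] and [f n m] lie on the same two tangent circles of the cell, so
    they coincide. If z is outside the lattice, the pair z + 1, z + i replaces z, z + 1 + i. *)
Lemma map_cell :
  [/\ ccw C (f n m) (N, M) (N + 1, M), ccw C (f n m) (N + 1, M) (N + 1, M + 1),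
      ccw C (f n m) (N + 1, M + 1) (N, M + 1) & ccw C (f n m) (N, M + 1) (N, M)].
Proof.
have [p [pt c1 c2 c3 c4]] := @cp_cell _ _ _ C_pattern N M (introT andP (conj V_up V_right)).
suff <- : p = f n m by [].
have fpt := map_point.
have [V|NV] := boolP (inV N M).
  apply: (tangent_unique (cp_tangent_right C_pattern V V_right)).
  - by apply: pt => //; lia.
  - by apply: pt => //; lia.
  - by apply: fpt => //; lia.
  - by apply: fpt => //; lia.
have V : inV (N + 1) M by move: NV; rewrite /inV; lia.
have V' : inV (N + 1 - 1) (M + 1) by rewrite addrK.
apply: (tangent_unique (cp_tangent_left C_pattern V V')); rewrite ?addrK.
- by apply: pt => //; lia.
- by apply: pt => //; lia.
- by apply: fpt => //; lia.
- by apply: fpt => //; lia.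
Qed.

Definition direction k l : R * R := (rho k.+1 l)^-1 *: (f k.+1 l - f k l).
Local Notation u := (direction n m).

Let right_gt0 : 0 < rho n.+1 m.
Proof. by apply: rho_gt0 => //; rewrite addSn /= od. Qed.

Let up_gt0 : 0 < rho n m.+1.
Proof. by apply: rho_gt0 => //; rewrite addnS /= od. Qed.

Let right_circle_map : C (N + 1) (M + 1) = Circle (f n.+1 m) (rho n.+1 m).
Proof. by apply: map_circle => //; lia. Qed.

Let up_circle_map : C N (M + 1) = Circle (f n m.+1) (rho n m.+1).
Proof. by apply: map_circle => //; lia. Qed.

Let right_rim : rim (Circle (f n.+1 m) (rho n.+1 m)) (f n m).
Proof. by rewrite -right_circle_map; apply: map_point => //; lia. Qed.

Let up_rim : rim (Circle (f n m.+1) (rho n m.+1)) (f n m).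
Proof. by rewrite -up_circle_map; apply: map_point => //; lia. Qed.

Lemma direction_unit : dot u u = 1.
Proof.
have r0 : rho n.+1 m != 0 by rewrite gt_eqF.
by rewrite /direction dotZ (rim_normal right_rim); field.
Qed.

Lemma direction_right : f n.+1 m - f n m = rho n.+1 m *: u.
Proof. by rewrite /direction scalerA divff ?scale1r // gt_eqF. Qed.

Lemma direction_up : f n m.+1 - f n m = rho n m.+1 *: rot u.
Proof.
have [_ _ c3 _] := map_cell.
have := c3 V_right V_up; rewrite /= right_circle_map up_circle_map /= !lte_fin.
move=> /(_ right_gt0 up_gt0) d.
have hz := cp_horizontal C_pattern V_up V_right; rewrite up_circle_map right_circle_map in hz.
have b : 0 <= pi - x <= pi by rewrite subr_ge0 gerBl andbC !ltW //; case/andP: x_bounds.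
have := intersect_dot b up_gt0 right_gt0 hz up_rim right_rim.
rewrite dotC => E.
rewrite -(rot_eq_scaled x_bounds right_gt0 up_gt0 (rim_normal right_rim) (rim_normal up_rim) _ d).
  by rewrite scalerA divff ?scale1r // gt_eqF.
by rewrite E cosB cospi sinpi; ring.
Qed.

(** The upper direction is the rotation both of [u] and, by the vertical intersection angle, of the
    direction of the left edge; hence the two horizontal edges at an odd point are collinear. *)
Lemma direction_left : (0 < n)%N -> (n.-1, m) <> (0, 0)%N -> f n m - f n.-1 m = rho n.-1 m *: u.
Proof.
move=> n0 nm.
have V : inV N M by rewrite /inV; lia.
have l0 : 0 < rho n.-1 m by apply: rho_gt0 => //; lia.
have EL : C N M = Circle (f n.-1 m) (rho n.-1 m) by apply: map_circle => //; lia.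
have lr : rim (Circle (f n.-1 m) (rho n.-1 m)) (f n m) by rewrite -EL; apply: map_point => //; lia.
have [_ _ _ c4] := map_cell.
have := c4 V_up V; rewrite /= EL up_circle_map /= !lte_fin => /(_ up_gt0 l0) d.
have vt := cp_vertical C_pattern V V_up; rewrite up_circle_map EL in vt.
have b : 0 <= x <= pi by case/andP: x_bounds => /ltW-> /ltW->.
have := intersect_dot b l0 up_gt0 vt lr up_rim => E.
have := rim_normal lr; rewrite -opprB dotNN => lr'.
have := rot_eq_scaled x_bounds l0 up_gt0 lr' (rim_normal up_rim).
rewrite direction_up scalerA mulVf ?gt_eqF // scale1r => H.
rewrite (rot_inj (H _ _)) ?scalerA ?divff ?scale1r ?gt_eqF //.
  rewrite -direction_up -[RHS]opprK -mulNr -E -opprB /dot /=; ring.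
by move: d; rewrite direction_up -opprB /det2 /=; lra.
Qed.

Lemma direction_down : (0 < m)%N -> (n, m.-1) <> (0, 0)%N -> f n m - f n m.-1 = rho n m.-1 *: rot u.
Proof.
move=> m0 nm.
have V : inV (N + 1) M by rewrite /inV; lia.
have l0 : 0 < rho n m.-1 by apply: rho_gt0 => //; lia.
have EL : C (N + 1) M = Circle (f n m.-1) (rho n m.-1) by apply: map_circle => //; lia.
have lr : rim (Circle (f n m.-1) (rho n m.-1)) (f n m) by rewrite -EL; apply: map_point => //; lia.
have [_ c2 _ _] := map_cell.
have := c2 V V_right; rewrite /= EL right_circle_map /= !lte_fin => /(_ l0 right_gt0) d.
have vt := cp_vertical C_pattern V V_right; rewrite right_circle_map EL in vt.
have b : 0 <= x <= pi by case/andP: x_bounds => /ltW-> /ltW->.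
have := intersect_dot b l0 right_gt0 vt lr right_rim => E.
have := rim_normal lr; rewrite -opprB dotNN => lr'.
rewrite -(rot_eq_scaled x_bounds right_gt0 l0 (rim_normal right_rim) lr').
- by rewrite scalerA divff ?scale1r // gt_eqF.
- rewrite [_ * rho _ _.-1]mulrC -[RHS]opprK -mulNr -E -opprB /dot /=; ring.
by move: d; rewrite -opprB /det2 /=; lra.
Qed.

End AtOddPoint.

Lemma pattern_edges n m : (n, m) <> (0, 0)%N ->
  f n.+1 m - f n m = hor_edge rho direction n m /\ f n m.+1 - f n m = ver_edge x rho direction n m.
Proof.
have int_point k l : odd (k + l) -> exists N M : int, N + M + 1 = k%:Z /\ M - N = l%:Z.
  by move=> od; exists ((k%:Z - l%:Z - 1) %/ 2)%Z, ((k%:Z + l%:Z - 1) %/ 2)%Z; lia.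
move=> nm; rewrite /hor_edge /ver_edge; case: ifP => od.
  have [N [M [En Em]]] := int_point _ _ od.
  by split; [exact: direction_right En Em|exact: direction_up En Em].
have odr : odd (n.+1 + m) by rewrite addSn /= od.
have odu : odd (n + m.+1) by rewrite addnS /= od.
have [N [M [En Em]]] := int_point _ _ odr; have [N' [M' [En' Em']]] := int_point _ _ odu.
split; first exact: (direction_left En Em).
exact: (direction_down En' Em').
Qed.

Lemma pattern_direction_unit : dot (direction 1 0) (direction 1 0) = 1.
Proof. by apply: (@direction_unit 0 0 1 0). Qed.

Lemma pattern_closed n m : (n, m) <> (0, 0)%N -> grid_closed x rho direction n m.
Proof.
move=> nm; rewrite /grid_closed.
have [<- <-] := pattern_edges nm.
have [|_ <-] := @pattern_edges n.+1 m; first by [].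
have [|<- _] := @pattern_edges n m.+1; first by [].
by rewrite [LHS]addrC [RHS]addrC !addrA !subrK.
Qed.

Variables (U : nat -> nat -> R * R) (D : nat -> nat -> bool).
Hypothesis gp : grid_pattern x rho U D.
Hypothesis D_off_origin : forall n m, (n, m) <> (0, 0)%N -> D n m.
Hypothesis origin : D 0 0 -> rho 0 0 = 0 /\ Defs.radius (C 0 0) = 0%:E.

Lemma pattern_embedded : embedded D f.
Proof.
have [g g1 uU] : exists2 g : R * R, dot g g = 1 &
    forall n m, odd (n + m) -> direction n m = cmul g (U n m).
  apply: (directions_rigid x_bounds rho_gt0 pattern_closed).
  - by move=> n m nm; apply: gp_closed gp _ _ (D_off_origin nm).
  - exact: pattern_direction_unit.
  - exact: gp_unit gp _ _ _.
have off n m : D n m -> D n.+1 m /\ D n m.+1 by move=> _; split; apply: D_off_origin.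
apply: (embedded_of_edges x_bounds gp _ _ g1).
- by move=> n m /off[].
- by move=> n m /off[].
move=> n m Dn; have [[n0 m0]|nm] := pselect ((n, m) = (0, 0)%N).
  rewrite n0 m0 in Dn *; have [r0 R0] := origin Dn.
  (* A circle of radius 0 reduces to its centre, so both edges at the origin vanish, as they do in
     the grid. *)
  have E (p : R * R) : rim (C 0 0) p -> p = f 0 0.
    have := @map_center 0 0 0 0 erefl erefl.
    case: (C 0 0) R0 => [c r [->] /= ->|q d //] e0.
    have := enorm_sqr (p - c); rewrite e0 expr0n /= => /esym/dot_eq0/eqP.
    by rewrite subr_eq0 => /eqP.
  have -> : f 1 0 = f 0 0 by apply: E; apply: (@map_point 0 0 1 0).
  have -> : f 0 1 = f 0 0 by apply: E; apply: (@map_point (-1) 0 0 1).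
  by rewrite subrr /hor_edge /ver_edge /= r0 !scale0r; split; apply: eq_vec; rewrite /cmul /=; ring.
have [-> ->] := pattern_edges nm.
rewrite /hor_edge /ver_edge; case: ifP => od; rewrite uU ?cmulZ ?cmul_rot //.
  by rewrite uU ?cmul_rot // addnS /= od.
by rewrite addSn /= od.
Qed.

End PatternRigidity.

Section Embedding.
Variables (R : realType) (x : R).
Hypothesis x_bounds : 0 < x < pi.

Lemma Z2_embedded (C : int -> int -> circle R) f :
  Z2_pattern x C -> discrete_map C f -> embedded Z2_domain f.
Proof.
move=> Z2 Cf; have radC := Z2_pattern_radius x_bounds Z2.
have z0 : zrho x 0 0 = 0 by rewrite /zrho /= rad0.
apply: (@pattern_embedded _ _ x_bounds (zrho x) C f _ Z2.1 Cf _ (zdir x)).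
- exact: zrho_gt0.
- by move=> N M n m En Em ev _; exact: radC.
- exact: Z2_grid.
- by [].
by rewrite (radC 0 0 0%N 0%N) // z0.
Qed.

Lemma Log_embedded (C : int -> int -> circle R) f :
  Log_pattern x C -> discrete_map C f -> embedded Log_domain f.
Proof.
move=> Lg Cf; have radC := Log_pattern_radius x_bounds Lg.
apply: (@pattern_embedded _ _ x_bounds (fun n m => (zrho x n m)^-1) C f _ Lg.1 Cf _
  (fun n m => conjv (zdir x n m))).
- by move=> n m ev nm; rewrite invr_gt0 zrho_gt0.
- by move=> N M n m En Em ev /eqP nm; rewrite (radC _ _ _ _ En Em ev) /Log_domain nm.
- exact: Log_grid.
- by move=> n m /eqP.
by [].
Qed.

End Embedding.

Theorem theorem2 (R : realType) (alpha : R) (halpha : 0 < alpha < pi) :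
  ((exists (C : int -> int -> circle R) (f : nat -> nat -> R * R),
      Z2_pattern alpha C /\ discrete_map C f) /\
   (forall (C : int -> int -> circle R) (f : nat -> nat -> R * R),
      Z2_pattern alpha C -> discrete_map C f -> embedded Z2_domain f)) /\
  ((exists (C : int -> int -> circle R) (f : nat -> nat -> R * R),
      Log_pattern alpha C /\ discrete_map C f) /\
   (forall (C : int -> int -> circle R) (f : nat -> nat -> R * R),
      Log_pattern alpha C -> discrete_map C f -> embedded Log_domain f)).
Proof.
split; split.
- exact: Z2_pattern_exists.
- exact: Z2_embedded.
- exact: Log_pattern_exists.
exact: Log_embedded.
Qed.
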